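(* Let $a\neq 0$ be a real number and, for $a\ne 1$, put $b:=\frac{a+1}{a-1}$. An admissible translational surface $r(u,v)=\alpha(u)+\beta(v)$ formed by a planar curve $\alpha$ and another curve $\beta$ in $\mathbb{R}^3$ has a constant ratio $a$ of isotropic principal curvatures if and only if it is isotropic similar to a subset of one of the following surfaces: $$r_a(u,v)=\begin{bmatrix}u\\ v\\ v^2+au^2\end{bmatrix},\qquad (u,v)\in\mathbb{R}^2;$$ $$r_b(u,v)=\begin{bmatrix} v+b\cos v\\ b\sin v+(b^2-1)\log|b-\sin v|+(1-b^2)u\\ \exp u\end{bmatrix},\qquad \text{if } a\neq 1,$$ where $u$ runs through $\mathbb{R}$ and $v$ runs through an interval on which $\sin v\neq b$ (for $a<0$), respectively $b\sin v\neq 1$ (for $a>0$); $$r(u,v)=\begin{bmatrix} u+v\\ \log|\cos u|-\log|\cos v|\\ u\end{bmatrix},\qquad \text{if } a=-1,$$ where $(u,v)$ runs through a subdomain of $(-\pi/2,\pi/2)^2\setminus\{u+v=0\}$. In particular, $\beta$ must be a planar curve as well.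
   Context: We work in $\mathbb{R}^3$ with coordinates $x,y,z$; ''isotropic'' or ''vertical'' means parallel to the $z$-axis. A surface is an embedded connected 2-dimensional $C^3$ submanifold of $\mathbb{R}^3$, possibly with boundary and possibly non-compact (for instance the image of a proper injective $C^3$ map of a closed planar domain with nondegenerate differential). A surface is admissible if none of its tangent planes is parallel to the $z$-axis; it is then locally a graph $z=f(x,y)$. The isotropic principal curvatures $\kappa_1,\kappa_2$ at a point are the eigenvalues of the Hessian $\nabla^2 f$; the isotropic mean and Gaussian curvatures are $H=\frac{\kappa_1+\kappa_2}{2}=\frac{f_{xx}+f_{yy}}{2}$ and $K=\kappa_1\kappa_2=f_{xx}f_{yy}-f_{xy}^2$. An admissible surface has a constant ratio $a$ of isotropic principal curvatures if $K\neq0$ and ($\kappa_1/\kappa_2=a$ or $\kappa_2/\kappa_1=a$) at each of its points; equivalently, $K\ne 0$ and $H^2/K=(a+1)^2/(4a)$. A general isotropic similarity is an invertible affine map $\mathbf{x}\mapsto A\mathbf{x}+\mathbf{b}$ of $\mathbb{R}^3$ with $A=\begin{pmatrix}\pm h_1&\mp h_2&0\\ h_2&h_1&0\\ c_1&c_2&c_3\end{pmatrix}$, $\mathbf b\in\mathbb{R}^3$, $h_1,h_2,c_1,c_2,c_3\in\mathbb{R}$ (these are the affine maps scaling the semi-norm $\sqrt{x^2+y^2}$ by a constant factor). Two sets are isotropic similar if some general isotropic similarity takes one to the other. If $\alpha(u)$ and $\beta(v)$ are two curves in $\mathbb{R}^3$, the surface $r(u,v)=\alpha(u)+\beta(v)$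 is called the translational surface formed by $\alpha$ and $\beta$. *)

(* Defs.v *)
From HB Require Import structures.
From mathcomp Require Import all_boot all_order all_algebra.
From mathcomp Require Import all_classical all_reals all_analysis.

Set Implicit Arguments.
Unset Strict Implicit.
Unset Printing Implicit Defensive.
Import Order.TTheory GRing.Theory Num.Theory.
Import numFieldNormedType.Exports.
Local Open Scope classical_set_scope.
Local Open Scope ring_scope.

(* [class_C n U f] is meant for an open set U of a finite-dimensional space:
   all iterated directional derivatives of f up to order n exist and are
   continuous on U, which is then equivalent to f being C^n on U. *)
Fixpoint class_C (R : realType) (V W : normedModType R) (n : nat)
    (U : set V) (f : V -> W) : Prop :=
  (forall x, U x -> {for x, continuous f}) /\
  if n is n'.+1 then
    forall w : V, (forall x, U x -> derivable f x w) /\ class_C n' U ('D_w f)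
  else True.

Section IsotropicGeometry.
Variable R : realType.

Notation point3 := 'cV[R]_3.
Notation point2 := 'cV[R]_2.

Definition vec3 (x y z : R) : point3 := \col_(i < 3) [:: x; y; z]`_i.

Definition e_z : point3 := delta_mx ord_max 0.

Definition topview (p : point3) : point2 := @usubmx R 2 1 1 p.

Definition height (p : point3) : R := p ord_max 0.

(** Curves and translational surfaces *)

Definition nondegenerate_interval (I : set R) : Prop :=
  is_interval I /\ exists s t, [/\ I s, I t & s < t].

(* I may contain its endpoints; being C^3 there means extending as a C^3 map
   to a neighbourhood, so that the (two-sided) derivative of the extension is
   the one-sided derivative of the curve. *)
Definition C3_curve (I : set R) (alpha : R -> point3) : Prop :=
  exists U : set R, [/\ open U, I `<=` U & class_C 3 U alpha].

Definition planar_curve (I : set R) (alpha : R -> point3) : Prop :=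
  exists (n : 'rV[R]_3) (d : R),
    n != 0 /\ forall u, I u -> n *m alpha u = d%:M.

Definition translational_set (I J : set R) (alpha beta : R -> point3) :
  set point3 := [set alpha u + beta v | u in I & v in J].

(* The last clause says that r(u,v) = alpha(u) + beta(v) is injective on
   I x J with continuous inverse; together with [free] it makes the image an
   embedded surface (with boundary when I or J contains an endpoint). *)
Definition translational_surface (I J : set R) (alpha beta : R -> point3) :
    Prop :=
  [/\ nondegenerate_interval I /\ nondegenerate_interval J,
      C3_curve I alpha /\ C3_curve J beta,
      forall u v, I u -> J v -> free [:: derive1 alpha u; derive1 beta v] &
      forall u v, I u -> J v -> forall W : set (R * R), nbhs (u, v) W ->
        \forall p \near alpha u + beta v,
          forall u' v', I u' -> J v' -> p = alpha u' + beta v' -> W (u', v')].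

Definition tangent_plane (alpha beta : R -> point3) (u v : R) :
  {vspace point3} := <<[:: derive1 alpha u; derive1 beta v]>>%VS.

Definition admissible (I J : set R) (alpha beta : R -> point3) : Prop :=
  forall u v, I u -> J v -> e_z \notin tangent_plane alpha beta u v.

(** Isotropic principal curvatures *)

Definition local_graph (S : set point3) (p : point3) (f : point2 -> R) : Prop :=
  (exists U : set point2, [/\ open U, U (topview p) & class_C 3 U f]) /\
  \forall q \near p, S q -> height q = f (topview q).

Definition hessian (f : point2 -> R) (x : point2) : 'M[R]_2 :=
  \matrix_(i < 2, j < 2) 'D_(delta_mx j 0) ('D_(delta_mx i 0) f) x.

(* The factorization of the characteristic polynomial says that k1, k2 are the
   eigenvalues of the Hessian counted with multiplicity. At a boundary point f
   is some C^3 extension of the surface, whose Hessian at the point does not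
   depend on the extension. *)
Definition isotropic_principal_curvatures (S : set point3) (p : point3)
    (k1 k2 : R) : Prop :=
  exists2 f, local_graph S p f &
    char_poly (hessian f (topview p)) = ('X - k1%:P) * ('X - k2%:P).

Definition constant_ratio (a : R) (S : set point3) : Prop :=
  forall p, S p -> exists k1 k2,
    [/\ isotropic_principal_curvatures S p k1 k2,
        k1 * k2 != 0 & k1 / k2 = a \/ k2 / k1 = a].

(** Isotropic similarities *)

Definition isotropic_matrix (s : bool) (h1 h2 c1 c2 c3 : R) : 'M[R]_3 :=
  \matrix_(i < 3, j < 3)
    (nth [::] [:: [:: (-1) ^+ s * h1; - ((-1) ^+ s * h2); 0];
                  [:: h2;             h1;                 0];
                  [:: c1;             c2;                 c3]] i)`_j.

Definition isotropic_similarity (T : point3 -> point3) : Prop :=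
  exists (s : bool) (h1 h2 c1 c2 c3 : R) (b : point3),
    let A := isotropic_matrix s h1 h2 c1 c2 c3 in
    A \in unitmx /\ T = (fun x => A *m x + b).

Definition isotropic_similar (S S' : set point3) : Prop :=
  exists2 T, isotropic_similarity T & T @` S = S'.

(** The model surfaces *)

Definition paraboloid (a : R) : set point3 :=
  [set vec3 u v (v ^+ 2 + a * u ^+ 2) | u in setT & v in setT].

Definition exp_surface (b : R) (V : set R) : set point3 :=
  [set vec3 (v + b * cos v)
            (b * sin v + (b ^+ 2 - 1) * ln `|b - sin v| + (1 - b ^+ 2) * u)
            (expR u) | u in setT & v in V].

Definition log_cos_surface (D : set (R * R)) : set point3 :=
  [set vec3 (uv.1 + uv.2) (ln `|cos uv.1| - ln `|cos uv.2|) uv.1 | uv in D].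

Definition exp_domain (a b : R) (V : set R) : Prop :=
  nondegenerate_interval V /\
  forall v, V v -> (a < 0 -> sin v != b) /\ (0 < a -> b * sin v != 1).

Definition log_cos_domain (D : set (R * R)) : Prop :=
  [/\ open D, connected D &
      forall u v, D (u, v) ->
        [/\ - (pi / 2) < u < pi / 2, - (pi / 2) < v < pi / 2 & u + v != 0]].

Definition model_surface (a : R) (M : set point3) : Prop :=
  [\/ M = paraboloid a,
      a != 1 /\ (let b := (a + 1) / (a - 1) in
                 exists2 V, exp_domain a b V & M = exp_surface b V) |
      a = -1 /\ (exists2 D, log_cos_domain D & M = log_cos_surface D)].

End IsotropicGeometry.

(* Main.v *)
Require Import Defs.
From mathcomp Require Import all_boot all_order all_algebra.
From mathcomp Require Import all_classical all_reals all_analysis.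
From mathcomp Require Import ring lra.
From mathcomp.real_closed Require Import complex.
Import Order.TTheory GRing.Theory Num.Theory.
Import numFieldNormedType.Exports.
Local Open Scope classical_set_scope.
Local Open Scope ring_scope.
Set Implicit Arguments.
Unset Strict Implicit.
Unset Printing Implicit Defensive.

(** Write A and B for the top views of the velocities of the two curves, and D for
    their determinant. If f is a local graph function of the surface, then
    differentiating f (alpha u + beta v) = height in u and in v shows that A and B
    are conjugate for the Hessian of f, and that the two diagonal entries of the
    Hessian in this frame are determinants of derivatives of the curves, divided
    by D ([hessian_sum]). So a constant ratio a of the principal curvatures is a
    quadratic equation between these determinants ([ratio_at]), and the equation
    and the families of models are preserved by isotropic similarities.

    From the equation to the models. A similarity makes the plane of the first
    curve vertical or horizontal.

    If it is vertical, the curve is a graph with slope G u, and the quotient of the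
    two diagonal entries does not depend on u, since for fixed v it is a continuous
    root of a fixed quadratic equation. Hence the variables separate
    ([vertical_plane_separated]) and G satisfies a linear equation with constant
    coefficients. Either the curve is a parabola, and the surface is part of the
    graph of a quadratic polynomial whose principal axes give the paraboloid
    ([separated_paraboloid]); or G is exponential, and the second curve is found by
    the rational parametrization of the quadratic relation
    ([separated_exponential]). In the second case the parametrization could break
    down only where the model curve is singular, and there a curve of class C^3
    cannot satisfy the relation.

    If the plane is horizontal and all B are parallel, the second curve is in a
    vertical plane and the previous case applies with the curves exchanged.
    Otherwise, by continuity, two vectors B are neither parallel nor orthogonal. For
    a <> 1 and a <> -1 the plane curvature of the first curve then satisfies two
    quadratic equations over the same interval of slopes. Eliminating it makes the
    product of two quadratic polynomials the square of a rational function, which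
    is impossible because they do not have the same complex roots
    ([no_common_conjugates]). For a = 1 conjugate directions are orthogonal, which
    is impossible for a turning A and a fixed B. For a = -1 the equation is linear
    and separates again; the top views of both curves are grim reapers
    ([log_cos_case]).

    From the models to the equation. Each model is a global graph of a smooth
    explicit function, or one involving a smooth inverse function in the second
    case ([graph_model]). Since the surface lies in such a graph, that function
    serves as its local graph function, and its Hessian is obtained from the two
    curves that generate the model ([constant_ratio_of_model]). *)

(** * Calculus on intervals *)

Section IntervalCalculus.
Variable R : realType.
Implicit Types (I : set R) (f g : R -> R).

Lemma is_derive_continuous f (x d : R) :
  is_derive x (1 : R) f d -> {for x, continuous f}.
Proof. by case=> /derivable1_diffP/differentiable_continuous. Qed.

Lemma is_derive_congr f (x d e : R) :
  is_derive x (1 : R) f d -> d = e -> is_derive x (1 : R) f e.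
Proof. by move=> fd <-. Qed.

Lemma is_derive_add f g (x d e : R) :
  is_derive x (1 : R) f d -> is_derive x (1 : R) g e ->
  is_derive x (1 : R) (fun z => f z + g z) (d + e).
Proof. by move=> fd ge; exact: is_deriveD. Qed.

Lemma is_derive_sub f g (x d e : R) :
  is_derive x (1 : R) f d -> is_derive x (1 : R) g e ->
  is_derive x (1 : R) (fun z => f z - g z) (d - e).
Proof. by move=> fd ge; exact: is_deriveB. Qed.

Lemma is_derive_opp f (x d : R) :
  is_derive x (1 : R) f d -> is_derive x (1 : R) (fun z => - f z) (- d).
Proof. by move=> fd; exact: is_deriveN. Qed.

Lemma is_derive_const (k x : R) : is_derive x (1 : R) (fun=> k) 0.
Proof. exact: is_derive_cst. Qed.

Lemma is_derive_ident (x : R) : is_derive x (1 : R) (fun z => z) 1.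
Proof. exact: is_derive_id. Qed.

Lemma is_derive_mul f g (x d e : R) :
  is_derive x (1 : R) f d -> is_derive x (1 : R) g e ->
  is_derive x (1 : R) (fun z => f z * g z) (d * g x + f x * e).
Proof.
move=> fd ge; apply: is_derive_congr (is_deriveM fd ge) _.
by rewrite addrC; congr (_ + _); rewrite mulrC.
Qed.

Lemma is_derive_sqr f (x d : R) : is_derive x (1 : R) f d ->
  is_derive x (1 : R) (fun z => f z ^+ 2) (2 * f x * d).
Proof.
move=> fd; apply: (is_derive_congr (is_derive_mul fd fd)); ring.
Qed.

Lemma is_derive_inv f (x d : R) : f x != 0 -> is_derive x (1 : R) f d ->
  is_derive x (1 : R) (fun z => (f z)^-1) (- d / f x ^+ 2).
Proof.
move=> fx fd; apply: (is_derive_congr (is_deriveV fx fd)).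
by rewrite mulNr -mulrN mulrC; congr (_ * _).
Qed.

Lemma is_derive_compose f g (x d e : R) :
  is_derive (g x) (1 : R) f d -> is_derive x (1 : R) g e ->
  is_derive x (1 : R) (fun z => f (g z)) (d * e).
Proof. by move=> fd ge; exact: is_derive1_comp. Qed.

Lemma nondegenerate_near I (u : R) (P : R -> Prop) :
  nondegenerate_interval I -> I u -> (\forall x \near u, P x) ->
  exists x, [/\ I x, x != u & P x].
Proof.
move=> [II [s [t [Is It st]]]] Iu /nbhs_ballP[e /= e0 eP].
suff [w [Iw wu]] : exists w, I w /\ w != u.
  have d0 : 0 < `|w - u| by rewrite normr_gt0 subr_eq0.
  pose k := Num.min 1 (e / 2 / `|w - u|).
  have k0 : 0 < k by rewrite lt_min ltr01 !divr_gt0.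
  have k1 : k <= 1 by rewrite ge_min lexx.
  exists (u + k * (w - u)); split.
  - case: (ltP u w) => uw.
      by apply: (II u w) => //; apply/andP; split; nra.
    by apply: (II w u) => //; apply/andP; split; nra.
  - by rewrite -subr_eq0 addrC addKr mulf_eq0 negb_or subr_eq0 wu gt_eqF.
  - apply: eP; rewrite /ball/= opprD addrA subrr add0r normrN normrM gtr0_norm//.
    rewrite -ltr_pdivlMr//; apply: le_lt_trans (_ : e / 2 / `|w - u| < _).
      by rewrite ge_min lexx orbT.
    by rewrite ltr_pM2r ?invr_gt0// ltr_pdivrMr// mulr2n mulrDr mulr1 ltrDl.
have [us|us] := eqVneq s u; last by exists s.
by exists t; split => //; rewrite -us gt_eqF.
Qed.

(** At an end of the interval the two-sided derivative of an extension is
    still determined by the values on the interval, which are the limits of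
    difference quotients from one side. *)
Lemma derive_eq_on I (u : R) f g (d e : R) :
  nondegenerate_interval I -> I u ->
  is_derive u (1 : R) f d -> is_derive u (1 : R) g e ->
  (\forall x \near u, I x -> f x = g x) -> d = e.
Proof.
move=> nI Iu fd ge fg; apply: contrapT => /eqP de.
have /is_derive1_caratheodory [h [hE hC hu]] :
  is_derive u (1 : R) (f - g) (d - e) by apply: is_deriveB.
have hN : \forall x \near u, h x != 0.
  by apply: (hC [set y | y != 0]); apply: open_nbhs_nbhs; split; [exact: open_neq|rewrite /= hu subr_eq0].
have [x [Ix xu [hx fgx]]] : exists x, [/\ I x, x != u & h x != 0 /\ (I x -> f x = g x)].
  by apply: nondegenerate_near => //; apply: filterI.
have := hE x; rewrite !fctE fgx// (_ : f u = g u) ?subrr; last first.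
  by have := nbhs_singleton fg; exact.
by move/esym/eqP; rewrite mulf_eq0 (negbTE hx) subr_eq0 (negbTE xu).
Qed.

Lemma derive_eq_onW I (u : R) f g (d e : R) :
  nondegenerate_interval I -> I u ->
  is_derive u (1 : R) f d -> is_derive u (1 : R) g e ->
  (forall x, I x -> f x = g x) -> d = e.
Proof.
move=> nI Iu fd gd fg; apply: (derive_eq_on nI Iu fd gd); near=> x; exact: fg.
Unshelve. all: by end_near.
Qed.

Lemma within_segment_continuous I f (s t : R) : is_interval I -> I s -> I t ->
  (forall x, I x -> {for x, continuous f}) -> {within `[s, t], continuous f}.
Proof.
move=> II Is It fC; apply: continuous_in_subspaceT => x.
rewrite inE/= in_itv => /andP[/= sx xt].
by apply: fC; apply: (II s t) => //; rewrite sx.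
Qed.

Lemma MVT_on I f (f' : R -> R) (s t : R) : is_interval I -> I s -> I t ->
  (forall x, I x -> is_derive x (1 : R) f (f' x)) ->
  exists2 c, I c & f t - f s = f' c * (t - s).
Proof.
move=> II; wlog st : s t / s <= t.
  move=> wl Is It fd; have [st|/ltW ts] := leP s t; first exact: wl.
  have [c Ic ec] := wl _ _ ts It Is fd.
  by exists c => //; rewrite -(opprB (f s)) ec -mulrN opprB.
move=> Is It fd.
have inI x : x \in `[s, t]%R -> I x.
  by rewrite in_itv => /andP[/= sx xt]; apply: (II s t) => //; rewrite sx.
have [c cst ec] : exists2 c, c \in `[s, t]%R & f t - f s = f' c * (t - s).
  apply: MVT_segment => // [x xst|].
    by apply: fd; apply: inI; exact: subset_itv_oo_cc.
  apply: (within_segment_continuous II) => // x Ix.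
  exact: is_derive_continuous (fd _ Ix).
by exists c => //; exact: inI.
Qed.

Lemma constant_on I f : is_interval I ->
  (forall x, I x -> is_derive x (1 : R) f 0) ->
  forall s t, I s -> I t -> f s = f t.
Proof.
move=> II fd s t Is It; have [c _ /eqP] := MVT_on II It Is fd.
by rewrite mul0r subr_eq0 => /eqP.
Qed.

Lemma injective_on I f (f' : R -> R) : is_interval I ->
  (forall x, I x -> is_derive x (1 : R) f (f' x)) ->
  (forall x, I x -> f' x != 0) ->
  forall s t, I s -> I t -> f s = f t -> s = t.
Proof.
move=> II fd f0 s t Is It fst; have [c Ic /esym/eqP] := MVT_on II It Is fd.
by rewrite fst subrr mulf_eq0 (negbTE (f0 _ Ic)) subr_eq0 => /eqP.
Qed.

Lemma IVT_on I f (s t v : R) : is_interval I -> I s -> I t ->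
  (forall x, I x -> {for x, continuous f}) -> f s <= v <= f t ->
  exists2 c, I c & f c = v.
Proof.
move=> II Is It fC /andP[fsv vft].
wlog st : f s t v Is It fC fsv vft / s <= t.
  move=> wl; have [st|/ltW ts] := leP s t; first exact: (wl f s t).
  have [||||||c Ic ec] := wl (fun x => - f x) t s (- v) => //.
  - by move=> x Ix; apply: continuousN; exact: fC.
  - by rewrite lerN2.
  - by rewrite lerN2.
  by exists c => //; apply: oppr_inj.
have [||c] := @IVT R f s t v st.
- exact: (within_segment_continuous II).
- by rewrite ge_min fsv le_max vft orbT.
rewrite in_itv => /andP[/= sc ct] fc; exists c => //.
by apply: (II s t) => //; rewrite sc.
Qed.

(** A continuous function on an interval which takes at most two values is
    constant, because otherwise it would take their mean value too. *)
Lemma two_valued_constant I f (s r : R) : is_interval I -> I s ->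
  (forall x, I x -> {for x, continuous f}) ->
  (forall x, I x -> f x = f s \/ f x = r) ->
  forall x, I x -> f x = f s.
Proof.
move=> II Is fC f2 x Ix; have [//|fx] := f2 x Ix.
have [-> //|ne] := eqVneq (f x) (f s).
pose m := (f s + f x) / 2.
have [c Ic fc] : exists2 c, I c & f c = m.
  case: (ltgtP (f x) (f s)) ne => // lt _.
    by apply: (@IVT_on _ f x s) => //; rewrite /m; apply/andP; split; lra.
  by apply: (@IVT_on _ f s x) => //; rewrite /m; apply/andP; split; lra.
have [e|e] := f2 c Ic; move: fc; rewrite e /m -?fx; move/eqP: ne => ne h;
  exfalso; apply: ne; lra.
Qed.

Lemma constant_sign_on I f : is_interval I ->
  (forall x, I x -> {for x, continuous f}) -> (forall x, I x -> f x != 0) ->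
  forall s t, I s -> I t -> 0 < f s -> 0 < f t.
Proof.
move=> II fC f0 s t Is It fs; rewrite lt_neqAle eq_sym f0//= leNgt.
apply/negP => ft; have [|c Ic fc] := @IVT_on _ f t s 0 II It Is fC.
  by rewrite !ltW.
by have := f0 _ Ic; rewrite fc eqxx.
Qed.

End IntervalCalculus.

Ltac derive_step :=
  first [ eassumption
        | eapply is_derive_const
        | eapply is_derive_ident
        | eapply is_derive_sub
        | eapply is_derive_add
        | eapply is_derive_opp
        | eapply is_derive_sqr
        | eapply is_derive_mul
        | eapply is_derive_inv
        | eapply (is_derive_compose (f := expR)); [exact: is_derive_expR|]
        | eapply (is_derive_compose (f := sin)); [exact: is_derive_sin|]
        | eapply (is_derive_compose (f := cos)); [exact: is_derive_cos|]
        | eapply (is_derive_compose (f := atan)); [exact: is_derive1_atan|] ].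

(** Leaves first the conditions that inverted functions do not vanish, then the
    equality of the computed derivative with the announced one. *)
Ltac derive_tac := eapply is_derive_congr; [repeat derive_step|cbv beta].

(** * The chain rule in the plane *)

Section PlaneChainRule.
Variable R : realType.

Lemma is_derive_line (V : normedModType R) (g : V -> R) (p w : V) (t : R) :
  derivable g (p + t *: w) w ->
  is_derive t (1 : R) (fun s => g (p + s *: w)) ('D_w g (p + t *: w)).
Proof.
have E : (fun h : R => h^-1 *: (((fun s => g (p + s *: w)) \o shift t) (h *: 1) - g (p + t *: w)))
   = (fun h : R => h^-1 *: ((g \o shift (p + t *: w)) (h *: w) - g (p + t *: w))).
  apply/funext => h /=; congr (_ *: (g _ - _)).
  by rewrite [_ *: 1]mulr1 scalerDl addrCA.
by move=> dg; split; rewrite /derivable /derive E.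
Qed.

(** The difference quotient along w, extended by its limit to t = 0. *)
Definition slope (V : normedModType R) (g : V -> R) (w p : V) (t : R) : R :=
  if t == 0 then 'D_w g p else (g (p + t *: w) - g p) / t.

Lemma slopeE (V : normedModType R) (g : V -> R) (w p : V) (t : R) :
  g (p + t *: w) = g p + slope g w p t * t.
Proof.
rewrite /slope; case: eqVneq => [->|t0]; first by rewrite scale0r mulr0 !addr0.
by rewrite divfK// [RHS]addrC subrK.
Qed.

(** By the mean value theorem a difference quotient is a value of the directional
    derivative at a nearby point, so it varies continuously even when its base
    point moves. *)
Lemma slope_continuous (V : normedModType R) (g : V -> R) (w p : V)
    (q : R -> V) (tau : R -> R) (u : R) :
  (\forall x \near p, derivable g x w) -> {for p, continuous ('D_w g)} ->
  {for u, continuous q} -> {for u, continuous tau} -> q u = p -> tau u = 0 ->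
  {for u, continuous (fun z => slope g w (q z) (tau z))}.
Proof.
move=> dg Dc qc tc qu tu.
have s0 : slope g w p 0 = 'D_w g p by rewrite /slope eqxx.
apply/cvgrPdist_lt => e e0; rewrite qu tu s0.
have /nbhs_ballP[d /= d0 dP] : \forall x \near p,
    derivable g x w /\ `|'D_w g p - 'D_w g x| < e.
  by apply: filterI => //; move/cvgrPdist_lt : Dc; exact.
have d20 : 0 < d / 2 by rewrite divr_gt0.
have qn : \forall z \near u, `|p - q z| < d / 2.
  by move/cvgrPdist_lt : qc; rewrite qu; apply.
have tn : \forall z \near u, `|tau z| * `|w| < d / 2.
  have w1 : 0 < `|w| + 1 by rewrite ltr_wpDl.
  have tn0 : \forall z \near u, `|tau u - tau z| < d / 2 / (`|w| + 1).
    by move/cvgrPdist_lt : tc; apply; rewrite divr_gt0.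
  apply: filterS tn0 => z; rewrite tu sub0r normrN ltr_pdivlMr//.
  by move=> h; apply: le_lt_trans h; rewrite ler_wpM2l// lerDl.
near=> z.
have qz : `|p - q z| < d / 2 by near: z.
have tz : `|tau z| * `|w| < d / 2 by near: z.
have bz s : `|s| <= `|tau z| -> ball p d (q z + s *: w).
  move=> st; rewrite -ball_normE /ball_/= opprD addrA (splitr d).
  apply: le_lt_trans (ler_normB _ _) _; rewrite ltrD//.
  by rewrite normrZ; apply: le_lt_trans tz; rewrite ler_wpM2r.
have [|tz0] := eqVneq (tau z) 0.
  move=> tz0; rewrite /slope tz0 eqxx.
  by have /dP[] := bz 0 ltac:(by rewrite normr0); rewrite scale0r addr0.
pose I : set R := [set s | `|s| <= `|tau z|].
have II : is_interval I.
  move=> s t /= Is It x /andP[sx xt]; rewrite /I/= ler_norml.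
  by move: Is It; rewrite /I/= !ler_norml; lra.
have [||s|c Ic] := @MVT_on R I (fun s => g (q z + s *: w))
    (fun s => 'D_w g (q z + s *: w)) 0 (tau z) II.
- by rewrite /I/= normr0.
- by rewrite /I/=.
- by move=> Is; apply: is_derive_line; have /dP[] := bz _ Is.
rewrite scale0r addr0 subr0 /slope (negbTE tz0) => ->.
by rewrite mulfK//; have /dP[] := bz _ Ic.
Unshelve. all: by end_near. Qed.

Definition vec2 (x y : R) : 'cV[R]_2 := \col_(i < 2) [:: x; y]`_i.

Definition e0 : 'cV[R]_2 := delta_mx 0 0.
Definition e1 : 'cV[R]_2 := delta_mx 1 0.

Lemma vec2D x y s t : vec2 (x + s) (y + t) = vec2 x y + s *: e0 + t *: e1.
Proof.
apply/colP => i; rewrite !mxE; case: i => -[|[|//]] i /=; ring.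
Qed.

Lemma vec2_continuous (T : topologicalType) (u : T) (f g : T -> R) :
  {for u, continuous f} -> {for u, continuous g} ->
  {for u, continuous (fun z => vec2 (f z) (g z))}.
Proof.
move=> fc gc; apply/cvgrPdist_lt => e e0; near=> z.
rewrite /Num.Def.normr/= mx_normrE bigmax_lt// => -[i j] _.
rewrite !mxE; case: i => -[|[|//]] i /=; near: z.
  by move/cvgrPdist_lt : fc; exact.
by move/cvgrPdist_lt : gc; exact.
Unshelve. all: by end_near. Qed.

(** Partial derivatives that exist near a point and are continuous there
    suffice: the increment of the composite is the sum of an increment in each
    coordinate direction, and by the mean value theorem both have continuous
    slope functions. *)
Lemma chain_rule2 (g : 'cV[R]_2 -> R) (x y : R -> R) (u dx dy : R) :
  let p := vec2 (x u) (y u) in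
  (\forall q \near p, derivable g q e0 /\ derivable g q e1) ->
  {for p, continuous ('D_e0 g)} -> {for p, continuous ('D_e1 g)} ->
  is_derive u (1 : R) x dx -> is_derive u (1 : R) y dy ->
  is_derive u (1 : R) (fun z => g (vec2 (x z) (y z)))
    ('D_e0 g p * dx + 'D_e1 g p * dy).
Proof.
move=> p dg c0 c1 xd yd.
have xc := is_derive_continuous xd; have yc := is_derive_continuous yd.
have /is_derive1_caratheodory [h [hE hC hu]] := xd.
have /is_derive1_caratheodory [k [kE kC ku]] := yd.
apply/is_derive1_caratheodory.
pose q z := vec2 (x u) (y z); pose sx z := x z - x u; pose sy z := y z - y u.
exists (fun z => slope g e0 (q z) (sx z) * h z + slope g e1 p (sy z) * k z).
have E z : vec2 (x z) (y z) = q z + sx z *: e0.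
  by rewrite -[q z]addr0 -(scale0r e1) addrAC -vec2D addr0 /sx addrC subrK.
have Eq z : q z = p + sy z *: e1.
  by rewrite -[p]addr0 -(scale0r e0) -vec2D addr0 /sy [_ + (_ - _)]addrC subrK.
have sxC : {for u, continuous sx} by apply: cvgB => //; exact: cvg_cst.
have syC : {for u, continuous sy} by apply: cvgB => //; exact: cvg_cst.
have sx0 : sx u = 0 by rewrite /sx subrr.
have sy0 : sy u = 0 by rewrite /sy subrr.
have dg0 : \forall q \near p, derivable g q e0 by apply: filterS dg => ? [].
have dg1 : \forall q \near p, derivable g q e1 by apply: filterS dg => ? [].
have qC : {for u, continuous q}.
  by apply: vec2_continuous => //; exact: cst_continuous.
have C0 : {for u, continuous (fun z => slope g e0 (q z) (sx z))}.
  exact: slope_continuous dg0 c0 qC sxC erefl sx0.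
have C1 : {for u, continuous (fun z => slope g e1 p (sy z))}.
  by apply: slope_continuous dg1 c1 _ syC erefl sy0; exact: cst_continuous.
split.
- move=> z; rewrite E Eq !slopeE -Eq [RHS]mulrDl -!mulrA -hE -kE /sx /sy; ring.
- by apply: cvgD; [apply: cvgM; [exact: C0|exact: hC]|apply: cvgM; [exact: C1|exact: kC]].
- by rewrite /sx /sy !subrr hu ku /slope !eqxx.
Qed.

End PlaneChainRule.

(** * The Hessian along a sum of two curves *)

Section CurveJets.
Variable R : realType.

(** The successive derivatives are part of the data, so that a curve, its
    image under a similarity and a model curve given by formulas can be treated
    alike; [curve_jet] says that the entries are derivatives of each other. *)
Record curve := Curve {
  cx : nat -> R -> R; cy : nat -> R -> R; cz : nat -> R -> R }.

(** The derivatives are two-sided also at the endpoints of I, where the curve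
    is thought of as extended. *)
Definition curve_jet (n : nat) (I : set R) (c : curve) : Prop :=
  forall k u, (k < n)%N -> I u ->
    [/\ is_derive u (1 : R) (cx c k) (cx c k.+1 u),
        is_derive u (1 : R) (cy c k) (cy c k.+1 u) &
        is_derive u (1 : R) (cz c k) (cz c k.+1 u)].

Lemma curve_jetS n I J c : J `<=` I -> curve_jet n I c -> curve_jet n J c.
Proof. by move=> JI cj k u kn /JI Iu; exact: cj. Qed.

Lemma curve_jet_leq m n I c : (m <= n)%N -> curve_jet n I c -> curve_jet m I c.
Proof. by move=> mn cj k u km; apply: cj; exact: leq_trans mn. Qed.

Definition det3 (x1 y1 z1 x2 y2 z2 x3 y3 z3 : R) : R :=
  x1 * (y2 * z3 - z2 * y3) - y1 * (x2 * z3 - z2 * x3) + z1 * (x2 * y3 - y2 * x3).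

Definition jac (c d : curve) (u v : R) : R :=
  cx c 1 u * cy d 1 v - cy c 1 u * cx d 1 v.

(** Differentiating f (c + d) = height once in each parameter shows that the
    Hessian of f is diagonal in the frame of the two velocities. Its diagonal
    entries are [bend1] and [bend2] divided by the Jacobian [jac]. *)
Definition bend1 (c d : curve) (u v : R) : R :=
  det3 (cx c 1 u) (cy c 1 u) (cz c 1 u) (cx d 1 v) (cy d 1 v) (cz d 1 v)
       (cx c 2 u) (cy c 2 u) (cz c 2 u).

Definition bend2 (c d : curve) (u v : R) : R :=
  det3 (cx c 1 u) (cy c 1 u) (cz c 1 u) (cx d 1 v) (cy d 1 v) (cz d 1 v)
       (cx d 2 v) (cy d 2 v) (cz d 2 v).

Definition speed2 (c : curve) (u : R) : R := cx c 1 u ^+ 2 + cy c 1 u ^+ 2.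

(** The equation H^2 / K = (a + 1)^2 / (4 a), multiplied by the denominators and
    written in terms of the two curves. *)
Definition ratio_at (a : R) (c d : curve) (u v : R) : Prop :=
  [/\ jac c d u v != 0, bend1 c d u v != 0, bend2 c d u v != 0 &
      a * (bend1 c d u v * speed2 d v + bend2 c d u v * speed2 c u) ^+ 2 =
      (a + 1) ^+ 2 * jac c d u v ^+ 2 * bend1 c d u v * bend2 c d u v].

Definition sum_top (c d : curve) (u v : R) : 'cV[R]_2 :=
  vec2 (cx c 0 u + cx d 0 v) (cy c 0 u + cy d 0 v).

Definition sum_height (c d : curve) (u v : R) : R := cz c 0 u + cz d 0 v.

End CurveJets.

Lemma det2E (S : comRingType) (A : 'M[S]_2) :
  \det A = A 0 0 * A 1 1 - A 0 1 * A 1 0.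
Proof.
rewrite (expand_det_row _ 0) !big_ord_recl big_ord0 addr0 /cofactor !det_mx11 !mxE /=.
rewrite expr0 expr1 mul1r mulN1r mulrN.
by congr (A _ _ * A _ _ - A _ _ * A _ _); apply: val_inj.
Qed.

Lemma tr2E (S : ringType) (A : 'M[S]_2) : \tr A = A 0 0 + A 1 1.
Proof.
rewrite /mxtrace !big_ord_recl big_ord0 addr0.
by congr (A _ _ + A _ _); apply: val_inj.
Qed.

(** In the basis of the two velocities A and B the second derivative is
    diagonal; the matrix of the change of basis has determinant D and Gram
    matrix with entries |A|^2, <A, B>, |B|^2. *)
Lemma second_form_algebra (R : comRingType)
    (p q r s t w A1 A2 A3 a1 a2 a3 B1 B2 B3 b1 b2 b3 : R) :
  p * A1 + q * A2 = A3 -> p * B1 + q * B2 = B3 ->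
  (r * A1 + s * A2) * A1 + p * a1 + ((t * A1 + w * A2) * A2 + q * a2) = a3 ->
  (r * B1 + s * B2) * B1 + p * b1 + ((t * B1 + w * B2) * B2 + q * b2) = b3 ->
  (r * B1 + s * B2) * A1 + (t * B1 + w * B2) * A2 = 0 ->
  (r * A1 + s * A2) * B1 + (t * A1 + w * A2) * B2 = 0 ->
  let D := A1 * B2 - A2 * B1 in
  let l := A1 * (B2 * a3 - B3 * a2) - A2 * (B1 * a3 - B3 * a1)
           + A3 * (B1 * a2 - B2 * a1) in
  let n := A1 * (B2 * b3 - B3 * b2) - A2 * (B1 * b3 - B3 * b1)
           + A3 * (B1 * b2 - B2 * b1) in
  (r + w) * D ^+ 3 = l * (B1 ^+ 2 + B2 ^+ 2) + n * (A1 ^+ 2 + A2 ^+ 2) /\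
  (r * w - s * t) * D ^+ 4 = l * n.
Proof.
move=> <- <- <- <- E5 E6 D l n.
pose l' := (r * A1 + s * A2) * A1 + (t * A1 + w * A2) * A2.
pose n' := (r * B1 + s * B2) * B1 + (t * B1 + w * B2) * B2.
have -> : l = D * l' by rewrite /l /D /l'; ring.
have -> : n = D * n' by rewrite /n /D /n'; ring.
split.
  transitivity (D * (l' * (B1 ^+ 2 + B2 ^+ 2) + n' * (A1 ^+ 2 + A2 ^+ 2)) -
    D * (A1 * B1 + A2 * B2) * (((r * B1 + s * B2) * A1 + (t * B1 + w * B2) * A2) +
    ((r * A1 + s * A2) * B1 + (t * A1 + w * A2) * B2))); last first.
    by rewrite E5 E6; ring.
  by rewrite /D /l' /n'; ring.
transitivity (D ^+ 2 * (l' * n' - ((r * B1 + s * B2) * A1 + (t * B1 + w * B2) * A2) *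
    ((r * A1 + s * A2) * B1 + (t * A1 + w * A2) * B2))); last first.
  by rewrite E5 E6; ring.
by rewrite /D /l' /n'; ring.
Qed.

Section HessianOfSum.
Variable R : realType.
Implicit Types (f : 'cV[R]_2 -> R) (c d : curve R).

Lemma class_C_partials (n : nat) (U : set 'cV[R]_2) f :
  open U -> class_C n.+1 U f -> forall p, U p ->
  [/\ \forall q \near p, derivable f q (e0 R) /\ derivable f q (e1 R),
      {for p, continuous ('D_(e0 R) f)} & {for p, continuous ('D_(e1 R) f)}].
Proof.
move=> oU [_ fC] p Up.
have [d0 c0] := fC (e0 R); have [d1 c1] := fC (e1 R).
split; [|by case: n {fC} c0 c1 => [|n] [c0 _] _; exact: c0
        |by case: n {fC} c0 c1 => [|n] _ [c1 _]; exact: c1].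
have : \forall q \near p, U q by exact: open_nbhs_nbhs.
by apply: filterS => q Uq; split; [exact: d0|exact: d1].
Qed.

Lemma class_CW (V W : normedModType R) (m n : nat) (U : set V) (g : V -> W) :
  (m <= n)%N -> class_C n U g -> class_C m U g.
Proof.
elim: n m g => [|n IH] [|m] g //= mn [gc gC]; first by split.
by split=> // w; have [? ?] := gC w; split=> //; apply: IH.
Qed.

Lemma class_C_derive (V W : normedModType R) (n : nat) (U : set V) (g : V -> W) w :
  class_C n.+1 U g -> class_C n U ('D_w g).
Proof. by case=> _ /(_ w) []. Qed.

(** The four second derivatives of f (c u + d v) = height, together with its two
    first derivatives, determine the Hessian. Only the values on the box are
    known, which suffices up to its boundary by [derive_eq_onW]. *)
Lemma hessian_sum_box (I J : set R) c d (u v : R) (U : set 'cV[R]_2) f :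
  nondegenerate_interval I -> nondegenerate_interval J -> I u -> J v ->
  curve_jet 2 I c -> curve_jet 2 J d -> open U -> class_C 3 U f ->
  jac c d u v != 0 ->
  (forall u' v', I u' -> J v' -> U (sum_top c d u' v') /\
     f (sum_top c d u' v') = sum_height c d u' v') ->
  let H := hessian f (sum_top c d u v) in
  \tr H * jac c d u v ^+ 3 =
    bend1 c d u v * speed2 d v + bend2 c d u v * speed2 c u /\
  \det H * jac c d u v ^+ 4 = bend1 c d u v * bend2 c d u v.
Proof.
move=> nI nJ Iu Jv cj dj oU fC D0 Uf H.
have Uin u' v' : I u' -> J v' -> U (sum_top c d u' v').
  by move=> Iu' Jv'; case: (Uf _ _ Iu' Jv').
have fE u' v' : I u' -> J v' -> f (sum_top c d u' v') = sum_height c d u' v'.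
  by move=> Iu' Jv'; case: (Uf _ _ Iu' Jv').
have chainu (g : 'cV[R]_2 -> R) u' v' : class_C 1 U g -> I u' -> J v' ->
    is_derive u' (1 : R) (fun z => g (sum_top c d z v'))
      ('D_(e0 R) g (sum_top c d u' v') * cx c 1 u' +
       'D_(e1 R) g (sum_top c d u' v') * cy c 1 u').
  move=> gC Iu' Jv'; have [dg g0 g1] := class_C_partials oU gC (Uin _ _ Iu' Jv').
  have [xd yd _] := cj 0%N u' isT Iu'.
  have sd (h : R -> R) k e : is_derive u' 1 h e -> is_derive u' 1 (fun z => h z + k) e.
    by move=> hd; rewrite -[e]addr0; apply: is_deriveD.
  exact: (@chain_rule2 R g (fun z => cx c 0 z + cx d 0 v')
    (fun z => cy c 0 z + cy d 0 v') u' _ _ dg g0 g1 (sd _ _ _ xd) (sd _ _ _ yd)).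
have chainv (g : 'cV[R]_2 -> R) u' v' : class_C 1 U g -> I u' -> J v' ->
    is_derive v' (1 : R) (fun z => g (sum_top c d u' z))
      ('D_(e0 R) g (sum_top c d u' v') * cx d 1 v' +
       'D_(e1 R) g (sum_top c d u' v') * cy d 1 v').
  move=> gC Iu' Jv'; have [dg g0 g1] := class_C_partials oU gC (Uin _ _ Iu' Jv').
  have [xd yd _] := dj 0%N v' isT Jv'.
  have sd (h : R -> R) k e : is_derive v' 1 h e -> is_derive v' 1 (fun z => k + h z) e.
    by move=> hd; rewrite -[e]add0r; apply: is_deriveD.
  exact: (@chain_rule2 R g (fun z => cx c 0 u' + cx d 0 z)
    (fun z => cy c 0 u' + cy d 0 z) v' _ _ dg g0 g1 (sd _ _ _ xd) (sd _ _ _ yd)).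
have fC1 : class_C 1 U f by exact: class_CW fC.
have f0C1 : class_C 1 U ('D_(e0 R) f) by exact: class_CW (class_C_derive (e0 R) fC).
have f1C1 : class_C 1 U ('D_(e1 R) f) by exact: class_CW (class_C_derive (e1 R) fC).
pose f0 := 'D_(e0 R) f; pose f1 := 'D_(e1 R) f.
have Eu u' v' : I u' -> J v' ->
    f0 (sum_top c d u' v') * cx c 1 u' + f1 (sum_top c d u' v') * cy c 1 u' =
    cz c 1 u'.
  move=> Iu' Jv'; have [_ _ zd] := cj 0%N u' isT Iu'.
  have hd : is_derive u' (1 : R) (fun z => sum_height c d z v') (cz c 1 u').
    by rewrite -[cz c 1 u']addr0; apply: is_deriveD.
  exact: (derive_eq_onW nI Iu' (chainu _ _ _ fC1 Iu' Jv') hd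
    (fun x Ix => fE x v' Ix Jv')).
have Ev u' v' : I u' -> J v' ->
    f0 (sum_top c d u' v') * cx d 1 v' + f1 (sum_top c d u' v') * cy d 1 v' =
    cz d 1 v'.
  move=> Iu' Jv'; have [_ _ zd] := dj 0%N v' isT Jv'.
  have hd : is_derive v' (1 : R) (fun z => sum_height c d u' z) (cz d 1 v').
    by rewrite -[cz d 1 v']add0r; apply: is_deriveD.
  exact: (derive_eq_onW nJ Jv' (chainv _ _ _ fC1 Iu' Jv') hd
    (fun x Jx => fE u' x Iu' Jx)).
have [xc2 yc2 zc2] := cj 1%N u isT Iu; have [xd2 yd2 zd2] := dj 1%N v isT Jv.
have du0 := chainu _ _ _ f0C1 Iu Jv; have du1 := chainu _ _ _ f1C1 Iu Jv.
have dv0 := chainv _ _ _ f0C1 Iu Jv; have dv1 := chainv _ _ _ f1C1 Iu Jv.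
have cst k x : is_derive x (1 : R) (fun=> k) 0 := is_derive_const k x.
have Euu := derive_eq_onW nI Iu (is_derive_add (is_derive_mul du0 xc2)
  (is_derive_mul du1 yc2)) zc2 (fun x Ix => Eu x v Ix Jv).
have Evv := derive_eq_onW nJ Jv (is_derive_add (is_derive_mul dv0 xd2)
  (is_derive_mul dv1 yd2)) zd2 (fun x Jx => Ev u x Iu Jx).
have Euv := derive_eq_onW nJ Jv (is_derive_add (is_derive_mul dv0 (cst (cx c 1 u) v))
  (is_derive_mul dv1 (cst (cy c 1 u) v))) (cst (cz c 1 u) v)
  (fun x Jx => Eu u x Iu Jx).
have Evu := derive_eq_onW nI Iu (is_derive_add (is_derive_mul du0 (cst (cx d 1 v) u))
  (is_derive_mul du1 (cst (cy d 1 v) u))) (cst (cz d 1 v) u)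
  (fun x Ix => Ev x v Ix Jv).
have {}Eu := Eu _ _ Iu Jv; have {}Ev := Ev _ _ Iu Jv.
have tH : \tr H = 'D_(e0 R) f0 (sum_top c d u v) + 'D_(e1 R) f1 (sum_top c d u v).
  by rewrite tr2E !mxE.
have dH : \det H = 'D_(e0 R) f0 (sum_top c d u v) * 'D_(e1 R) f1 (sum_top c d u v) -
   'D_(e1 R) f0 (sum_top c d u v) * 'D_(e0 R) f1 (sum_top c d u v).
  by rewrite det2E !mxE.
rewrite {}tH {}dH; move: Eu Ev Euu Evv Euv Evu.
rewrite !mulr0 !addr0 -/f0 -/f1 => Eu' Ev' Euu' Evv' Euv' Evu'.
exact: second_form_algebra Eu' Ev' Euu' Evv' Euv' Evu'.
Qed.

End HessianOfSum.

(** * Principal curvatures of a sum of two curves *)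

Section PrincipalCurvatures.
Variable R : realType.

Lemma char_poly2P (A : 'M[R]_2) (k1 k2 : R) :
  char_poly A = ('X - k1%:P) * ('X - k2%:P) <->
  \tr A = k1 + k2 /\ \det A = k1 * k2.
Proof.
have E : ('X - k1%:P) * ('X - k2%:P) = 'X^2 - (k1 + k2) *: 'X + (k1 * k2)%:P :> {poly R}.
  rewrite -mul_polyC polyCD polyCM; ring.
have t : (char_poly A)`_1 = - \tr A by rewrite (char_poly_trace (n := 2)).
have d : (char_poly A)`_0 = \det A by rewrite char_poly_det -signr_odd expr0 mul1r.
have Q i : ('X^2 - (k1 + k2) *: 'X + (k1 * k2)%:P : {poly R})`_i =
    (i == 2%N)%:R - (k1 + k2) * (i == 1%N)%:R + (if i == 0%N then k1 * k2 else 0).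
  by rewrite coefD coefB coefZ coefX coefXn coefC.
rewrite E; split => [H|[tA dA]].
  move: t d; rewrite H !Q /= => t d; split; last by rewrite -d; ring.
  by apply: oppr_inj; rewrite -t; ring.
apply/polyP => -[|[|[|i]]]; rewrite Q /=.
- by rewrite d dA; ring.
- by rewrite t tA; ring.
- have /monicP := char_poly_monic A.
  by rewrite /lead_coef size_char_poly => ->; ring.
- by rewrite nth_default ?size_char_poly//; ring.
Qed.

Lemma ratio_invariants (a k1 k2 : R) : k1 * k2 != 0 -> k1 / k2 = a \/ k2 / k1 = a ->
  a * (k1 + k2) ^+ 2 = (a + 1) ^+ 2 * (k1 * k2).
Proof.
rewrite mulf_eq0 negb_or => /andP[k10 k20] [] /(congr1 (fun x => x * _)).
  by move=> /(_ k2); rewrite divfK// => ->; ring.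
by move=> /(_ k1); rewrite divfK// => ->; ring.
Qed.

(** For a <> -1 the trace gives the eigenvalues rationally. For a = -1 the trace
    vanishes, and they are real because the determinant is negative. *)
Lemma ratio_eigenvalues (a t d : R) : a != 0 -> d != 0 -> (a = -1 -> d < 0) ->
  a * t ^+ 2 = (a + 1) ^+ 2 * d ->
  exists k1 k2, [/\ t = k1 + k2, d = k1 * k2, k1 * k2 != 0 & k1 / k2 = a].
Proof.
move=> a0 d0 dneg E; have [a1|a1] := eqVneq a (-1).
  have t0 : t = 0.
    move: E; rewrite a1 addNr expr0n/= mul0r mulN1r => /eqP.
    by rewrite oppr_eq0 expf_eq0/= => /eqP.
  have dn := dneg a1; pose k := Num.sqrt (- d).
  have kk : k * k = - d by rewrite -expr2 sqr_sqrtr// oppr_ge0 ltW.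
  have k0 : k != 0 by rewrite gt_eqF// sqrtr_gt0 oppr_gt0.
  exists k, (- k); rewrite mulrN kk opprK subrr; split => //.
  by rewrite invrN mulrN divff.
have a10 : a + 1 != 0 by rewrite addr_eq0.
pose k := t / (a + 1).
have tE : t = a * k + k by rewrite /k; field.
have dE : d = a * k * k.
  apply: (mulfI (expf_neq0 2 a10)); rewrite -E tE; ring.
have k0 : k != 0 by apply: contraNneq d0 => k0; rewrite dE k0 mulr0.
exists (a * k), k; split => //; first by rewrite -dE.
by rewrite mulfK.
Qed.

End PrincipalCurvatures.

Section RatioOfSum.
Variable R : realType.
Implicit Types (c d : curve R) (I J : set R).

Definition point (c : curve R) (u : R) : 'cV[R]_3 :=
  vec3 (cx c 0 u) (cy c 0 u) (cz c 0 u).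

Lemma vec3D (x y z x' y' z' : R) :
  vec3 x y z + vec3 x' y' z' = vec3 (x + x') (y + y') (z + z').
Proof. by apply/colP => i; rewrite !mxE; case: i => -[|[|[|//]]]. Qed.

Lemma topview_vec3 (x y z : R) : topview (vec3 x y z) = vec2 x y.
Proof. by apply/colP => i; rewrite !mxE; case: i => -[|[|//]]. Qed.

Lemma height_vec3 (x y z : R) : height (vec3 x y z) = z.
Proof. by rewrite /height !mxE. Qed.

Lemma vec3_continuous (T : topologicalType) (u : T) (f g h : T -> R) :
  {for u, continuous f} -> {for u, continuous g} -> {for u, continuous h} ->
  {for u, continuous (fun z => vec3 (f z) (g z) (h z))}.
Proof.
move=> fc gc hc; apply/cvgrPdist_lt => e e0; near=> z.
rewrite /Num.Def.normr/= mx_normrE bigmax_lt// => -[i j] _.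
rewrite !mxE; case: i => -[|[|[|//]]] i /=; near: z.
- by move/cvgrPdist_lt : fc; exact.
- by move/cvgrPdist_lt : gc; exact.
- by move/cvgrPdist_lt : hc; exact.
Unshelve. all: by end_near. Qed.

Lemma sum_continuous2 (f g : R -> R) (u v : R) :
  {for u, continuous f} -> {for v, continuous g} ->
  {for (u, v), continuous (fun q : R * R => f q.1 + g q.2)}.
Proof.
move=> fc gc; apply: cvgD.
  by apply: (cvg_comp fst f); [exact: cvg_fst|exact: fc].
by apply: (cvg_comp snd g); [exact: cvg_snd|exact: gc].
Qed.

Lemma nondegenerate_ball I (u e : R) : nondegenerate_interval I -> I u -> 0 < e ->
  nondegenerate_interval (I `&` ball u e).
Proof.
move=> nI Iu e0; split.
  move=> s t [Is bs] [It bt] x /andP[sx xt]; split.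
    by apply: (nI.1 s t) => //; rewrite sx.
  move: bs bt; rewrite /ball/= !ltr_distl => /andP[? ?] /andP[? ?].
  by apply/andP; split; lra.
have [x [Ix xu bx]] : exists x, [/\ I x, x != u & ball u e x].
  by apply: nondegenerate_near => //; exact: nbhsx_ballx.
have bu : ball u e u by exact: ballxx.
case: (ltgtP x u) xu => // lt _; last by exists u, x.
by exists x, u.
Qed.

Lemma hessian_sum I J c d (u v : R) (U : set 'cV[R]_2) f :
  nondegenerate_interval I -> nondegenerate_interval J -> I u -> J v ->
  curve_jet 2 I c -> curve_jet 2 J d -> open U -> U (sum_top c d u v) ->
  class_C 3 U f -> jac c d u v != 0 ->
  (\forall q \near (u, v), I q.1 -> J q.2 ->
     f (sum_top c d q.1 q.2) = sum_height c d q.1 q.2) ->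
  let H := hessian f (sum_top c d u v) in
  \tr H * jac c d u v ^+ 3 =
    bend1 c d u v * speed2 d v + bend2 c d u v * speed2 c u /\
  \det H * jac c d u v ^+ 4 = bend1 c d u v * bend2 c d u v.
Proof.
move=> nI nJ Iu Jv cj dj oU Up fC D0 fE.
have [xc yc _] := cj 0%N u isT Iu; have [xd yd _] := dj 0%N v isT Jv.
have topc : {for (u, v), continuous (fun q : R * R => sum_top c d q.1 q.2)}.
  apply: vec2_continuous.
    exact: sum_continuous2 (is_derive_continuous xc) (is_derive_continuous xd).
  exact: sum_continuous2 (is_derive_continuous yc) (is_derive_continuous yd).
have Un : \forall q \near (u, v), U (sum_top c d q.1 q.2).
  by apply: (topc U); exact: open_nbhs_nbhs.
have : nbhs (u, v) [set q : R * R | (I q.1 -> J q.2 ->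
    f (sum_top c d q.1 q.2) = sum_height c d q.1 q.2) /\ U (sum_top c d q.1 q.2)].
  exact: filterI.
move=> /nbhs_ballP[e /= e0 eP].
apply: (@hessian_sum_box _ (I `&` ball u e) (J `&` ball v e) _ _ _ _ U) => //.
- exact: nondegenerate_ball.
- exact: nondegenerate_ball.
- by split=> //; exact: ballxx.
- by split=> //; exact: ballxx.
- by apply: curve_jetS cj => x [].
- by apply: curve_jetS dj => x [].
- move=> u' v' [Iu' bu] [Jv' bv].
  by have [/(_ Iu' Jv') ? ?] := eP (u', v') (conj bu bv).
Qed.

Lemma speed2_gt0 c d (u v : R) : jac c d u v != 0 -> 0 < speed2 c u /\ 0 < speed2 d v.
Proof.
have E (x y : R) : ~~ ((x == 0) && (y == 0)) -> 0 < x ^+ 2 + y ^+ 2.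
  by rewrite lt0r addr_ge0 ?sqr_ge0// andbT paddr_eq0 ?sqr_ge0// !sqrf_eq0.
by move=> D0; split; apply: E; apply: contra D0 => /andP[/eqP x0 /eqP y0];
  rewrite /jac x0 y0 ?mulr0 ?mul0r subrr.
Qed.

(** The geometric condition at all points, boundary points included, becomes an
    equation between the derivatives of the two curves. *)
Lemma constant_ratio_at (a : R) I J c d :
  nondegenerate_interval I -> nondegenerate_interval J ->
  curve_jet 2 I c -> curve_jet 2 J d ->
  (forall u v, I u -> J v -> jac c d u v != 0) ->
  constant_ratio a (translational_set I J (point c) (point d)) ->
  forall u v, I u -> J v -> ratio_at a c d u v.
Proof.
move=> nI nJ cj dj D0 aS u v Iu Jv.
have Suv u' v' : I u' -> J v' ->
    translational_set I J (point c) (point d) (point c u' + point d v').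
  by move=> Iu' Jv'; exists u' => //; exists v'.
have [k1 [k2 [[f [[U [oU Up fC]] fS] /char_poly2P[tH dH] k0 ka]]]] := aS _ (Suv _ _ Iu Jv).
have D := D0 _ _ Iu Jv.
rewrite /point vec3D topview_vec3 in Up tH dH.
have [xc yc zc] := cj 0%N u isT Iu; have [xd yd zd] := dj 0%N v isT Jv.
have pc : {for (u, v), continuous (fun q : R * R => point c q.1 + point d q.2)}.
  have -> : (fun q : R * R => point c q.1 + point d q.2) = (fun q : R * R =>
      vec3 (cx c 0 q.1 + cx d 0 q.2) (cy c 0 q.1 + cy d 0 q.2)
           (cz c 0 q.1 + cz d 0 q.2)).
    by apply/funext => q; rewrite /point vec3D.
  apply: vec3_continuous.
  - exact: sum_continuous2 (is_derive_continuous xc) (is_derive_continuous xd).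
  - exact: sum_continuous2 (is_derive_continuous yc) (is_derive_continuous yd).
  - exact: sum_continuous2 (is_derive_continuous zc) (is_derive_continuous zd).
have fE : \forall q \near (u, v), I q.1 -> J q.2 ->
     f (sum_top c d q.1 q.2) = sum_height c d q.1 q.2.
  have : \forall q \near (u, v), translational_set I J (point c) (point d)
      (point c q.1 + point d q.2) -> height (point c q.1 + point d q.2) =
      f (topview (point c q.1 + point d q.2)) by exact: pc fS.
  apply: filterS => q qS Iq Jq; have := qS (Suv _ _ Iq Jq).
  by rewrite /point vec3D topview_vec3 height_vec3.
have [tE dE] := hessian_sum nI nJ Iu Jv cj dj oU Up fC D fE.
have LN : bend1 c d u v * bend2 c d u v != 0.
  by rewrite -dE dH mulf_neq0// expf_neq0.
have /andP[L0 N0] : (bend1 c d u v != 0) && (bend2 c d u v != 0).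
  by rewrite -negb_or -mulf_eq0.
split=> //; rewrite -tE -[RHS]mulrA -dE tH dH.
have := ratio_invariants k0 ka; move: (jac c d u v) => j rE.
transitivity (a * (k1 + k2) ^+ 2 * j ^+ 6); first by ring.
by rewrite rE; ring.
Qed.

(** Conversely the equation at one pair of parameters gives principal curvatures
    in ratio a at one point. *)
Lemma ratio_at_principal (a : R) I J c d (u v : R) (U : set 'cV[R]_2) f :
  a != 0 ->
  nondegenerate_interval I -> nondegenerate_interval J -> I u -> J v ->
  curve_jet 2 I c -> curve_jet 2 J d -> open U -> U (sum_top c d u v) ->
  class_C 3 U f ->
  (\forall q \near (u, v), I q.1 -> J q.2 ->
     f (sum_top c d q.1 q.2) = sum_height c d q.1 q.2) ->
  ratio_at a c d u v ->
  exists k1 k2,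
    [/\ char_poly (hessian f (sum_top c d u v)) = ('X - k1%:P) * ('X - k2%:P),
        k1 * k2 != 0 & k1 / k2 = a].
Proof.
move=> a0 nI nJ Iu Jv cj dj oU Up fC fE [D0 L0 N0 rE].
have [tE dE] := hessian_sum nI nJ Iu Jv cj dj oU Up fC D0 fE.
have [sc sd] := speed2_gt0 D0.
move: (\tr _) (\det _) tE dE rE (@char_poly2P R (hessian f (sum_top c d u v))) =>
  t e tE dE rE cP.
have jn n : jac c d u v ^+ n != 0 by rewrite expf_neq0.
have [|||k1 [k2 [t12 e12 k0 ka]]] := @ratio_eigenvalues R a t e a0.
- apply: contraNneq (mulf_neq0 L0 N0) => e0; by rewrite -dE e0 mul0r.
- (* The trace vanishes for a = -1, so the two diagonal entries have opposite
     signs. *)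
  move=> a1; have : bend1 c d u v * bend2 c d u v < 0.
    move: rE; rewrite a1 addNr expr0n/= !mul0r => /eqP.
    rewrite mulN1r oppr_eq0 expf_eq0/= => /eqP E.
    rewrite -(pmulr_llt0 _ sd) mulrAC (_ : _ * speed2 d v = - (bend2 c d u v * speed2 c u)).
      rewrite mulNr oppr_lt0 mulrAC -expr2 mulr_gt0//.
      by rewrite exprn_even_gt0.
    by apply/eqP; rewrite -addr_eq0 E.
  by rewrite -dE pmulr_llt0// exprn_even_gt0.
- apply: (mulIf (jn 6%N)).
  transitivity (a * (t * jac c d u v ^+ 3) ^+ 2); first by ring.
  rewrite tE rE; transitivity ((a + 1) ^+ 2 * jac c d u v ^+ 2 *
    (bend1 c d u v * bend2 c d u v)); first by ring.
  by rewrite -dE; ring.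
by exists k1, k2; split => //; apply/cP; rewrite -t12 -e12.
Qed.

End RatioOfSum.

(** * Isotropic similarities *)

Section Similarities.
Variable R : realType.
Implicit Types (c d : curve R) (I J : set R).

(** Similarities are handled through their parameters, which makes composition,
    inversion and the action on curves explicit formulas. *)
Record simil := Simil {
  flip : bool; h1 : R; h2 : R; c1 : R; c2 : R; c3 : R; b1 : R; b2 : R; b3 : R }.

Implicit Types g : simil.

Definition simil_ok g : Prop := h1 g ^+ 2 + h2 g ^+ 2 != 0 /\ c3 g != 0.

Definition linx g (x y : R) := (-1) ^+ flip g * h1 g * x - (-1) ^+ flip g * h2 g * y.
Definition liny g (x y : R) := h2 g * x + h1 g * y.
Definition linz g (x y z : R) := c1 g * x + c2 g * y + c3 g * z.

Definition simil_map g (p : 'cV[R]_3) : 'cV[R]_3 :=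
  vec3 (linx g (p 0 0) (p 1 0) + b1 g) (liny g (p 0 0) (p 1 0) + b2 g)
       (linz g (p 0 0) (p 1 0) (p ord_max 0) + b3 g).

Lemma vec3_eta (p : 'cV[R]_3) : p = vec3 (p 0 0) (p 1 0) (p ord_max 0).
Proof.
apply/colP => i; rewrite !mxE; case: i => -[|[|[|//]]] i /=;
  by congr (p _ _); apply: val_inj.
Qed.

Lemma vec3_0 (x y z : R) : vec3 x y z 0 0 = x. Proof. by rewrite !mxE. Qed.
Lemma vec3_1 (x y z : R) : vec3 x y z 1 0 = y. Proof. by rewrite !mxE. Qed.
Lemma vec3_2 (x y z : R) : vec3 x y z ord_max 0 = z. Proof. by rewrite !mxE. Qed.

Lemma mul_vec3 (A : 'M[R]_3) (x y z : R) : A *m vec3 x y z =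
  vec3 (A 0 0 * x + A 0 1 * y + A 0 ord_max * z)
       (A 1 0 * x + A 1 1 * y + A 1 ord_max * z)
       (A ord_max 0 * x + A ord_max 1 * y + A ord_max ord_max * z).
Proof.
apply/colP => i; rewrite !mxE !big_ord_recl big_ord0 addr0 addrA !mxE /=.
by case: i => -[|[|[|//]]] i /=; congr (A _ _ * _ + A _ _ * _ + A _ _ * _);
  apply: val_inj.
Qed.

Lemma simil_mapE g (x y z : R) : simil_map g (vec3 x y z) =
  vec3 (linx g x y + b1 g) (liny g x y + b2 g) (linz g x y z + b3 g).
Proof. by rewrite /simil_map vec3_0 vec3_1 vec3_2. Qed.

Lemma isotropic_mapE g p :
  isotropic_matrix (flip g) (h1 g) (h2 g) (c1 g) (c2 g) (c3 g) *m p +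
    vec3 (b1 g) (b2 g) (b3 g) = simil_map g p.
Proof.
rewrite [p]vec3_eta simil_mapE mul_vec3 vec3D !mxE /=.
by congr vec3; rewrite /linx /liny /linz; ring.
Qed.

Definition simil_comp g' g : simil :=
  let e := (-1) ^+ flip g : R in
  let H1 := h1 g' * h1 g - e * h2 g' * h2 g in
  let H2 := e * h2 g' * h1 g + h1 g' * h2 g in
  Simil (flip g' (+) flip g) H1 H2
    (c1 g' * (e * h1 g) + c2 g' * h2 g + c3 g' * c1 g)
    (- c1 g' * (e * h2 g) + c2 g' * h1 g + c3 g' * c2 g) (c3 g' * c3 g)
    (linx g' (b1 g) (b2 g) + b1 g') (liny g' (b1 g) (b2 g) + b2 g')
    (linz g' (b1 g) (b2 g) (b3 g) + b3 g').

Lemma simil_compE g' g p : simil_map (simil_comp g' g) p = simil_map g' (simil_map g p).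
Proof.
rewrite [p]vec3_eta !simil_mapE /linx /liny /linz /simil_comp /= /linx /liny /linz.
by case: (flip g); case: (flip g'); rewrite /= ?expr0 ?expr1; congr vec3; ring.
Qed.

Lemma simil_comp_ok g' g : simil_ok g' -> simil_ok g -> simil_ok (simil_comp g' g).
Proof.
move=> [h' c'] [h c]; split; last by rewrite /= mulf_neq0.
apply: contra (mulf_neq0 h' h) => /eqP; rewrite /simil_comp /= => E.
apply/eqP; rewrite -[RHS]E; case: (flip g); rewrite ?expr0 ?expr1; ring.
Qed.

Definition simil_inv g : simil :=
  let e := (-1) ^+ flip g : R in
  let h := h1 g ^+ 2 + h2 g ^+ 2 in
  let k1 := h1 g / h in let k2 := - e * h2 g / h in
  let d1 := - (c1 g * (e * k1) + c2 g * k2) / c3 g in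
  let d2 := - (- c1 g * (e * k2) + c2 g * k1) / c3 g in
  let i := Simil (flip g) k1 k2 d1 d2 (c3 g)^-1 0 0 0 in
  Simil (flip g) k1 k2 d1 d2 (c3 g)^-1
    (- linx i (b1 g) (b2 g)) (- liny i (b1 g) (b2 g)) (- linz i (b1 g) (b2 g) (b3 g)).

Lemma simil_inv_ok g : simil_ok g -> simil_ok (simil_inv g).
Proof.
move=> [h c]; split; last by rewrite /= invr_neq0.
apply: contra (invr_neq0 h) => /eqP E; apply/eqP; rewrite -[RHS]E /simil_inv /=.
by case: (flip g); rewrite ?expr0 ?expr1; field.
Qed.

Lemma simil_mapK g p : simil_ok g -> simil_map (simil_inv g) (simil_map g p) = p.
Proof.
move=> [h c]; rewrite [in RHS](vec3_eta p) {1}(vec3_eta p) !simil_mapE.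
rewrite /linx /liny /linz /simil_inv /=.
by case: (flip g); rewrite ?expr0 ?expr1; congr vec3; rewrite /linx /liny /linz /= ?expr0 ?expr1; field; rewrite ?c ?h.
Qed.

Lemma simil_mapVK g p : simil_ok g -> simil_map g (simil_map (simil_inv g) p) = p.
Proof.
move=> [h c]; rewrite [in RHS](vec3_eta p) {1}(vec3_eta p) !simil_mapE.
rewrite /linx /liny /linz /simil_inv /=.
by case: (flip g); rewrite ?expr0 ?expr1; congr vec3; rewrite /linx /liny /linz /= ?expr0 ?expr1; field; rewrite ?c ?h.
Qed.

Lemma isotropic_matrix_det (s : bool) (k1 k2 d1 d2 d3 : R) :
  \det (isotropic_matrix s k1 k2 d1 d2 d3) =
  (-1) ^+ s * (k1 ^+ 2 + k2 ^+ 2) * d3.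
Proof.
rewrite (expand_det_col _ ord_max) !big_ord_recl big_ord0 addr0 !mxE /= !mul0r !add0r.
rewrite /cofactor det2E !mxE /=; case: s; rewrite ?expr0 ?expr1; ring.
Qed.

Lemma isotropic_similarityP (T : 'cV[R]_3 -> 'cV[R]_3) :
  isotropic_similarity T <-> exists2 g, simil_ok g & T = simil_map g.
Proof.
split=> [[s [k1 [k2 [d1 [d2 [d3 [b [uA ->]]]]]]]]|[g [h0 c0] ->]].
  exists (Simil s k1 k2 d1 d2 d3 (b 0 0) (b 1 0) (b ord_max 0)).
    move: uA; rewrite unitmxE unitfE isotropic_matrix_det !mulf_eq0 !negb_or.
    by case/andP => /andP[_ ? ?]; split.
  by apply/funext => p; rewrite -isotropic_mapE /= -vec3_eta.
exists (flip g), (h1 g), (h2 g), (c1 g), (c2 g), (c3 g), (vec3 (b1 g) (b2 g) (b3 g)).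
split; last by apply/funext => p; rewrite -isotropic_mapE.
by rewrite unitmxE unitfE isotropic_matrix_det !mulf_neq0// signr_eq0.
Qed.

(** A translation changes only the derivative of order 0. *)
Definition simil_curve g c : curve R := Curve
  (fun k u => linx g (cx c k u) (cy c k u) + (if k is 0%N then b1 g else 0))
  (fun k u => liny g (cx c k u) (cy c k u) + (if k is 0%N then b2 g else 0))
  (fun k u => linz g (cx c k u) (cy c k u) (cz c k u) + (if k is 0%N then b3 g else 0)).

(** In the image of a sum of two curves only one summand may be translated; the
    other one is moved by the linear part. *)
Definition simil_lin g : simil :=
  Simil (flip g) (h1 g) (h2 g) (c1 g) (c2 g) (c3 g) 0 0 0.

Lemma simil_curve_jet n I g c : curve_jet n I c -> curve_jet n I (simil_curve g c).
Proof.
move=> cj k u kn Iu; have [xd yd zd] := cj k u kn Iu.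
split; rewrite /= /linx /liny /linz; derive_tac; ring.
Qed.

Lemma simil_sum g c d u v : simil_map g (point c u + point d v) =
  point (simil_curve (simil_lin g) c) u + point (simil_curve g d) v.
Proof.
rewrite /point !vec3D simil_mapE /= /linx /liny /linz /=; congr vec3; ring.
Qed.

(** All terms of the equation are determinants or squared lengths, and both
    sides scale by the same power of the similarity factor. *)
Lemma simil_ratio_at (a : R) g g' c d u v : simil_ok g ->
  simil_lin g' = simil_lin g ->
  ratio_at a c d u v -> ratio_at a (simil_curve g' c) (simil_curve g d) u v.
Proof.
move=> [h0 k0] [Ef E1 E2 E3 E4 E5].
have s0 : (-1) ^+ flip g != 0 :> R by rewrite signr_eq0.
have e2 : ((-1) ^+ flip g : R) ^+ 2 = 1 by rewrite sqrr_sign.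
have jE : jac (simil_curve g' c) (simil_curve g d) u v =
    (-1) ^+ flip g * (h1 g ^+ 2 + h2 g ^+ 2) * jac c d u v.
  by rewrite /jac /= /linx /liny E1 E2 Ef; ring.
have b1E : bend1 (simil_curve g' c) (simil_curve g d) u v =
    (-1) ^+ flip g * (h1 g ^+ 2 + h2 g ^+ 2) * c3 g * bend1 c d u v.
  by rewrite /bend1 /det3 /= /linx /liny /linz E1 E2 E3 E4 E5 Ef; ring.
have b2E : bend2 (simil_curve g' c) (simil_curve g d) u v =
    (-1) ^+ flip g * (h1 g ^+ 2 + h2 g ^+ 2) * c3 g * bend2 c d u v.
  by rewrite /bend2 /det3 /= /linx /liny /linz E1 E2 E3 E4 E5 Ef; ring.
have scE : speed2 (simil_curve g' c) u = (h1 g ^+ 2 + h2 g ^+ 2) * speed2 c u.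
  by rewrite /speed2 /= /linx /liny E1 E2 Ef; case: (flip g);
    rewrite ?expr0 ?expr1; ring.
have sdE : speed2 (simil_curve g d) v = (h1 g ^+ 2 + h2 g ^+ 2) * speed2 d v.
  by rewrite /speed2 /= /linx /liny; case: (flip g); rewrite ?expr0 ?expr1; ring.
move=> [D0 L0 N0 rE]; split; rewrite ?jE ?b1E ?b2E ?scE ?sdE ?mulf_neq0//.
move: ((-1) ^+ _) e2 rE => e e2 rE.
transitivity (e ^+ 2 * (h1 g ^+ 2 + h2 g ^+ 2) ^+ 4 * c3 g ^+ 2 *
  (a * (bend1 c d u v * speed2 d v + bend2 c d u v * speed2 c u) ^+ 2)); first by ring.
rewrite rE; transitivity (e ^+ 2 * (e ^+ 2 * (h1 g ^+ 2 + h2 g ^+ 2) ^+ 4 * c3 g ^+ 2 *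
  ((a + 1) ^+ 2 * jac c d u v ^+ 2 * bend1 c d u v * bend2 c d u v))); last by ring.
by rewrite e2 !mul1r.
Qed.

End Similarities.

(** * Fitting a surface into a model *)

Section Fits.
Variable R : realType.
Implicit Types (c d : curve R) (I J : set R).

(** The conclusion sought for a pair of curves; unlike the relation between
    sets it is visibly symmetric in the two curves and transported by
    similarities. *)
Definition fits (a : R) I J c d : Prop := exists M g,
  [/\ model_surface a M, simil_ok g &
      forall u v, I u -> J v -> M (simil_map g (point c u + point d v))].

Definition flat J d : Prop := exists n1 n2 n3 k,
  [|| n1 != 0, n2 != 0 | n3 != 0] /\
  forall v, J v -> n1 * cx d 0 v + n2 * cy d 0 v + n3 * cz d 0 v = k.

Lemma fits_swap a I J c d : fits a I J c d -> fits a J I d c.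
Proof.
move=> [M [g [mM gk MS]]]; exists M, g; split => // v u Jv Iu.
by rewrite addrC; exact: MS.
Qed.

Lemma fits_simil a I J c d g : simil_ok g ->
  fits a I J (simil_curve (simil_lin g) c) (simil_curve g d) -> fits a I J c d.
Proof.
move=> gk [M [g' [mM g'k MS]]]; exists M, (simil_comp g' g); split => //.
  exact: simil_comp_ok.
by move=> u v Iu Jv; rewrite simil_compE simil_sum; exact: MS.
Qed.

Lemma flat_simil J d g : simil_ok g -> flat J (simil_curve g d) -> flat J d.
Proof.
move=> [h0 k0] [n1 [n2 [n3 [k [n0 E]]]]].
pose e : R := (-1) ^+ flip g.
have e0 : e != 0 by rewrite signr_eq0.
exists (n1 * (e * h1 g) + n2 * h2 g + n3 * c1 g),
  (- n1 * (e * h2 g) + n2 * h1 g + n3 * c2 g), (n3 * c3 g),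
  (k - n1 * b1 g - n2 * b2 g - n3 * b3 g); split; last first.
  by move=> v /E <-; rewrite /= /linx /liny /linz -/e; ring.
apply: contraLR n0; rewrite !negb_or !negbK => /and3P[/eqP E1 /eqP E2].
rewrite mulf_eq0 (negbTE k0) orbF => /eqP n30; move: E1 E2; rewrite n30.
rewrite !mul0r !addr0 => E1 E2.
have F1 : n1 * e * (h1 g ^+ 2 + h2 g ^+ 2) = 0.
  transitivity (h1 g * (n1 * (e * h1 g) + n2 * h2 g)
    - h2 g * (- n1 * (e * h2 g) + n2 * h1 g)); first by ring.
  by rewrite E1 E2; ring.
have F2 : n2 * (h1 g ^+ 2 + h2 g ^+ 2) = 0.
  transitivity (h2 g * (n1 * (e * h1 g) + n2 * h2 g)
    + h1 g * (- n1 * (e * h2 g) + n2 * h1 g)); first by ring.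
  by rewrite E1 E2; ring.
move/eqP: F1; rewrite !mulf_eq0 (negbTE h0) (negbTE e0) !orbF => ->.
by move/eqP: F2; rewrite !mulf_eq0 (negbTE h0) !orbF => ->; rewrite eqxx.
Qed.

Lemma ratio_at_swap a c d u v : ratio_at a c d u v -> ratio_at a d c v u.
Proof.
have E1 : jac d c v u = - jac c d u v by rewrite /jac; ring.
have E2 : bend1 d c v u = - bend2 c d u v by rewrite /bend1 /bend2 /det3; ring.
have E3 : bend2 d c v u = - bend1 c d u v by rewrite /bend1 /bend2 /det3; ring.
move=> [D0 L0 N0 rE]; split; rewrite ?E1 ?E2 ?E3 ?oppr_eq0//.
transitivity (a * (bend1 c d u v * speed2 d v + bend2 c d u v * speed2 c u) ^+ 2).
  by ring.
by rewrite rE; ring.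
Qed.

End Fits.

Section AuxiliaryAlgebra.
Variable R : realType.

(** For fixed P the equation is quadratic in r, and the product of its roots is
    P^2. *)
Lemma ratio_roots (a P r s : R) : a != 0 -> s != 0 ->
  a * (P + r) ^+ 2 = (a + 1) ^+ 2 * r -> a * (P + s) ^+ 2 = (a + 1) ^+ 2 * s ->
  r = s \/ r = P ^+ 2 / s.
Proof.
move=> a0 s0 Er Es.
have : a * ((r - s) * (r * s - P ^+ 2)) = 0.
  transitivity (s * (a * (P + r) ^+ 2) - r * (a * (P + s) ^+ 2)); first by ring.
  by rewrite Er Es; ring.
move/eqP; rewrite !mulf_eq0 (negbTE a0) /= !subr_eq0 => /orP[/eqP|/eqP] E.
  by left.
by right; rewrite -E mulfK.
Qed.

(** The two eigenvalues are a l and l. Unless the form is already diagonal, the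
    vector (f, l - e) is an eigenvector for l, and it need not be normalized since
    similarities may scale. *)
Lemma quadratic_form_axes (a e f g : R) : a != 0 -> e * g - f ^+ 2 != 0 ->
  a * (e + g) ^+ 2 = (a + 1) ^+ 2 * (e * g - f ^+ 2) ->
  exists h1 h2 l, [/\ h1 ^+ 2 + h2 ^+ 2 != 0, l != 0 & forall x y,
    e * x ^+ 2 + 2 * f * x * y + g * y ^+ 2 =
    l * ((h2 * x + h1 * y) ^+ 2 + a * (h1 * x - h2 * y) ^+ 2)].
Proof.
move=> a0 d0 E.
have [|k [l [tE dE k0 kl]]] := ratio_eigenvalues a0 d0 _ E.
  move=> a1; move: E; rewrite a1 addNr expr0n mul0r mulN1r => /eqP.
  rewrite oppr_eq0 expf_eq0 addr_eq0/= => /eqP eg.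
  rewrite lt_neqAle d0 eg -subr_ge0 (_ : _ - _ = f ^+ 2 + g ^+ 2); last by ring.
  by rewrite addr_ge0 ?sqr_ge0.
have l0 : l != 0 by apply: contraNneq k0 => ->; rewrite mulr0.
have {kl}kE : k = a * l by rewrite -kl divfK.
have gE : g = (1 + a) * l - e by apply: (addrI e); rewrite tE kE; ring.
have fE : f ^+ 2 = - (e - l) * (e - a * l).
  by apply: oppr_inj; apply: (addrI (e * g)); rewrite dE kE gE; ring.
have [f0|f0] := eqVneq f 0.
  move: fE; rewrite f0 expr0n mulNr => /esym/eqP.
  rewrite oppr_eq0 mulf_eq0 !subr_eq0 => /orP[/eqP el|/eqP el].
    exists 0, 1, l; split => [|//|x y].
      by rewrite expr0n expr1n add0r oner_eq0.
    by rewrite gE el; ring.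
  exists 1, 0, l; split => [|//|x y].
    by rewrite expr0n expr1n addr0 oner_eq0.
  by rewrite gE el; ring.
pose N := f ^+ 2 + (l - e) ^+ 2.
have N0 : N != 0.
  by rewrite gt_eqF// ltr_wpDr ?sqr_ge0// lt0r sqrf_eq0 f0 sqr_ge0.
exists (l - e), f, (l / N); split; first by rewrite addrC.
  by rewrite mulf_neq0// invr_neq0.
move=> x y; apply: (mulfI N0).
transitivity (l * ((f * x + (l - e) * y) ^+ 2 + a * ((l - e) * x - f * y) ^+ 2));
  last by field.
have -> : l * ((f * x + (l - e) * y) ^+ 2 + a * ((l - e) * x - f * y) ^+ 2) =
  l * (f ^+ 2 + a * (l - e) ^+ 2) * x ^+ 2 +
  l * (1 - a) * (l - e) * 2 * f * x * y +
  l * ((l - e) ^+ 2 + a * f ^+ 2) * y ^+ 2 by ring.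
by rewrite /N fE gE; ring.
Qed.

Lemma angle_exists (c s : R) : c ^+ 2 + s ^+ 2 = 1 ->
  exists t, cos t = c /\ sin t = s.
Proof.
move=> E.
have c1 : -1 <= c <= 1.
  rewrite -ler_norml -(ler_pXn2r (n := 2)) ?nnegrE// expr1n real_normK ?num_real//.
  by rewrite -E lerDl sqr_ge0.
have sE : Num.sqrt (1 - c ^+ 2) = `|s|.
  by rewrite -E addrC addKr sqrtr_sqr.
case: (leP 0 s) => s0.
  by exists (acos c); rewrite acosK// sin_acos// sE ger0_norm.
by exists (- acos c); rewrite cosN sinN acosK// sin_acos// sE ltr0_norm// opprK.
Qed.

Lemma is_derive_ln_norm (x : R) : x != 0 ->
  is_derive x (1 : R) (fun z : R => ln `|z|) x^-1.
Proof.
move=> x0; case: (ltgtP x 0) x0 => // lt _.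
  have near0 : \near x, ln (- x) = ln `|x|.
    have : \forall y \near x, y < 0 by apply: lt_nbhsl.
    by apply: filterS => y y0; rewrite ltr0_norm.
  apply: (near_eq_is_derive near0).
  have lnd : is_derive (- x) (1 : R) (@ln R) (- x)^-1.
    by apply: is_derive1_ln; rewrite oppr_gt0.
  apply: (is_derive_congr (is_derive_compose lnd (is_derive_opp (is_derive_ident x)))).
  by rewrite invrN mulrN1 opprK.
have near0 : \near x, ln x = ln `|x|.
  have : \forall y \near x, 0 < y by apply: lt_nbhsr.
  by apply: filterS => y y0; rewrite gtr0_norm.
by apply: (near_eq_is_derive near0); exact: is_derive1_ln.
Qed.

End AuxiliaryAlgebra.

(** * A curve in a vertical plane *)

(** After a rotation the curve in the vertical plane is (x0, y u, z u), with
    slope G = z' / y'. The other curve is (X v, Y v, Z v) with slopes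
    w = Y' / X' and Q = Z' / X'. The function r, depending on v only, is the quotient
    of the two diagonal entries of the Hessian in the frame (1, w), (0, 1); the
    constants A and B come from separating the variables u and v. *)
Section SeparatedSystem.
Variables (R : realType) (a : R) (I J : set R) (x0 A B : R).
Variables (y y1 z G X X1 Y Z w Q r r1 : R -> R).
Hypotheses (a0 : a != 0) (nI : nondegenerate_interval I)
  (nJ : nondegenerate_interval J).
Hypotheses (X1P : forall v, J v -> X1 v != 0) (rP : forall v, J v -> r v != 0)
  (GP : forall u, I u -> A - B * G u != 0).
Hypotheses (yd : forall u, I u -> is_derive u (1 : R) y (y1 u))
  (zd : forall u, I u -> is_derive u (1 : R) z (G u * y1 u))
  (Gd : forall u, I u -> is_derive u (1 : R) G (y1 u * (A - B * G u)))
  (Xd : forall v, J v -> is_derive v (1 : R) X (X1 v))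
  (Yd : forall v, J v -> is_derive v (1 : R) Y (w v * X1 v))
  (Zd : forall v, J v -> is_derive v (1 : R) Z (Q v * X1 v))
  (wd : forall v, J v -> is_derive v (1 : R) w (X1 v * (B * r v)))
  (Qd : forall v, J v -> is_derive v (1 : R) Q (X1 v * (A * r v)))
  (rd : forall v, J v -> is_derive v (1 : R) r (r1 v)).
Hypothesis rE : forall v, J v ->
  a * (1 + w v ^+ 2 + r v) ^+ 2 = (a + 1) ^+ 2 * r v.

Let II : is_interval I := nI.1.
Let IJ : is_interval J := nJ.1.

Definition separated_goal : Prop := (exists M g,
  [/\ model_surface a M, simil_ok g & forall u v, I u -> J v ->
      M (simil_map g (vec3 (x0 + X v) (y u + Y v) (z u + Z v)))]) /\
  exists n1 n2 n3 k, [|| n1 != 0, n2 != 0 | n3 != 0] /\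
    forall v, J v -> n1 * X v + n2 * Y v + n3 * Z v = k.

(** When B = 0 the slope w and the quotient r are constant, both curves are
    parabolas, and the surface is part of the graph of a quadratic polynomial. *)
Lemma separated_paraboloid : B = 0 -> separated_goal.
Proof.
move=> B0; have [_ [u0 [_ [Iu0 _ _]]]] := nI; have [_ [v0 [_ [Jv0 _ _]]]] := nJ.
have A0 : A != 0 by have := GP Iu0; rewrite B0 mul0r subr0.
have [w0 wE] : exists w0, forall v, J v -> w v = w0.
  exists (w v0) => v Jv; apply: (constant_on IJ _ Jv Jv0) => x Jx.
  by apply: (is_derive_congr (wd Jx)); rewrite B0; ring.
have [r0 [r00 rC]] : exists r0, r0 != 0 /\ forall v, J v -> r v = r0.
  exists (r v0); split; first exact: rP.
  apply: (two_valued_constant (r := (1 + w0 ^+ 2) ^+ 2 / r v0) IJ Jv0).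
    by move=> x Jx; exact: is_derive_continuous (rd Jx).
  move=> x Jx; apply: (@ratio_roots _ a) => //; first exact: rP.
    by have := rE Jx; rewrite wE.
  by have := rE Jv0; rewrite wE.
have [G0 GE] : exists G0, forall u, I u -> G u = A * y u + G0.
  exists (G u0 - A * y u0) => u Iu; rewrite -(subrK (A * y u) (G u)) addrC.
  congr (_ + _); apply: (constant_on (f := fun u => G u - A * y u) II _ Iu Iu0).
  move=> x Ix; have yx := yd Ix; have Gx := Gd Ix; derive_tac.
  by rewrite B0; ring.
have [z0 zE] : exists z0, forall u, I u -> z u = A / 2 * y u ^+ 2 + G0 * y u + z0.
  exists (z u0 - (A / 2 * y u0 ^+ 2 + G0 * y u0)) => u Iu.
  rewrite addrC; apply/eqP; rewrite -subr_eq; apply/eqP.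
  apply: (constant_on (f := fun u => z u - (A / 2 * y u ^+ 2 + G0 * y u)) II _ Iu Iu0).
  move=> x Ix; have yx := yd Ix; have zx := zd Ix; derive_tac.
  by rewrite GE//; field.
have [Y0 YE] : exists Y0, forall v, J v -> Y v = w0 * X v + Y0.
  exists (Y v0 - w0 * X v0) => v Jv; apply/eqP; rewrite addrC -subr_eq; apply/eqP.
  apply: (constant_on (f := fun v => Y v - w0 * X v) IJ _ Jv Jv0).
  move=> x Jx; have Xx := Xd Jx; have Yx := Yd Jx; derive_tac.
  by rewrite wE//; ring.
have [Q0 QE] : exists Q0, forall v, J v -> Q v = A * r0 * X v + Q0.
  exists (Q v0 - A * r0 * X v0) => v Jv; apply/eqP; rewrite addrC -subr_eq; apply/eqP.
  apply: (constant_on (f := fun v => Q v - A * r0 * X v) IJ _ Jv Jv0).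
  move=> x Jx; have Xx := Xd Jx; have Qx := Qd Jx; derive_tac.
  by rewrite rC//; ring.
have [Z0 ZE] : exists Z0, forall v, J v ->
    Z v = A * r0 / 2 * X v ^+ 2 + Q0 * X v + Z0.
  exists (Z v0 - (A * r0 / 2 * X v0 ^+ 2 + Q0 * X v0)) => v Jv.
  apply/eqP; rewrite addrC -subr_eq; apply/eqP.
  apply: (constant_on (f := fun v => Z v - (A * r0 / 2 * X v ^+ 2 + Q0 * X v)) IJ _ Jv Jv0).
  move=> x Jx; have Xx := Xd Jx; have Zx := Zd Jx; derive_tac.
  by rewrite QE//; field.
split; last first.
  exists (- w0), 1, 0, Y0; split; first by rewrite oner_eq0 orbT.
  by move=> v /YE ->; ring.
have [k1 [k2 [l [k0 l0 kE]]]] : exists h1 h2 l, [/\ h1 ^+ 2 + h2 ^+ 2 != 0, l != 0 &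
    forall s t, (w0 ^+ 2 + r0) * s ^+ 2 + 2 * (- w0) * s * t + 1 * t ^+ 2 =
    l * ((h2 * s + h1 * t) ^+ 2 + a * (h1 * s - h2 * t) ^+ 2)].
  have dE : (w0 ^+ 2 + r0) * 1 - (- w0) ^+ 2 = r0 by ring.
  apply: quadratic_form_axes; rewrite ?dE//.
  by have := rE Jv0; rewrite wE// rC// => <-; ring.
pose m := 2 / (l * A).
exists (paraboloid a), (Simil false k1 k2 (m * (G0 * w0 - Q0)) (- m * G0) m
  (- k1 * x0 + k2 * Y0) (- k2 * x0 - k1 * Y0)
  (m * (G0 * Y0 - G0 * w0 * x0 + Q0 * x0 - z0 - Z0))).
split; first by constructor 1.
  by split => //=; rewrite /m mulf_neq0 ?invr_neq0 ?mulf_neq0.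
move=> u v Iu Jv; rewrite simil_mapE /linx /liny /linz /= expr0 YE// zE// ZE//.
pose s := X v; pose t := y u + w0 * X v.
exists (k1 * s - k2 * t) => //; exists (k2 * s + k1 * t) => //.
congr vec3; rewrite -/s -/t; [by rewrite /t /s; ring|by rewrite /t /s; ring|].
have -> : (k2 * s + k1 * t) ^+ 2 + a * (k1 * s - k2 * t) ^+ 2 =
    l^-1 * (t ^+ 2 - 2 * w0 * s * t + (w0 ^+ 2 + r0) * s ^+ 2).
  apply: (mulfI l0); rewrite -kE mulVKf//; ring.
by rewrite /m /t /s; field; rewrite A0.
Qed.

(** For a = 1 the relation between w and r is a sum of two squares, which forces
    w = 0. *)
Lemma separated_ratio_neq1 : B != 0 -> a != 1.
Proof.
move=> B0; have [_ [v0 [_ [Jv0 _ _]]]] := nJ.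
apply/eqP => a1.
have w0 v : J v -> w v = 0.
  move=> Jv; have : (r v - 1 + w v ^+ 2) ^+ 2 + (2 * w v) ^+ 2 = 0.
    have := rE Jv; rewrite a1 mul1r => E.
    transitivity ((1 + w v ^+ 2 + r v) ^+ 2 - (1 + 1) ^+ 2 * r v); first by ring.
    by rewrite E subrr.
  move/eqP; rewrite paddr_eq0 ?sqr_ge0// => /andP[_].
  by rewrite sqrf_eq0 mulf_eq0 pnatr_eq0/= => /eqP.
have /eqP := derive_eq_onW nJ Jv0 (wd Jv0) (is_derive_const 0 v0) w0.
by rewrite !mulf_eq0 (negbTE (X1P Jv0)) (negbTE B0) (negbTE (rP Jv0)).
Qed.

(** With 1 + w^2 + r = 2 b t the relation between w and r splits into this linear
    one and r = (b^2 - 1) t^2, and then (b - 1 / t, w / t) is a point of the unit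
    circle. For b = 0 the first equation does not determine t, and the sign of t
    can be chosen. *)
Lemma separated_parameter (b : R) : a != 1 -> b = (a + 1) / (a - 1) ->
  exists t t1 : R -> R, forall v, J v ->
    [/\ is_derive v (1 : R) t (t1 v), t v != 0, r v = (b ^+ 2 - 1) * t v ^+ 2 &
        1 + w v ^+ 2 + r v = 2 * b * t v].
Proof.
move=> a1 bE; have am : a - 1 != 0 by rewrite subr_eq0.
have P0 v : 0 < 1 + w v ^+ 2 by rewrite ltr_wpDr ?sqr_ge0.
have [b0|b0] := eqVneq b 0.
  have aE : a = -1.
    move/eqP: bE; rewrite b0 eq_sym mulf_eq0 invr_eq0 (negbTE am) orbF.
    by rewrite addr_eq0 => /eqP.
  exists (fun v => Num.sqrt (1 + w v ^+ 2)),
    (fun v => (2 * Num.sqrt (1 + w v ^+ 2))^-1 * (2 * w v * (X1 v * (B * r v)))).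
  move=> v Jv; have rv : r v = - (1 + w v ^+ 2).
    have := rE Jv; rewrite aE addNr expr0n/= mul0r mulN1r => /eqP.
    by rewrite oppr_eq0 sqrf_eq0 addrC addr_eq0 => /eqP.
  split.
  - apply: (is_derive_compose (f := Num.sqrt)); first exact: is_derive1_sqrt.
    have wx := wd Jv; derive_tac; ring.
  - by rewrite sqrtr_eq0 -ltNge.
  - by rewrite sqr_sqrtr ?ltW// b0 rv; ring.
  - by rewrite rv b0; ring.
have ap : a + 1 != 0 by move: b0; rewrite bE; apply: contraNneq => ->; rewrite mul0r.
exists (fun v => (1 + w v ^+ 2 + r v) / (2 * b)),
  (fun v => (2 * w v * (X1 v * (B * r v)) + r1 v) / (2 * b)).
move=> v Jv.
have tr : r v = (b ^+ 2 - 1) * ((1 + w v ^+ 2 + r v) / (2 * b)) ^+ 2.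
  apply: (mulfI (expf_neq0 2 ap)); rewrite -rE// bE; field.
  by rewrite am ap.
split => //.
- have wx := wd Jv; have rx := rd Jv; derive_tac; ring.
- by apply: contraNneq (rP Jv) => t0; rewrite tr t0 expr0n mulr0.
- by field.
Qed.

(** When B <> 0 the equation for G makes the first curve exponential. The second
    curve is parametrized by the angle V with sin V = b - 1 / t and
    cos V = w / t: there h X = V + b cos V up to a constant, so that this formula
    can serve as definition of V and no angle has to be lifted. *)
Lemma separated_exponential : B != 0 -> separated_goal.
Proof.
move=> B0; have a1 := separated_ratio_neq1 B0.
have [_ [u0 [_ [Iu0 _ _]]]] := nI; have [_ [v0 [v9 [Jv0 Jv9 v09]]]] := nJ.
pose b := (a + 1) / (a - 1); pose kb := b ^+ 2 - 1.
have am : a - 1 != 0 by rewrite subr_eq0.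
have kbE : kb = 4 * a / (a - 1) ^+ 2 by rewrite /kb /b; field.
have kb0 : kb != 0.
  by rewrite kbE !mulf_neq0 ?pnatr_eq0// invr_neq0// expf_neq0.
have [t [t1 tP]] := separated_parameter a1 (erefl b).
have [h hE] : exists h, h = B * kb by exists (B * kb).
have h0 : h != 0 by rewrite hE mulf_neq0.
have td v : J v -> is_derive v (1 : R) t (t1 v) by case/tP.
have t0 v : J v -> t v != 0 by case/tP.
have rt v : J v -> r v = kb * t v ^+ 2 by case/tP.
have pt v : J v -> 1 + w v ^+ 2 + kb * t v ^+ 2 = 2 * b * t v.
  by move=> Jv; rewrite -rt//; case: (tP _ Jv).
have wd' v : J v -> is_derive v (1 : R) w (h * X1 v * t v ^+ 2).
  by move=> Jv; apply: (is_derive_congr (wd Jv)); rewrite rt// hE; ring.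
pose E v := b - kb * t v.
have tE v : J v -> t1 v * E v = w v * (h * X1 v * t v ^+ 2).
  move=> Jv.
  have F : is_derive v (1 : R) (fun v => 1 + w v ^+ 2 + kb * t v ^+ 2)
      (2 * w v * (h * X1 v * t v ^+ 2) + kb * (2 * t v * t1 v)).
    have wx := wd' _ Jv; have tx := td _ Jv; derive_tac; ring.
  have F' : is_derive v (1 : R) (fun v => 2 * b * t v) (2 * b * t1 v).
    have tx := td _ Jv; derive_tac; ring.
  have := derive_eq_onW nJ Jv F F' pt => H.
  have two0 : 2 != 0 :> R by rewrite pnatr_eq0.
  apply: (mulfI two0); apply: (addIr (2 * kb * t v * t1 v)).
  transitivity (2 * b * t1 v); first by rewrite /E; ring.
  by rewrite -H; ring.
(* E would vanish where the model curve is singular. There w would vanish by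
   the previous identity, which the relation between w and t excludes. This is
   where r has to be differentiable up to the ends of J. *)
have E0 v : J v -> E v != 0.
  move=> Jv; apply/eqP => Ev; have := tE _ Jv; rewrite Ev mulr0 => /esym/eqP.
  rewrite !mulf_eq0 (negbTE h0) (negbTE (X1P Jv)) (negbTE (t0 _ Jv)).
  rewrite /= orbF => /eqP w0.
  have bt : b = kb * t v by apply/eqP; rewrite -subr_eq0 -/(E v) Ev.
  have : kb * t v ^+ 2 = 1.
    have := pt _ Jv; rewrite w0 {1}bt expr0n/= addr0 => H.
    apply: (addIr (kb * t v ^+ 2)); rewrite H; ring.
  move=> k1; have : b ^+ 2 = kb.
    transitivity (kb * (kb * t v ^+ 2)); last by rewrite k1 mulr1.
    by rewrite {1}bt; ring.
  rewrite /kb => /eqP; rewrite -subr_eq0 opprB addrC addrNK.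
  by rewrite oner_eq0.
pose s v := b - (t v)^-1; pose c v := w v / t v.
have cs v : J v -> c v ^+ 2 + s v ^+ 2 = 1.
  move=> Jv; have T := t0 _ Jv.
  transitivity ((1 + w v ^+ 2 + kb * t v ^+ 2 - 2 * b * t v) / t v ^+ 2 + 1).
    by rewrite /c /s /kb; field.
  by rewrite pt// subrr mul0r add0r.
have td' v : J v -> t1 v = w v * (h * X1 v * t v ^+ 2) / E v.
  by move=> Jv; rewrite -tE// mulfK// E0.
have [phi [cphi sphi]] := angle_exists (cs _ Jv0).
pose V v := h * X v - h * X v0 - b * (c v - c v0) + phi.
have cd v : J v -> is_derive v (1 : R) c (h * X1 v * (1 - b * t v) / E v).
  move=> Jv; have wx := wd' _ Jv; have tx := td _ Jv; have T := t0 _ Jv.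
  have Ev := E0 _ Jv.
  derive_tac => //; rewrite (td' _ Jv).
  have -> : 1 - b * t v = t v * E v - w v ^+ 2.
    transitivity ((1 + w v ^+ 2 + kb * t v ^+ 2 - 2 * b * t v) + (t v * E v - w v ^+ 2)).
      by rewrite /E; ring.
    by rewrite pt// subrr add0r.
  by field; rewrite Ev T.
have sd v : J v -> is_derive v (1 : R) s (w v * (h * X1 v) / E v).
  move=> Jv; have tx := td _ Jv; have T := t0 _ Jv; have Ev := E0 _ Jv.
  derive_tac => //; rewrite (td' _ Jv).
  by field; rewrite Ev T.
have Vd v : J v -> is_derive v (1 : R) V (h * X1 v * t v / E v).
  move=> Jv; have Xx := Xd Jv; have cx := cd _ Jv; have Ev := E0 _ Jv.
  derive_tac; move: Ev; rewrite /E /kb => Ev; by field.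
(* The two unit vectors (c, s) and (cos V, sin V) rotate at the same speed, so
   their inner product is constant. *)
have VE v : J v -> cos (V v) = c v /\ sin (V v) = s v.
  move=> Jv.
  have F x : J x -> is_derive x (1 : R)
      (fun x => c x * cos (V x) + s x * sin (V x)) 0.
    move=> Jx; have cx := cd _ Jx; have sx := sd _ Jx; have Vx := Vd _ Jx.
    have T := t0 _ Jx; have Ex := E0 _ Jx.
    derive_tac; rewrite /s /c; field; by rewrite T Ex.
  have := constant_on IJ F Jv Jv0; rewrite /V /= !subrr mulr0 subr0 add0r -/(V v).
  rewrite cphi sphi -!expr2 cs// => CS.
  have : (c v - cos (V v)) ^+ 2 + (s v - sin (V v)) ^+ 2 = 0.
    transitivity ((c v ^+ 2 + s v ^+ 2) + (cos (V v) ^+ 2 + sin (V v) ^+ 2)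
      - 2 * (c v * cos (V v) + s v * sin (V v))); first by ring.
    by rewrite cs// cos2Dsin2 CS; ring.
  move/eqP; rewrite paddr_eq0 ?sqr_ge0// !sqrf_eq0 !subr_eq0.
  by move=> /andP[/eqP <- /eqP <-].
have [K1 XE] : exists K, forall v, J v -> h * X v = V v + b * cos (V v) + K.
  exists (h * X v0 - b * c v0 - phi) => v Jv; have [-> _] := VE _ Jv.
  rewrite /V; ring.
pose W v := b * sin (V v) + kb * ln `|b - sin (V v)|.
have bs v : J v -> b - sin (V v) = (t v)^-1.
  by move=> /VE[_ ->]; rewrite /s opprB addrC subrK.
have [K2 YE] : exists K, forall v, J v -> h * Y v = W v + K.
  exists (h * Y v0 - W v0) => v Jv; apply/eqP; rewrite addrC -subr_eq; apply/eqP.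
  apply: (constant_on (f := fun v => h * Y v - W v) IJ _ Jv Jv0).
  move=> x Jx; have Yx := Yd Jx; have Vx := Vd _ Jx.
  have T := t0 _ Jx; have Ex := E0 _ Jx.
  have lx : is_derive x (1 : R) (fun x => ln `|b - sin (V x)|)
      ((b - sin (V x))^-1 * (- (cos (V x) * (h * X1 x * t x / E x)))).
    apply: (is_derive_compose (f := fun z => ln `|z|)).
      by apply: is_derive_ln_norm; rewrite bs// invr_neq0.
    derive_tac; ring.
  derive_tac; rewrite bs// (VE _ Jx).1 /c; move: Ex; rewrite /E => Ex.
  by field; rewrite Ex T.
pose m := A / B.
have [C [C0 GE]] : exists C, C != 0 /\ forall u, I u -> G u - m = C * expR (- B * y u).
  have F x : I x -> is_derive x (1 : R) (fun u => (G u - m) * expR (B * y u)) 0.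
    move=> Ix; have yx := yd Ix; have Gx := Gd Ix; derive_tac.
    by rewrite /m; field.
  have GE u : I u -> (G u - m) * expR (B * y u) = (G u0 - m) * expR (B * y u0).
    by move=> Iu; exact: (constant_on II F Iu Iu0).
  exists ((G u0 - m) * expR (B * y u0)); split.
    apply: mulf_neq0; last by rewrite gt_eqF// expR_gt0.
    apply: contraNneq (GP Iu0) => H.
    have -> : G u0 = m by apply/eqP; rewrite -subr_eq0 H.
    by rewrite /m mulrC divfK// subrr.
  move=> u Iu; rewrite -(GE u Iu) -mulrA -expRD mulNr subrr expR0 mulr1 //.
have [K3 zE] : exists K, forall u, I u ->
    z u - m * y u + C / B * expR (- B * y u) = K.
  eexists => u Iu.
  apply: (constant_on (f := fun u => z u - m * y u + C / B * expR (- B * y u)) II _ Iu Iu0).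
  move=> x Ix; have yx := yd Ix; have zx := zd Ix; derive_tac.
  have -> : G x = m + C * expR (- B * y x) by rewrite -GE// addrC subrK.
  by field.
have [q QE] : exists q, forall v, J v -> Q v = m * w v + q.
  exists (Q v0 - m * w v0) => v Jv; apply/eqP; rewrite addrC -subr_eq; apply/eqP.
  apply: (constant_on (f := fun v => Q v - m * w v) IJ _ Jv Jv0).
  move=> x Jx; have Qx := Qd Jx; have wx := wd Jx; derive_tac.
  by rewrite /m; field.
have [K4 ZE] : exists K, forall v, J v -> Z v - m * Y v - q * X v = K.
  eexists => v Jv.
  apply: (constant_on (f := fun v => Z v - m * Y v - q * X v) IJ _ Jv Jv0).
  move=> x Jx; have Xx := Xd Jx; have Yx := Yd Jx; have Zx := Zd Jx; derive_tac.
  by rewrite QE//; ring.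
split; last first.
  exists (- q), (- m), 1, K4; split; first by rewrite oner_eq0 !orbT.
  by move=> v /ZE <-; ring.
exists (exp_surface b (V @` J)), (Simil false h 0 (B * q / C) (B * m / C) (- B / C)
  (- h * x0 - K1) (- K2) (B / C * (K3 + K4 - q * x0))); split.
- constructor 2; split => //; exists (V @` J) => //; split; first split.
  + move=> _ _ [s1 Js <-] [s2 Jt <-] x xst.
    have [|v Jv <-] := @IVT_on R J V s1 s2 x IJ Js Jt _ xst; last by exists v.
    by move=> ? Jv; exact: is_derive_continuous (Vd _ Jv).
  + have V09 : V v0 != V v9.
      apply/eqP => /(injective_on IJ Vd _ Jv0 Jv9) E09.
      move: v09; rewrite E09 ?ltxx// => v Jv.
      by rewrite !mulf_neq0 ?X1P ?t0// invr_neq0// E0.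
    case: (ltgtP (V v0) (V v9)) V09 => // lt _.
      by exists (V v0), (V v9); split => //.
    by exists (V v9), (V v0); split => //.
  + move=> _ [v Jv <-]; split => _.
      by rewrite eq_sym -subr_eq0 bs// invr_neq0// t0.
    rewrite eq_sym -subr_eq0 (VE _ Jv).2.
    have -> : 1 - b * s v = E v / t v.
      by rewrite /s /E /kb; field; rewrite t0.
    by rewrite mulf_neq0 ?invr_neq0 ?E0 ?t0.
- split => /=; first by rewrite expr0n addr0 expf_neq0.
  by rewrite mulf_neq0 ?invr_neq0 ?oppr_eq0.
move=> u v Iu Jv; rewrite simil_mapE /linx /liny /linz /= expr0.
exists (- B * y u) => //; exists (V v); first by exists v.
congr vec3.
- transitivity (h * X v - K1); first by rewrite XE//; ring.
  by ring.
- transitivity (h * Y v - K2 + h * y u); last by ring.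
  by rewrite YE// /W hE /kb; ring.
- apply: (mulfI (mulf_neq0 C0 (invr_neq0 B0))).
  have -> : Z v = K4 + m * Y v + q * X v by rewrite -(ZE _ Jv); ring.
  have -> : C / B * expR (- B * y u) = K3 - z u + m * y u by rewrite -(zE _ Iu); ring.
  by field; rewrite B0 C0.
Qed.

End SeparatedSystem.

Section VerticalPlane.
Variables (R : realType) (a : R) (I J : set R) (c d : curve R).
Hypotheses (a0 : a != 0) (nI : nondegenerate_interval I)
  (nJ : nondegenerate_interval J) (cj : curve_jet 3 I c) (dj : curve_jet 3 J d).
Hypothesis c_vertical : forall u, I u -> cx c 1 u = 0.
Hypothesis cd_ratio : forall u v, I u -> J v -> ratio_at a c d u v.

Let y1 := cy c 1.
Let X1 := cx d 1.
Let G u := cz c 1 u / y1 u.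
Let w v := cy d 1 v / X1 v.
Let Q v := cz d 1 v / X1 v.
Let g2 u := (cz c 2 u * y1 u - cz c 1 u * cy c 2 u) / y1 u ^+ 3.
Let p2 v := (cy d 2 v * X1 v - cy d 1 v * cx d 2 v) / X1 v ^+ 3.
Let q2 v := (cz d 2 v * X1 v - cz d 1 v * cx d 2 v) / X1 v ^+ 3.
Let n2 u v := q2 v - G u * p2 v.

(** For fixed v the quotient r = (q2 - G p2) / g2 satisfies a quadratic equation
    whose coefficients do not depend on u, so by continuity it does not depend on
    u. As G is not constant, the identity q2 - G p2 = r g2 then separates: p2 and q2
    are constant multiples of r. *)
Lemma vertical_plane_separated : separated_goal a I J (cx c 0 (sval (cid nI.2)))
  (cy c 0) (cz c 0) (cx d 0) (cy d 0) (cz d 0).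
Proof.
have IJ := nJ.1; have II := nI.1.
case: (cid nI.2) => u0 /= [_ [Iu0 _ _]].
have [_ [v0 [_ [Jv0 _ _]]]] := nJ.
have y1d u : I u -> is_derive u (1 : R) y1 (cy c 2 u) by move=> Iu; case: (@cj 1%N u).
have z1d u : I u -> is_derive u (1 : R) (cz c 1) (cz c 2 u) by move=> Iu; case: (@cj 1%N u).
have y2d u : I u -> is_derive u (1 : R) (cy c 2) (cy c 3 u) by move=> Iu; case: (@cj 2%N u).
have z2d u : I u -> is_derive u (1 : R) (cz c 2) (cz c 3 u) by move=> Iu; case: (@cj 2%N u).
have X1d v : J v -> is_derive v (1 : R) X1 (cx d 2 v) by move=> Jv; case: (@dj 1%N v).
have Y1d v : J v -> is_derive v (1 : R) (cy d 1) (cy d 2 v) by move=> Jv; case: (@dj 1%N v).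
have Z1d v : J v -> is_derive v (1 : R) (cz d 1) (cz d 2 v) by move=> Jv; case: (@dj 1%N v).
have X2d v : J v -> is_derive v (1 : R) (cx d 2) (cx d 3 v) by move=> Jv; case: (@dj 2%N v).
have Y2d v : J v -> is_derive v (1 : R) (cy d 2) (cy d 3 v) by move=> Jv; case: (@dj 2%N v).
have Z2d v : J v -> is_derive v (1 : R) (cz d 2) (cz d 3 v) by move=> Jv; case: (@dj 2%N v).
have x2 u : I u -> cx c 2 u = 0.
  move=> Iu; have [xd _ _] := @cj 1%N u isT Iu.
  exact: (derive_eq_onW nI Iu xd (is_derive_const 0 u) c_vertical).
have yX u v : I u -> J v -> (y1 u != 0) && (X1 v != 0).
  move=> Iu Jv; have [D0 _ _ _] := cd_ratio Iu Jv; move: D0.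
  by rewrite /jac c_vertical// mul0r sub0r oppr_eq0 mulf_eq0 negb_or.
have y0 u : I u -> y1 u != 0 by move=> Iu; case/andP: (yX _ _ Iu Jv0).
have X0 v : J v -> X1 v != 0 by move=> Jv; case/andP: (yX _ _ Iu0 Jv).
have L u v : I u -> J v -> bend1 c d u v = - X1 v * y1 u ^+ 3 * g2 u.
  move=> Iu Jv; rewrite /bend1 /det3 c_vertical// x2// /g2 /y1 /X1; field.
  exact: y0.
have N u v : I u -> J v -> bend2 c d u v = - y1 u * X1 v ^+ 3 * n2 u v.
  move=> Iu Jv; rewrite /bend2 /det3 c_vertical// /n2 /q2 /p2 /G; move: (y0 _ Iu) (X0 _ Jv).
  by rewrite /y1 /X1 => yu Xv; field; rewrite yu Xv.
have g20 u : I u -> g2 u != 0.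
  move=> Iu; have [_ + _ _] := cd_ratio Iu Jv0; rewrite L//.
  by apply: contraNneq => ->; rewrite mulr0.
have n20 u v : I u -> J v -> n2 u v != 0.
  move=> Iu Jv; have [_ _ + _] := cd_ratio Iu Jv; rewrite N//.
  by apply: contraNneq => ->; rewrite mulr0.
have EQ u v : I u -> J v -> a * (1 + w v ^+ 2 + n2 u v / g2 u) ^+ 2 =
    (a + 1) ^+ 2 * (n2 u v / g2 u).
  move=> Iu Jv; have [_ _ _] := cd_ratio Iu Jv; rewrite L// N// => E.
  have k0 : y1 u ^+ 6 * X1 v ^+ 6 * g2 u ^+ 2 != 0.
    apply: mulf_neq0; last by apply: expf_neq0; exact: g20.
    by apply: mulf_neq0; apply: expf_neq0; [exact: y0|exact: X0].
  apply: (mulfI k0).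
  transitivity (a * (- X1 v * y1 u ^+ 3 * g2 u * speed2 d v +
    - y1 u * X1 v ^+ 3 * n2 u v * speed2 c u) ^+ 2).
    rewrite /speed2 c_vertical// /w -/X1 -/y1; field.
    by rewrite X0// g20.
  rewrite E /jac c_vertical// -/X1 -/y1; field.
  by rewrite g20.
have Gd u : I u -> is_derive u (1 : R) G (y1 u * g2 u).
  move=> Iu; have yx := y1d _ Iu; have zx := z1d _ Iu.
  by have yu := y0 _ Iu; rewrite /G /g2; derive_tac => //; field.
have wd v : J v -> is_derive v (1 : R) w (X1 v * p2 v).
  move=> Jv; have Xx := X1d _ Jv; have Yx := Y1d _ Jv.
  by have Xv := X0 _ Jv; rewrite /w /p2; derive_tac => //; field.
have Qd v : J v -> is_derive v (1 : R) Q (X1 v * q2 v).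
  move=> Jv; have Xx := X1d _ Jv; have Zx := Z1d _ Jv.
  by have Xv := X0 _ Jv; rewrite /Q /q2; derive_tac => //; field.
have g2c u : I u -> {for u, continuous g2}.
  move=> Iu; apply: is_derive_continuous; rewrite /g2.
  have yx := y1d _ Iu; have zx := z1d _ Iu; have y2x := y2d _ Iu; have z2x := z2d _ Iu.
  have e3 : (fun x => (cz c 2 x * y1 x - cz c 1 x * cy c 2 x) / y1 x ^+ 3) =
    (fun x => (cz c 2 x * y1 x - cz c 1 x * cy c 2 x) * (y1 x * y1 x ^+ 2)^-1).
    by apply/funext => x; rewrite [y1 x ^+ 3]exprS.
  rewrite e3; derive_tac; last by [].
  by apply: mulf_neq0; [|apply: expf_neq0]; exact: y0.
pose r v := n2 u0 v / g2 u0.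
have r0 v : J v -> r v != 0.
  by move=> Jv; apply: mulf_neq0; [exact: n20|apply: invr_neq0; exact: g20].
have n2E u v : I u -> J v -> n2 u v = r v * g2 u.
  move=> Iu Jv; rewrite -[LHS](divfK (g20 _ Iu)); congr (_ * _).
  apply: (two_valued_constant (f := fun u => n2 u v / g2 u)
    (r := (1 + w v ^+ 2) ^+ 2 / r v) II Iu0) => // x Ix.
    apply: cvgM; last by apply: cvgV; [exact: g20|exact: g2c].
    apply: cvgB; first exact: cvg_cst.
    by apply: cvgM; [exact: is_derive_continuous (Gd _ Ix)|exact: cvg_cst].
  apply: (@ratio_roots _ a) => //; first exact: r0.
    exact: EQ.
  exact: EQ.
have rd v : exists e, J v -> is_derive v (1 : R) r e.
  have [Jv|nJv] := pselect (J v); last by exists 0.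
  have Xx := X1d _ Jv; have Yx := Y1d _ Jv; have Zx := Z1d _ Jv.
  have X2x := X2d _ Jv; have Y2x := Y2d _ Jv; have Z2x := Z2d _ Jv.
  have e3 : r = fun v => (((cz d 2 v * X1 v - cz d 1 v * cx d 2 v) - G u0 *
    (cy d 2 v * X1 v - cy d 1 v * cx d 2 v)) * (X1 v * X1 v ^+ 2)^-1) / g2 u0.
    by apply/funext => x; rewrite /r /n2 /q2 /p2 [X1 x ^+ 3]exprS; ring.
  eexists => _; rewrite e3; derive_tac; last by [].
  by apply: mulf_neq0; [|apply: expf_neq0]; exact: X0.
have [r1 r1d] := choice rd.
pose A := q2 v0 / r v0; pose B := p2 v0 / r v0.
have g2E u : I u -> g2 u = A - B * G u.
  move=> Iu; apply: (mulfI (r0 _ Jv0)); rewrite -n2E// /n2 /A /B; field.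
  exact: r0.
have [u1 [Iu1 G01]] : exists u1, I u1 /\ G u1 != G u0.
  have [s [t [Is It st]]] := nI.2.
  have [Gs|] := eqVneq (G s) (G u0); last by exists s.
  exists t; split => //; rewrite -Gs; apply/eqP => /esym Gst.
  have := injective_on II Gd _ Is It Gst.
  by move=> st'; move: st; rewrite st' ?ltxx// => u Iu; apply: mulf_neq0; [exact: y0|exact: g20].
have pq v : J v -> p2 v = B * r v /\ q2 v = A * r v.
  move=> Jv; have E0 := n2E _ _ Iu0 Jv; have E1 := n2E _ _ Iu1 Jv.
  move: E0 E1; rewrite !g2E// /n2 => E0 E1.
  have pE : p2 v = B * r v.
    apply: (mulfI (_ : G u1 - G u0 != 0)); first by rewrite subr_eq0.
    transitivity ((q2 v - G u0 * p2 v) - (q2 v - G u1 * p2 v)); first by ring.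
    by rewrite E0 E1; ring.
  split => //; transitivity (q2 v - G u0 * p2 v + G u0 * p2 v); first by ring.
  by rewrite E0 pE; ring.
have [x0 xE] : exists x0, forall u, I u -> cx c 0 u = x0.
  exists (cx c 0 u0) => u Iu; apply: (constant_on II _ Iu Iu0) => x Ix.
  by have [xd _ _] := @cj 0%N x isT Ix; rewrite -(c_vertical Ix).
have yd u : I u -> is_derive u (1 : R) (cy c 0) (y1 u).
  by move=> Iu; case: (@cj 0%N u).
have zd u : I u -> is_derive u (1 : R) (cz c 0) (G u * y1 u).
  by move=> Iu; rewrite /G divfK ?y0//; case: (@cj 0%N u).
have Xd v : J v -> is_derive v (1 : R) (cx d 0) (X1 v).
  by move=> Jv; case: (@dj 0%N v).
have Yd v : J v -> is_derive v (1 : R) (cy d 0) (w v * X1 v).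
  by move=> Jv; rewrite /w divfK ?X0//; case: (@dj 0%N v).
have Zd v : J v -> is_derive v (1 : R) (cz d 0) (Q v * X1 v).
  by move=> Jv; rewrite /Q divfK ?X0//; case: (@dj 0%N v).
have Gd' u : I u -> is_derive u (1 : R) G (y1 u * (A - B * G u)).
  by move=> Iu; rewrite -g2E//; exact: Gd.
have GP u : I u -> A - B * G u != 0 by move=> Iu; rewrite -g2E// g20.
have wd' v : J v -> is_derive v (1 : R) w (X1 v * (B * r v)).
  by move=> Jv; rewrite -(pq _ Jv).1; exact: wd.
have Qd' v : J v -> is_derive v (1 : R) Q (X1 v * (A * r v)).
  by move=> Jv; rewrite -(pq _ Jv).2; exact: Qd.
have rE v : J v -> a * (1 + w v ^+ 2 + r v) ^+ 2 = (a + 1) ^+ 2 * r v.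
  by move=> Jv; exact: EQ.
have [B0|B0] := eqVneq B 0.
  exact: (separated_paraboloid _ a0 nI nJ r0 GP yd zd Gd' Xd Yd Zd wd' Qd' r1d rE B0).
exact: (separated_exponential _ a0 nI nJ X0 r0 GP yd zd Gd' Xd Yd Zd wd' Qd' r1d rE B0).
Qed.

Lemma vertical_plane_case : fits a I J c d /\ flat J d.
Proof.
have := vertical_plane_separated.
case: (cid nI.2) => u0 /= [_ [Iu0 _ _]] [[M [g [mM gk MS]]] fl]; split => //.
exists M, g; split => // u v Iu Jv; rewrite /point vec3D.
suff -> : cx c 0 u = cx c 0 u0 by exact: MS.
apply: (constant_on nI.1 _ Iu Iu0) => x Ix.
by have [xd _ _] := @cj 0%N x isT Ix; rewrite -(c_vertical Ix).
Qed.

End VerticalPlane.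

(** * Two pairs of conjugate directions *)

Section ConjugateDirections.

(** A simple root of one factor of a square is a root of the cofactor, for
    the parity of its multiplicity. *)
Lemma square_cofactor_root (F : fieldType) (z : F) (E S T : {poly F}) :
  z + z != 0 -> T != 0 -> S ^+ 2 = T ^+ 2 * (('X ^+ 2 - (z ^+ 2)%:P) * E) -> root E z.
Proof.
move=> z0 T0 H; have [->|E0] := eqVneq E 0; first exact: root0.
apply: contraT => Ez.
have XE : 'X ^+ 2 - (z ^+ 2)%:P = ('X - z%:P) * ('X - (- z)%:P) :> {poly F}.
  by rewrite polyCN polyC_exp; ring.
have X0 (y : F) : 'X - y%:P != 0 :> {poly F} by rewrite polyXsubC_eq0.
have S0 : S != 0.
  by rewrite -sqrf_eq0 H XE !mulf_neq0// expf_neq0.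
have := congr1 (mup z) H; rewrite !expr2 XE !mupM ?mulf_neq0//.
rewrite (mupNroot Ez) -['X - z%:P]expr1 -['X - (- z)%:P]expr1 !mup_XsubCX eqxx.
have -> : (- z == z) = false by rewrite eq_sym -subr_eq0 opprK (negbTE z0).
rewrite !addn0 => /(congr1 odd).
by rewrite !oddD !addbb.
Qed.

Variable R : realType.

Lemma poly_eq_on_injective (I : set R) (s : R -> R) (p q : {poly R}) :
  nondegenerate_interval I ->
  (forall u v, I u -> I v -> s u = s v -> u = v) ->
  (forall u, I u -> p.[s u] = q.[s u]) -> p = q.
Proof.
move=> [II [x [y [Ix Iy xy]]]] sI pq; apply/eqP; rewrite -subr_eq0; apply/eqP.
pose n := size (p - q); pose f i := x + (y - x) * (i%:R / n.+1%:R).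
have If i : (i < n.+1)%N -> I (f i).
  move=> lin; apply: (II x y) => //.
  have i0 : 0 <= i%:R / n.+1%:R :> R by rewrite divr_ge0.
  have i1 : i%:R / n.+1%:R <= 1 :> R.
    by rewrite ler_pdivrMr ?ltr0n// mul1r ler_nat ltnW.
  rewrite /f; move: (_ / _) i0 i1 => t t0 t1.
  by apply/andP; split; nra.
apply: (@roots_geq_poly_eq0 _ _ [seq s (f i) | i <- iota 0 n.+1]).
- apply/allP => _ /mapP[i + ->]; rewrite mem_iota add0n => /andP[_ lin].
  by rewrite /root hornerD hornerN pq ?subrr//; exact: If.
- rewrite map_inj_in_uniq ?iota_uniq// => i j.
  rewrite !mem_iota !add0n => /andP[_ li] /andP[_ lj] /sI -/(_ (If _ li) (If _ lj)).
  move/addrI/(mulfI (lt0r_neq0 _)) => H.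
  have : i%:R / n.+1%:R = j%:R / n.+1%:R :> R by apply: H; rewrite subr_gt0.
  by move/(mulIf _) => /(_ ltac:(by rewrite invr_neq0)) /eqP; rewrite eqr_nat => /eqP.
- by rewrite size_map size_iota.
Qed.

End ConjugateDirections.

Section Resultant.
Variable R : realType.

(** The resultant of the two quadratic equations for k, written as the
    difference of a square and of the product of their discriminants. *)
Lemma eliminate_curvature (k W m0 m1 t0 t1 : R) :
  k ^+ 2 + (m0 * W) ^+ 2 = (t0 - 2 * W) * k * m0 ->
  k ^+ 2 + (m1 * W) ^+ 2 = (t1 - 2 * W) * k * m1 ->
  W != 0 -> m0 != 0 -> m1 != 0 ->
  (2 * W ^+ 2 * (m0 ^+ 2 + m1 ^+ 2) - (t0 - 2 * W) * (t1 - 2 * W) * m0 * m1) ^+ 2 =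
  (m0 * m1) ^+ 2 * ((t0 * (t0 - 4 * W)) * (t1 * (t1 - 4 * W))).
Proof.
move=> E0 E1 W0 m00 m10.
pose Q0 := t0 - 2 * W; pose Q1 := t1 - 2 * W.
have k0 : k != 0.
  apply: contra_neq m00 => k0; move/eqP: E0.
  rewrite k0 expr0n add0r mulr0 mul0r sqrf_eq0 mulf_eq0 (negbTE W0) orbF.
  by move/eqP.
have F1 : W ^+ 2 * (m0 ^+ 2 - m1 ^+ 2) = k * (Q0 * m0 - Q1 * m1).
  transitivity ((k ^+ 2 + (m0 * W) ^+ 2) - (k ^+ 2 + (m1 * W) ^+ 2)); first by ring.
  by rewrite E0 E1 /Q0 /Q1; ring.
have F2 : k * (m1 ^+ 2 - m0 ^+ 2) = m0 * m1 * (Q0 * m1 - Q1 * m0).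
  apply: (mulfI k0).
  transitivity (m1 ^+ 2 * (k ^+ 2 + (m0 * W) ^+ 2) - m0 ^+ 2 * (k ^+ 2 + (m1 * W) ^+ 2)).
    by ring.
  by rewrite E0 E1 /Q0 /Q1; ring.
have F : - W ^+ 2 * (m0 ^+ 2 - m1 ^+ 2) ^+ 2 =
    m0 * m1 * (Q0 * m1 - Q1 * m0) * (Q0 * m0 - Q1 * m1).
  transitivity ((m1 ^+ 2 - m0 ^+ 2) * (W ^+ 2 * (m0 ^+ 2 - m1 ^+ 2))); first by ring.
  by rewrite F1 mulrA [_ * k]mulrC F2.
transitivity ((m0 * m1) ^+ 2 * ((t0 * (t0 - 4 * W)) * (t1 * (t1 - 4 * W))) +
  4 * W ^+ 2 * (m0 * m1 * (Q0 * m1 - Q1 * m0) * (Q0 * m0 - Q1 * m1) -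
    - W ^+ 2 * (m0 ^+ 2 - m1 ^+ 2) ^+ 2)).
  by rewrite /Q0 /Q1; ring.
by rewrite F subrr mulr0 addr0.
Qed.

(** Here s is the slope of a direction and k a scaled curvature of a curve in that
    direction. The resultant makes the product of two quadratic polynomials the
    square of a rational function. The first polynomial has two opposite simple
    complex roots, since K <> 4, so both are roots of the second one; but the
    linear term of the latter is a nonzero multiple of K p q. *)
Lemma no_common_conjugates (I : set R) (s : R -> R) (M0 M1 : {poly R}) (K p q : R) :
  nondegenerate_interval I ->
  (forall u v, I u -> I v -> s u = s v -> u = v) ->
  K != 0 -> K != 4 -> p != 0 -> q != 0 ->
  (forall u, I u -> exists k,
    let W := s u ^+ 2 + 1 in let m0 := M0.[s u] in let m1 := M1.[s u] in
    [/\ m0 != 0, m1 != 0, k ^+ 2 + (m0 * W) ^+ 2 = (K - 2 * W) * k * m0 &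
        k ^+ 2 + (m1 * W) ^+ 2 =
        (K / (p ^+ 2 + q ^+ 2) * (p * s u + q) ^+ 2 - 2 * W) * k * m1]) -> False.
Proof.
move=> nI sI K0 K4 p0 q0 H.
pose n := p ^+ 2 + q ^+ 2.
have n0 : n != 0.
  by rewrite gt_eqF// ltr_wpDr ?sqr_ge0// lt0r sqrf_eq0 p0 sqr_ge0.
have [_ [u0 [_ [Iu0 _ _]]]] := nI.
have M00 : M0 != 0.
  by have [k [m00 _ _ _]] := H _ Iu0; apply: contraNneq m00 => ->; rewrite horner0.
have M10 : M1 != 0.
  by have [k [_ m10 _ _]] := H _ Iu0; apply: contraNneq m10 => ->; rewrite horner0.
pose L : {poly R} := p%:P * 'X + q%:P.
have L0 : L != 0.
  apply/eqP => /(congr1 (fun f => f.[0])); rewrite !hornerE ?mulr0 ?add0r => /eqP.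
  by rewrite (negbTE q0).
pose W : {poly R} := 'X ^+ 2 + 1%:P.
pose t0 : {poly R} := K%:P; pose t1 : {poly R} := (K / n)%:P * L ^+ 2.
pose S : {poly R} := 2 * W ^+ 2 * (M0 ^+ 2 + M1 ^+ 2)
  - (t0 - 2 * W) * (t1 - 2 * W) * M0 * M1.
have [z2 z2E] : exists z2, z2 = (K - 4) / 4 by exists ((K - 4) / 4).
pose E : {poly R} := (- 4 * K ^+ 2 / n)%:P * (t1 - 4%:P * W).
have SE : S ^+ 2 = (M0 * M1 * L) ^+ 2 * (('X ^+ 2 - z2%:P) * E).
  apply: (poly_eq_on_injective nI sI) => u Iu.
  have [k [m0 m1 E0 E1]] := H _ Iu.
  have W0 : s u ^+ 2 + 1 != 0 by rewrite gt_eqF// ltr_wpDl ?sqr_ge0.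
  have := eliminate_curvature E0 E1 W0 m0 m1.
  rewrite /S /E /t1 /t0 /L /W !hornerE /= => ->; rewrite z2E -/n; by field.
pose f := real_complex R.
pose z := sqrtc (f z2).
have zz : z ^+ 2 = f z2 by exact: sqr_sqrtc.
have z20 : z2 != 0 by rewrite z2E mulf_neq0 ?invr_neq0 ?pnatr_eq0// subr_eq0.
have z0 : z != 0.
  by apply: contraNneq z20 => z0; move: zz; rewrite z0 expr0n => /esym/eqP; rewrite fmorph_eq0.
have zN (y : R[i]) : y != 0 -> y + y != 0.
  by move=> y0; rewrite -mulr2n mulrn_eq0.
have SE' (y : R[i]) : y ^+ 2 = f z2 -> (map_poly f S) ^+ 2 =
    (map_poly f (M0 * M1 * L)) ^+ 2 * (('X ^+ 2 - (y ^+ 2)%:P) * map_poly f E).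
  move=> ->; move: SE; move: S (M0 * M1 * L) E => S' T' E' /(congr1 (map_poly f)).
  by rewrite !(rmorphXn, rmorphM, rmorphB) /= map_polyX map_polyC.
have T0 : map_poly f (M0 * M1 * L) != 0.
  by rewrite map_poly_eq0 !mulf_neq0.
have r1 := square_cofactor_root (zN _ z0) T0 (SE' _ zz).
have r2 : root (map_poly f E) (- z).
  apply: (square_cofactor_root (zN (- z) _) T0); first by rewrite oppr_eq0.
  by apply: SE'; rewrite sqrrN.
have Eh (y : R[i]) : (map_poly f E).[y] =
    f (- 4 * K ^+ 2 / n) * (f (K / n) * (f p * y + f q) ^+ 2 - 4 * (y ^+ 2 + 1)).
  rewrite /E /t1 /L /W; move: (- 4 * _ / n) (K / n) => c1 c2.
  rewrite !(rmorphM, rmorphB, rmorphD, rmorphXn) /= !map_polyC map_polyX /=.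
  rewrite !(hornerM, hornerD, hornerN, horner_exp, hornerC, hornerX).
  rewrite rmorph1 /f; ring.
have c0 : f (- 4 * K ^+ 2 / n) != 0.
  rewrite fmorph_eq0 !mulf_neq0 ?invr_neq0// ?oppr_eq0 ?pnatr_eq0//.
have : f (4 * (K / n) * p * q) * z = 0.
  have h1 : f (K / n) * (f p * z + f q) ^+ 2 - 4 * (z ^+ 2 + 1) = 0.
    by apply: (mulfI c0); rewrite -Eh mulr0; apply/eqP.
  have h2 : f (K / n) * (f p * - z + f q) ^+ 2 - 4 * ((- z) ^+ 2 + 1) = 0.
    by apply: (mulfI c0); rewrite -Eh mulr0; apply/eqP.
  transitivity ((f (K / n) * (f p * z + f q) ^+ 2 - 4 * (z ^+ 2 + 1)) -
    (f (K / n) * (f p * - z + f q) ^+ 2 - 4 * ((- z) ^+ 2 + 1))).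
    have -> : f (4 * (K / n) * p * q) = 4 * f (K / n) * f p * f q.
      rewrite /f; move: (K / n) => c1.
      by rewrite (rmorphM _ _ q) (rmorphM _ _ p) (rmorphM _ 4 c1) rmorph_nat.
    by ring.
  by rewrite h1 h2 subrr.
apply/eqP; rewrite mulf_neq0// fmorph_eq0 !mulf_neq0 ?invr_neq0 ?pnatr_eq0//.
Qed.

End Resultant.

(** * A curve in a horizontal plane *)

Section LogCosDomain.
Variable R : realType.

(** For e of either sign, one of the two components of the set of parameters for
    which the surface with logarithms and cosines is regular. *)
Definition triangle (e : R) : set (R * R) :=
  [set q | (- (pi / 2) < q.1 < pi / 2 /\ - (pi / 2) < q.2 < pi / 2) /\
           0 < e * (q.1 + q.2)].

Lemma open_fun_lt (T : topologicalType) (f : T -> R) (k : R) :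
  continuous f -> open [set q | k < f q].
Proof.
by move=> fc; apply: (@open_comp _ _ f [set x | k < x]); [move=> ? _; exact: fc|exact: open_gt].
Qed.

Lemma continuous_fst_real : continuous (fun q : R * R => q.1).
Proof. by move=> q; exact: cvg_fst. Qed.

Lemma continuous_snd_real : continuous (fun q : R * R => q.2).
Proof. by move=> q; exact: cvg_snd. Qed.

Lemma segment_gt (k x y t : R) : k < x -> k < y -> 0 <= t <= 1 ->
  k < x + t * (y - x).
Proof.
move=> kx ky /andP[t0 t1]; case: (leP x y) => [xy|/ltW yx].
  by apply: (lt_le_trans kx); rewrite lerDl mulr_ge0// subr_ge0.
apply: (lt_le_trans ky); rewrite -subr_ge0 (_ : _ - _ = (1 - t) * (x - y)); last by ring.
by rewrite mulr_ge0// subr_ge0.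
Qed.

Lemma triangle_domain (e : R) : e != 0 -> log_cos_domain (triangle e).
Proof.
have fc := continuous_fst_real; have sc := continuous_snd_real.
have Nc (f : R * R -> R) : continuous f -> continuous (fun q => - f q).
  by move=> fC q; apply: cvgN; exact: fC.
move=> e0; split.
- have -> : triangle e = ([set q | - (pi / 2) < q.1] `&` [set q | - (pi / 2) < - q.1])
      `&` ([set q | - (pi / 2) < q.2] `&` [set q | - (pi / 2) < - q.2])
      `&` [set q : R * R | 0 < e * (q.1 + q.2)].
    apply/seteqP; split=> -[u v] /=; rewrite /triangle /= !ltrN2.
      by move=> [[/andP[? ?] /andP[? ?]] ?].
    by move=> [[[-> ->] [-> ->]] ->].
  apply: openI; first by apply: openI; apply: openI; apply: open_fun_lt => //; exact: Nc.
  apply: open_fun_lt => q; apply: cvgM; first exact: cvg_cst.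
  by apply: cvgD; [exact: fc|exact: sc].
- have seg (p q : R * R) : triangle e p -> triangle e q -> forall t, 0 <= t <= 1 ->
      triangle e (p.1 + t * (q.1 - p.1), p.2 + t * (q.2 - p.2)).
    move=> [[/andP[p1 p2] /andP[p3 p4]] p5] [[/andP[q1 q2] /andP[q3 q4]] q5] t t01.
    have neg (x y : R) : - (x + t * (y - x)) = - x + t * (- y - - x) by ring.
    split; [split; apply/andP; split => /=|].
    - exact: segment_gt.
    - by rewrite -ltrN2 neg; apply: segment_gt; rewrite ?ltrN2.
    - exact: segment_gt.
    - by rewrite -ltrN2 neg; apply: segment_gt; rewrite ?ltrN2.
    - rewrite (_ : e * _ = e * (p.1 + p.2) + t * (e * (q.1 + q.2) - e * (p.1 + p.2))).
        exact: segment_gt.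
      by rewrite /=; ring.
  have [[p0 Tp0]|nT] := pselect (exists p, triangle e p); last first.
    suff -> : triangle e = set0 by exact: connected0.
    by apply/seteqP; split=> // q Tq; apply: nT; exists q.
  pose f (q : R * R) (t : R) := (p0.1 + t * (q.1 - p0.1), p0.2 + t * (q.2 - p0.2)).
  have -> : triangle e = \bigcup_(q in triangle e) (f q @` `[0, 1]).
    apply/seteqP; split => [q Tq|_ [q Tq [t t01 <-]]].
      exists q => //; exists 1; first by rewrite /= in_itv/= ler01 lexx.
      by rewrite /f !mul1r ![_ + (_ - _)]addrC !subrK; case: q {Tq}.
    by apply: seg => //; move: t01; rewrite /= in_itv.
  apply: bigcup_connected.
    exists p0 => q Tq; exists 0; first by rewrite /= in_itv/= ler01 lexx.
    by rewrite /f !mul0r !addr0; case: (p0).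
  move=> q Tq; apply: connected_continuous_connected; first exact: segment_connected.
  have lc (x y : R) : continuous (fun t : R => x + t * (y - x)).
    move=> t; apply: cvgD; first exact: cvg_cst.
    by apply: cvgM; [exact: cvg_id|exact: cvg_cst].
  by apply: continuous_subspaceT => t; exact: (cvg_pair (lc _ _ t) (lc _ _ t)).
- move=> u v [/= [? ?] uv]; split => //; apply: contraTneq uv => ->.
  by rewrite mulr0 ltxx.
Qed.

End LogCosDomain.

Section HorizontalPlane.
Variables (R : realType) (a : R) (I J : set R) (c d : curve R).
Hypotheses (a0 : a != 0) (nI : nondegenerate_interval I)
  (nJ : nondegenerate_interval J) (cj : curve_jet 3 I c) (dj : curve_jet 3 J d).
Hypothesis c_horizontal : forall u, I u -> cz c 1 u = 0.
Hypothesis cd_ratio : forall u v, I u -> J v -> ratio_at a c d u v.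

Let x1 := cx c 1. Let y1 := cy c 1.
Let X1 := cx d 1. Let Y1 := cy d 1. Let Z1 := cz d 1.
Let k u := x1 u * cy c 2 u - y1 u * cx c 2 u.
Let C1 v := Z1 v * cx d 2 v - cz d 2 v * X1 v.
Let C2 v := Z1 v * cy d 2 v - cz d 2 v * Y1 v.
Let m u v := x1 u * C2 v - y1 u * C1 v.

Local Lemma x1d u : I u -> is_derive u (1 : R) x1 (cx c 2 u).
Proof. by move=> Iu; case: (@cj 1%N u). Qed.
Local Lemma y1d u : I u -> is_derive u (1 : R) y1 (cy c 2 u).
Proof. by move=> Iu; case: (@cj 1%N u). Qed.
Local Lemma X1d v : J v -> is_derive v (1 : R) X1 (cx d 2 v).
Proof. by move=> Jv; case: (@dj 1%N v). Qed.
Local Lemma Y1d v : J v -> is_derive v (1 : R) Y1 (cy d 2 v).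
Proof. by move=> Jv; case: (@dj 1%N v). Qed.
Local Lemma Z1d v : J v -> is_derive v (1 : R) Z1 (cz d 2 v).
Proof. by move=> Jv; case: (@dj 1%N v). Qed.
Local Lemma Xd v : J v -> is_derive v (1 : R) (cx d 0) (X1 v).
Proof. by move=> Jv; case: (@dj 0%N v). Qed.
Local Lemma Yd v : J v -> is_derive v (1 : R) (cy d 0) (Y1 v).
Proof. by move=> Jv; case: (@dj 0%N v). Qed.
Local Lemma Zd v : J v -> is_derive v (1 : R) (cz d 0) (Z1 v).
Proof. by move=> Jv; case: (@dj 0%N v). Qed.

(** With the first curve horizontal, the diagonal entries of the Hessian are given
    by the plane curvature term k of the first curve and a term m linear in its
    velocity. *)
Local Lemma horizontal_ratio u v : I u -> J v ->
  [/\ jac c d u v != 0, Z1 v != 0, k u != 0, m u v != 0 &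
      a * (Z1 v * k u * speed2 d v + m u v * speed2 c u) ^+ 2 =
      (a + 1) ^+ 2 * jac c d u v ^+ 2 * (Z1 v * k u * m u v)].
Proof.
move=> Iu Jv; have [_ _ z1] := @cj 1%N u isT Iu.
have z2 := derive_eq_onW nI Iu z1 (is_derive_const 0 u) c_horizontal.
have L : bend1 c d u v = - (Z1 v * k u).
  by rewrite /bend1 /det3 c_horizontal// z2 /k /Z1 /x1 /y1; ring.
have N : bend2 c d u v = - m u v.
  by rewrite /bend2 /det3 c_horizontal// /m /C1 /C2 /Z1 /x1 /y1 /X1 /Y1; ring.
have [D0] := cd_ratio Iu Jv; rewrite L N !oppr_eq0 mulf_eq0 negb_or.
move=> /andP[Z0 k0] m0 E; split => //.
transitivity (a * (- (Z1 v * k u) * speed2 d v + - m u v * speed2 c u) ^+ 2).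
  by ring.
by rewrite E; ring.
Qed.

(** Umbilical directions are conjugate only when orthogonal, but one velocity
    cannot stay orthogonal to a turning one. *)
Local Lemma horizontal_ratio_neq1 : a != 1.
Proof.
have [_ [u0 [_ [Iu0 _ _]]]] := nI; have [_ [v0 [_ [Jv0 _ _]]]] := nJ.
apply/eqP => a1.
have dot0 u : I u -> x1 u * X1 v0 + y1 u * Y1 v0 = 0.
  move=> Iu; have [D0 Z0 k0 m0 E] := horizontal_ratio Iu Jv0.
  have a2 : a + 1 != 0 by rewrite a1 gt_eqF// addr_gt0.
  have t0 : 0 < Z1 v0 * k u * m u v0.
    rewrite lt0r !mulf_neq0//= -(pmulr_rge0 _ (_ : 0 < (a + 1) ^+ 2 * jac c d u v0 ^+ 2)).
      by rewrite -E a1 mul1r sqr_ge0.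
    by rewrite mulr_gt0// exprn_even_gt0.
  have : (Z1 v0 * k u * speed2 d v0 - m u v0 * speed2 c u) ^+ 2 +
      4 * (Z1 v0 * k u * m u v0) * (x1 u * X1 v0 + y1 u * Y1 v0) ^+ 2 = 0.
    transitivity (a * (Z1 v0 * k u * speed2 d v0 + m u v0 * speed2 c u) ^+ 2 -
      (a + 1) ^+ 2 * jac c d u v0 ^+ 2 * (Z1 v0 * k u * m u v0)); last first.
      by rewrite E subrr.
    by rewrite a1 /speed2 /jac -/x1 -/y1 -/X1 -/Y1; ring.
  move/eqP; rewrite paddr_eq0 ?sqr_ge0//; last first.
    by rewrite mulr_ge0 ?sqr_ge0// mulr_ge0// ltW.
  move=> /andP[_]; rewrite mulf_eq0 (gt_eqF (mulr_gt0 _ t0)) ?ltr0n//.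
  by rewrite /= sqrf_eq0 => /eqP.
have [D0 Z0 k0 m0 E] := horizontal_ratio Iu0 Jv0.
have xd := x1d Iu0; have yd := y1d Iu0.
have F : is_derive u0 (1 : R) (fun u => x1 u * X1 v0 + y1 u * Y1 v0)
    (cx c 2 u0 * X1 v0 + cy c 2 u0 * Y1 v0) by derive_tac; ring.
have dd := derive_eq_onW nI Iu0 F (is_derive_const 0 u0) dot0.
have d0 := dot0 _ Iu0.
have [_ sd] := speed2_gt0 D0.
have : k u0 * speed2 d v0 = 0.
  transitivity ((x1 u0 * X1 v0 + y1 u0 * Y1 v0) * (cy c 2 u0 * X1 v0 - cx c 2 u0 * Y1 v0)
    + (cx c 2 u0 * X1 v0 + cy c 2 u0 * Y1 v0) * (x1 u0 * Y1 v0 - y1 u0 * X1 v0)).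
    by rewrite /k /speed2 -/X1 -/Y1; ring.
  by rewrite dd d0; ring.
by move/eqP; rewrite mulf_eq0 (negbTE k0) gt_eqF.
Qed.

Let cross v w := X1 v * Y1 w - Y1 v * X1 w.
Let dot v w := X1 v * X1 w + Y1 v * Y1 w.

(** Then the second curve lies in a vertical plane, and the two curves exchange
    their roles. *)
Local Lemma parallel_case : (forall v w, J v -> J w -> cross v w = 0) ->
  fits a I J c d /\ flat J d.
Proof.
move=> par; have [_ [u0 [_ [Iu0 _ _]]]] := nI; have [_ [v0 [_ [Jv0 _ _]]]] := nJ.
have [D0 _ _ _ _] := horizontal_ratio Iu0 Jv0; have [_ sd] := speed2_gt0 D0.
have g0 : Y1 v0 ^+ 2 + X1 v0 ^+ 2 != 0 by rewrite addrC gt_eqF.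
pose g := @Simil R false (Y1 v0) (X1 v0) 0 0 1 0 0 0.
have gk : simil_ok g by split => //=; rewrite oner_eq0.
have dv v : J v -> cx (simil_curve g d) 1 v = 0.
  move=> Jv; rewrite /= /linx /= expr0 -/X1 -/Y1 addr0 !mul1r mulrC.
  by rewrite -(par _ _ Jv Jv0) /cross; ring.
have ra v u : J v -> I u -> ratio_at a (simil_curve g d) (simil_curve g c) v u.
  move=> Jv Iu; apply: simil_ratio_at => //.
  by apply: ratio_at_swap; exact: cd_ratio.
have [ft _] := vertical_plane_case a0 nJ nI (simil_curve_jet g dj)
  (simil_curve_jet g cj) dv ra.
split; first by apply: fits_swap; apply: (fits_simil gk).
exists (Y1 v0), (- X1 v0), 0, (Y1 v0 * cx d 0 v0 - X1 v0 * cy d 0 v0); split.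
  rewrite eqxx oppr_eq0 orbF; apply: contraTT (sd).
  rewrite negb_or !negbK => /andP[/eqP Y0 /eqP X0].
  by rewrite /speed2 -/X1 -/Y1 X0 Y0 expr0n addr0 ltxx.
move=> v Jv; rewrite mul0r addr0 mulNr.
apply: (constant_on (f := fun v => Y1 v0 * cx d 0 v - X1 v0 * cy d 0 v) nJ.1 _ Jv Jv0).
move=> w Jw; have Xw := Xd Jw; have Yw := Yd Jw; derive_tac.
by transitivity (cross w v0); [rewrite /cross; ring|exact: par].
Qed.

(** Between two velocities which are not parallel there is, by continuity, one
    which is neither parallel nor orthogonal to the first. *)
Local Lemma oblique_pair v0 v1 : J v0 -> J v1 -> cross v0 v1 != 0 ->
  exists v2, [/\ J v2, cross v0 v2 != 0 & dot v0 v2 != 0].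
Proof.
move=> J0 J1 c0.
have [d0|d0] := eqVneq (dot v0 v1) 0; last by exists v1.
have [_ [u0 [_ [Iu0 _ _]]]] := nI.
pose e := cross v0 v1.
have s0 v : J v -> 0 < speed2 d v.
  by move=> Jv; have [D0 _ _ _ _] := horizontal_ratio Iu0 Jv; have [] := speed2_gt0 D0.
have fc v : J v -> {for v, continuous (fun v => e * cross v0 v - e ^+ 2 * dot v0 v)}.
  move=> Jv; move: e => e'; apply: (@is_derive_continuous _ _ _
    (e' * (X1 v0 * cy d 2 v - Y1 v0 * cx d 2 v)
     - e' ^+ 2 * (X1 v0 * cx d 2 v + Y1 v0 * cy d 2 v))); rewrite /cross /dot.
  by have Xv := X1d Jv; have Yv := Y1d Jv; derive_tac; ring.
have [|v2 J2 E] := @IVT_on R J (fun v => e * cross v0 v - e ^+ 2 * dot v0 v) v0 v1 0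
  nJ.1 J0 J1 fc.
  rewrite d0 mulr0 subr0 -/e -expr2 sqr_ge0 andbT.
  rewrite (_ : _ - _ = - (e ^+ 2 * speed2 d v0)); last first.
    by rewrite /cross /dot /speed2 -/X1 -/Y1; ring.
  by rewrite oppr_le0 mulr_ge0 ?sqr_ge0// ltW// s0.
exists v2.
have lag : cross v0 v2 ^+ 2 + dot v0 v2 ^+ 2 = speed2 d v0 * speed2 d v2.
  by rewrite /cross /dot /speed2 -/X1 -/Y1; ring.
have lag0 : cross v0 v2 ^+ 2 + dot v0 v2 ^+ 2 != 0.
  by rewrite lag gt_eqF// mulr_gt0// s0.
have cd : cross v0 v2 = e * dot v0 v2.
  apply: (mulfI c0); rewrite -/e; apply/eqP; rewrite -subr_eq0 -[X in _ == X]E.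
  by apply/eqP; ring.
have dn : dot v0 v2 != 0.
  by apply: contraNneq lag0 => d2; rewrite cd d2 mulr0 expr0n addr0.
by split => //; rewrite cd mulf_neq0.
Qed.

(** The ratio equation is homogeneous in the first velocity, which is written
    here as l (t1, t2) with respect to the frame of the vector (bx, by_) and its
    normal. Dividing by the powers of l leaves an equation in the slope s. *)
Local Lemma normalized_ratio (l s bx by_ z X Y D1 D2 h : R) :
  let b := bx ^+ 2 + by_ ^+ 2 in let b1 := X ^+ 2 + Y ^+ 2 in
  let t1 := s * bx + by_ in let t2 := s * by_ - bx in
  let M := t1 * D2 - t2 * D1 in let D := t1 * Y - t2 * X in
  l != 0 -> z != 0 -> b != 0 -> b1 != 0 ->
  a * (z * (l ^+ 3 * h) * b1 + (l * M) * (l ^+ 2 * (t1 ^+ 2 + t2 ^+ 2))) ^+ 2 =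
    (a + 1) ^+ 2 * (l * D) ^+ 2 * (z * (l ^+ 3 * h) * (l * M)) ->
  h ^+ 2 + (b / (z * b1) * M * (s ^+ 2 + 1)) ^+ 2 =
    ((a + 1) ^+ 2 / a / (b * b1) * D ^+ 2 - 2 * (s ^+ 2 + 1)) * h * (b / (z * b1) * M).
Proof.
move=> b b1 t1 t2 M D l0 z0 b0 b10 E.
have tt : t1 ^+ 2 + t2 ^+ 2 = b * (s ^+ 2 + 1) by rewrite /t1 /t2 /b; ring.
have k0 : a * l ^+ 6 * z ^+ 2 * b1 ^+ 2 != 0.
  by apply: mulf_neq0; [apply: mulf_neq0; [apply: mulf_neq0|]|] => //; exact: expf_neq0.
apply: (mulfI k0).
have -> : a * l ^+ 6 * z ^+ 2 * b1 ^+ 2 *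
    (h ^+ 2 + (b / (z * b1) * M * (s ^+ 2 + 1)) ^+ 2) =
  a * (z * (l ^+ 3 * h) * b1 + l * M * (l ^+ 2 * (t1 ^+ 2 + t2 ^+ 2))) ^+ 2 -
  a * l ^+ 6 * 2 * z * h * b1 * M * (b * (s ^+ 2 + 1)).
  rewrite tt; clear E tt k0; move: b b1 M b0 b10 => b' b1' M' b0 b10; field.
  by rewrite z0 b10.
rewrite E; clear E tt k0; move: b b1 M D b10 b0 => b' b1' M' D' b10 b0; field.
by rewrite a0 z0 b10 b0.
Qed.

(** The directions of the first curve fill an interval of slopes s, and along it
    the same curvature k satisfies the quadratic equations that belong to v0 and
    to v1. *)
Local Lemma oblique_contradiction v0 v1 : a != -1 -> J v0 -> J v1 ->
  cross v0 v1 != 0 -> dot v0 v1 != 0 -> False.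
Proof.
move=> an1 J0 J1 p0 q0.
have a1 : a + 1 != 0 by rewrite addr_eq0.
pose K := (a + 1) ^+ 2 / a.
have [_ [u0 [_ [Iu0 _ _]]]] := nI.
have s0 v : J v -> speed2 d v != 0.
  move=> Jv; have [D0 _ _ _ _] := horizontal_ratio Iu0 Jv.
  by have [_ sd] := speed2_gt0 D0; rewrite gt_eqF.
have Z0 v : J v -> Z1 v != 0 by move=> Jv; have [] := horizontal_ratio Iu0 Jv.
pose D u := jac c d u v0.
have D0 u : I u -> D u != 0 by move=> Iu; have [] := horizontal_ratio Iu J0.
pose s u := (x1 u * X1 v0 + y1 u * Y1 v0) / D u.
pose bx := X1 v0; pose by_ := Y1 v0; pose b := bx ^+ 2 + by_ ^+ 2.
have b0 : b != 0 by exact: s0.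
have sd u : I u -> is_derive u (1 : R) s (b * k u / D u ^+ 2).
  move=> Iu; have xu := x1d Iu; have yu := y1d Iu; have Du := D0 _ Iu.
  move: Du; rewrite /s /D /jac -/x1 -/y1 -/X1 -/Y1 => Du.
  by derive_tac => //; rewrite /b /bx /by_ /k; field.
have sI u v : I u -> I v -> s u = s v -> u = v.
  apply: (injective_on nI.1 sd) => w Iw.
  have [_ _ kw _ _] := horizontal_ratio Iw J0.
  by apply: mulf_neq0; [exact: mulf_neq0|apply: invr_neq0; apply: expf_neq0; exact: D0].
pose M v : {poly R} := (b / (Z1 v * speed2 d v))%:P *
  ((bx * C2 v - by_ * C1 v)%:P * 'X + (by_ * C2 v + bx * C1 v)%:P).
have ME v t : (M v).[t] = b / (Z1 v * speed2 d v) *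
    ((t * bx + by_) * C2 v - (t * by_ - bx) * C1 v).
  by rewrite /M !(hornerM, hornerD, hornerC, hornerX); congr (_ * _); ring.
apply: (@no_common_conjugates R I s (M v0) (M v1) K (cross v0 v1) (dot v0 v1)) => //.
- by apply: mulf_neq0; [apply: expf_neq0|apply: invr_neq0].
- rewrite /K -subr_eq0 (_ : _ - _ = (a - 1) ^+ 2 / a); last by field.
  apply: mulf_neq0; last exact: invr_neq0.
  by apply: expf_neq0; rewrite subr_eq0; exact: horizontal_ratio_neq1.
move=> u Iu; pose l := D u / b.
have l0 : l != 0 by apply: mulf_neq0; [exact: D0|exact: invr_neq0].
have xl : x1 u = l * (s u * bx + by_).
  rewrite /l /s; have := D0 _ Iu; rewrite /D /jac -/x1 -/y1 -/X1 -/Y1 -/bx -/by_ => Du.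
  by rewrite /b; field; rewrite Du.
have yl : y1 u = l * (s u * by_ - bx).
  rewrite /l /s; have := D0 _ Iu; rewrite /D /jac -/x1 -/y1 -/X1 -/Y1 -/bx -/by_ => Du.
  by rewrite /b; field; rewrite Du.
pose h := k u / l ^+ 3.
have kl : k u = l ^+ 3 * h by rewrite /h mulrC divfK// expf_neq0.
have mE v : m u v = l * ((s u * bx + by_) * C2 v - (s u * by_ - bx) * C1 v).
  by rewrite /m xl yl; ring.
have jE v : jac c d u v = l * ((s u * bx + by_) * Y1 v - (s u * by_ - bx) * X1 v).
  by rewrite /jac -/x1 -/y1 xl yl -/X1 -/Y1; ring.
have cE : speed2 c u = l ^+ 2 * ((s u * bx + by_) ^+ 2 + (s u * by_ - bx) ^+ 2).
  by rewrite /speed2 -/x1 -/y1 xl yl; ring.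
have M0 v : J v -> (M v).[s u] != 0.
  move=> Jv; rewrite ME; have [_ _ _ + _] := horizontal_ratio Iu Jv.
  rewrite mE mulf_eq0 (negbTE l0) /= => m0.
  apply: mulf_neq0 => //; apply: mulf_neq0 => //; apply: invr_neq0.
  by apply: mulf_neq0; [exact: Z0|exact: s0].
have EE v : J v -> h ^+ 2 + ((M v).[s u] * (s u ^+ 2 + 1)) ^+ 2 =
    (K / (b * speed2 d v) * ((s u * bx + by_) * Y1 v - (s u * by_ - bx) * X1 v) ^+ 2
     - 2 * (s u ^+ 2 + 1)) * h * (M v).[s u].
  move=> Jv; rewrite ME.
  apply: (normalized_ratio (l := l)) => //; [exact: Z0|exact: s0|].
  have [_ _ _ _ +] := horizontal_ratio Iu Jv.
  by rewrite mE jE cE kl.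
exists h; split; [exact: M0|exact: M0| |].
  rewrite EE//; congr ((_ - _) * _ * _).
  have -> : (s u * bx + by_) * Y1 v0 - (s u * by_ - bx) * X1 v0 = b.
    by rewrite /b /bx /by_; ring.
  by rewrite /speed2 -/X1 -/Y1 -/b; field; rewrite b0.
rewrite EE//; congr ((_ * _ - _) * _ * _).
  congr (_ / _); rewrite /b /speed2 -/X1 -/Y1 /cross /dot /bx /by_; ring.
by congr (_ ^+ 2); rewrite /cross /dot /bx /by_; ring.
Qed.

(** For a = -1 the ratio equation is linear in k, and it separates: the vector
    (C1, C2) / (Z1 speed2) does not depend on v. Calling it (g1, g2) and turning it
    into the second axis makes the top views of the two curves grim reapers,
    parametrized by the angles U and V of their tangents. *)
Local Lemma log_cos_case v0 v1 : a = -1 -> J v0 -> J v1 -> cross v0 v1 != 0 ->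
  fits a I J c d /\ flat J d.
Proof.
move=> an1 J0 J1 c01.
have [_ [u0 [_ [Iu0 _ _]]]] := nI.
have IJ := nJ.1; have II := nI.1.
have D0 u v : I u -> J v -> jac c d u v != 0.
  by move=> Iu Jv; have [] := horizontal_ratio Iu Jv.
have Z0 v : J v -> Z1 v != 0 by move=> Jv; have [] := horizontal_ratio Iu0 Jv.
have k0 u : I u -> k u != 0 by move=> Iu; have [] := horizontal_ratio Iu J0.
have sc u : I u -> speed2 c u != 0.
  by move=> Iu; have [+ _] := speed2_gt0 (D0 _ _ Iu J0) => sg; rewrite gt_eqF.
have sd v : J v -> speed2 d v != 0.
  by move=> Jv; have [_ sg] := speed2_gt0 (D0 _ _ Iu0 Jv); rewrite gt_eqF.
have mE u v : I u -> J v -> m u v * speed2 c u = - (Z1 v * k u * speed2 d v).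
  move=> Iu Jv; have [_ _ _ _] := horizontal_ratio Iu Jv.
  rewrite an1 addNr expr0n/= !mul0r mulN1r => /eqP.
  by rewrite oppr_eq0 sqrf_eq0 addrC addr_eq0 => /eqP.
pose G1 v := C1 v / (Z1 v * speed2 d v); pose G2 v := C2 v / (Z1 v * speed2 d v).
have GE u v : I u -> J v -> x1 u * G2 v - y1 u * G1 v = - k u / speed2 c u.
  move=> Iu Jv; have ZS : Z1 v * speed2 d v != 0.
    by apply: mulf_neq0; [exact: Z0|exact: sd].
  apply: (mulfI (mulf_neq0 ZS (sc _ Iu))).
  transitivity (m u v * speed2 c u).
    by rewrite /G1 /G2 /m; field; rewrite Z0// sd.
  by rewrite mE//; field; rewrite sc.
pose g1 := G1 v0; pose g2 := G2 v0.
(* The velocity (x1, y1) and its derivative are independent, and both are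
   orthogonal to the difference of the values of (G2, - G1) at v and v0. *)
have Gcst v : J v -> G1 v = g1 /\ G2 v = g2.
  move=> Jv.
  have E0 u : I u -> x1 u * (G2 v - g2) - y1 u * (G1 v - g1) = 0.
    move=> Iu; transitivity ((x1 u * G2 v - y1 u * G1 v) - (x1 u * g2 - y1 u * g1)).
      by ring.
    by rewrite !GE// subrr.
  have xd := x1d Iu0; have yd := y1d Iu0.
  have F : is_derive u0 (1 : R) (fun u => x1 u * (G2 v - g2) - y1 u * (G1 v - g1))
    (cx c 2 u0 * (G2 v - g2) - cy c 2 u0 * (G1 v - g1)) by derive_tac; ring.
  have E1 := derive_eq_onW nI Iu0 F (is_derive_const 0 u0) E0.
  have {}E0 := E0 _ Iu0; have ku := k0 _ Iu0.
  have e1 : k u0 * (G1 v - g1) = 0.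
    transitivity (cx c 2 u0 * (x1 u0 * (G2 v - g2) - y1 u0 * (G1 v - g1))
      - x1 u0 * (cx c 2 u0 * (G2 v - g2) - cy c 2 u0 * (G1 v - g1))).
      by rewrite /k; ring.
    by rewrite E0 E1; ring.
  have e2 : k u0 * (G2 v - g2) = 0.
    transitivity (cy c 2 u0 * (x1 u0 * (G2 v - g2) - y1 u0 * (G1 v - g1))
      - y1 u0 * (cx c 2 u0 * (G2 v - g2) - cy c 2 u0 * (G1 v - g1))).
      by rewrite /k; ring.
    by rewrite E0 E1; ring.
  move/eqP: e1; rewrite mulf_eq0 (negbTE ku) subr_eq0 => /eqP ->.
  by move/eqP: e2; rewrite mulf_eq0 (negbTE ku) subr_eq0 => /eqP ->.
have CE v : J v -> C1 v = g1 * (Z1 v * speed2 d v) /\ C2 v = g2 * (Z1 v * speed2 d v).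
  move=> Jv; have ZS : Z1 v * speed2 d v != 0.
    by apply: mulf_neq0; [exact: Z0|exact: sd].
  by have [<- <-] := Gcst _ Jv; rewrite /G1 /G2 !divfK.
have kE u : I u -> x1 u * g2 - y1 u * g1 = - k u / speed2 c u.
  by move=> Iu; exact: GE.
pose g := g1 ^+ 2 + g2 ^+ 2.
have A0 u : I u -> x1 u * g2 - y1 u * g1 != 0.
  move=> Iu; rewrite kE//; apply: mulf_neq0; first by rewrite oppr_eq0 k0.
  by apply: invr_neq0; exact: sc.
have g0 : g != 0.
  apply: contraNneq (A0 _ Iu0) => /eqP.
  by rewrite paddr_eq0 ?sqr_ge0// !sqrf_eq0 => /andP[/eqP -> /eqP ->]; rewrite !mulr0 subr0.
pose cr v := X1 v * g2 - Y1 v * g1; pose dt v := X1 v * g1 + Y1 v * g2.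
have [e crE] : exists e, forall v, J v -> cr v = e * Z1 v.
  exists (cr v0 / Z1 v0) => v Jv.
  have F x : J x -> is_derive x (1 : R) (fun v => cr v / Z1 v) 0.
    move=> Jx; have Xx := X1d Jx; have Yx := Y1d Jx; have Zx := Z1d Jx.
    have Zn := Z0 _ Jx; have [E1 E2] := CE _ Jx.
    rewrite /cr; derive_tac => //.
    have N : (C1 x * g2 - C2 x * g1) / Z1 x ^+ 2 = 0.
      by rewrite E1 E2 (_ : _ - _ = 0) ?mul0r//; ring.
    by rewrite -[RHS]N /C1 /C2; field.
  by rewrite -(constant_on IJ F Jv J0) divfK// Z0.
have lagd v : cr v ^+ 2 + dt v ^+ 2 = g * speed2 d v.
  by rewrite /cr /dt /g /speed2 -/X1 -/Y1; ring.
have e0 : e != 0.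
  apply: contraNneq c01 => e0; apply/eqP; apply: (mulfI g0); rewrite mulr0.
  have z0 := crE _ J0; have z1 := crE _ J1.
  transitivity (dt v0 * - cr v1 + cr v0 * dt v1); first by rewrite /g /cr /dt /cross; ring.
  by rewrite z0 z1 e0; ring.
pose T v := dt v / (e * Z1 v); pose U v := atan (T v).
have eZ v : J v -> e * Z1 v != 0 by move=> Jv; apply: mulf_neq0 => //; exact: Z0.
have Td v : J v -> is_derive v (1 : R) T (e * Z1 v * (1 + T v ^+ 2)).
  move=> Jv; have Xv := X1d Jv; have Yv := Y1d Jv; have Zv := Z1d Jv.
  have Zn := Z0 _ Jv; have [E1 E2] := CE _ Jv; have en := eZ _ Jv.
  have -> : e * Z1 v * (1 + T v ^+ 2) = (C1 v * g1 + C2 v * g2) / (e * Z1 v ^+ 2).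
    rewrite E1 E2.
    transitivity (g * speed2 d v / (e * Z1 v)); last by rewrite /g; field; rewrite Zn e0.
    by rewrite -lagd crE// /T; field; rewrite Zn e0.
  rewrite /T /dt; derive_tac => //; rewrite /C1 /C2; field.
  by rewrite Zn e0.
have Ud v : J v -> is_derive v (1 : R) U (e * Z1 v).
  move=> Jv; have Tv := Td _ Jv; rewrite /U; derive_tac.
  by rewrite mulrC mulfK// gt_eqF// ltr_wpDr ?sqr_ge0.
have cosU x : 0 < cos (atan x) :> R.
  by apply: cos_gt0_pihalf; rewrite atan_gtNpi2 atan_ltpi2.
have sinU x : sin (atan x) = x * cos (atan x) :> R.
  by rewrite -{2}[x]atanK /tan divfK// gt_eqF.
pose S u := - (x1 u * g1 + y1 u * g2) / (x1 u * g2 - y1 u * g1).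
pose V u := atan (S u).
have Sd u : I u -> is_derive u (1 : R) S
    ((x1 u * g2 - y1 u * g1) * (1 + S u ^+ 2)).
  move=> Iu; have xu := x1d Iu; have yu := y1d Iu; have An := A0 _ Iu.
  have -> : (x1 u * g2 - y1 u * g1) * (1 + S u ^+ 2) =
      - (g * k u) / (x1 u * g2 - y1 u * g1) ^+ 2.
    have kk : k u = - (x1 u * g2 - y1 u * g1) * speed2 c u.
      by rewrite kE//; field; exact: sc.
    rewrite kk /S /g /speed2 -/x1 -/y1; field.
    exact: An.
  rewrite /S; derive_tac => //; rewrite /k /g; field.
  exact: An.
have Vd u : I u -> is_derive u (1 : R) V (x1 u * g2 - y1 u * g1).
  move=> Iu; have Su := Sd _ Iu; rewrite /V; derive_tac.
  by rewrite mulrC mulfK// gt_eqF// ltr_wpDr ?sqr_ge0.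
have lnc (f : R -> R) (f' x : R) : is_derive x (1 : R) f f' ->
    is_derive x (1 : R) (fun x => ln `|cos (atan (f x))|)
      (- f x * (f' / (1 + f x ^+ 2))).
  move=> fd.
  have ld : is_derive (cos (atan (f x))) (1 : R) (fun z => ln `|z|)
     (cos (atan (f x)))^-1 by apply: is_derive_ln_norm; rewrite gt_eqF.
  apply: is_derive_congr.
    apply: (is_derive_compose ld); derive_tac; reflexivity.
  have cn : cos (atan (f x)) != 0 by rewrite gt_eqF.
  have fn : 1 + f x ^+ 2 != 0 by rewrite gt_eqF// ltr_wpDr ?sqr_ge0.
  by rewrite sinU; field; rewrite ?cn ?fn.
have x0d u : I u -> is_derive u (1 : R) (cx c 0) (x1 u) by move=> Iu; case: (@cj 0%N u).
have y0d u : I u -> is_derive u (1 : R) (cy c 0) (y1 u) by move=> Iu; case: (@cj 0%N u).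
have [K1 UX] : exists K, forall v, J v -> g2 * cx d 0 v - g1 * cy d 0 v - U v = K.
  eexists => v Jv.
  apply: (constant_on (f := fun v => g2 * cx d 0 v - g1 * cy d 0 v - U v) IJ _ Jv J0).
  move=> x Jx; have Xx := Xd Jx; have Yx := Yd Jx; have Ux := Ud _ Jx; derive_tac.
  by rewrite -crE// /cr; ring.
have [K2 UZ] : exists K, forall v, J v -> e * cz d 0 v - U v = K.
  eexists => v Jv.
  apply: (constant_on (f := fun v => e * cz d 0 v - U v) IJ _ Jv J0).
  by move=> x Jx; have Zx := Zd Jx; have Ux := Ud _ Jx; derive_tac; ring.
have [K3 UY] : exists K, forall v, J v ->
    - g1 * cx d 0 v - g2 * cy d 0 v - ln `|cos (U v)| = K.
  eexists => v Jv.
  apply: (constant_on (f := fun v => - g1 * cx d 0 v - g2 * cy d 0 v - ln `|cos (U v)|)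
    IJ _ Jv J0).
  move=> x Jx; have Xx := Xd Jx; have Yx := Yd Jx; have lx := lnc _ _ _ (Td _ Jx).
  derive_tac; rewrite mulfK; last by rewrite gt_eqF// ltr_wpDr ?sqr_ge0.
  by rewrite /T /dt; field; rewrite Z0// e0.
have [K4 VX] : exists K, forall u, I u -> g2 * cx c 0 u - g1 * cy c 0 u - V u = K.
  eexists => u Iu.
  apply: (constant_on (f := fun u => g2 * cx c 0 u - g1 * cy c 0 u - V u) II _ Iu Iu0).
  move=> x Ix; have xx := x0d _ Ix; have yx := y0d _ Ix; have vx := Vd _ Ix; derive_tac.
  by ring.
have [K5 VY] : exists K, forall u, I u ->
    - g1 * cx c 0 u - g2 * cy c 0 u + ln `|cos (V u)| = K.
  eexists => u Iu.
  apply: (constant_on (f := fun u => - g1 * cx c 0 u - g2 * cy c 0 u + ln `|cos (V u)|)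
    II _ Iu Iu0).
  move=> x Ix; have xx := x0d _ Ix; have yx := y0d _ Ix; have lx := lnc _ _ _ (Sd _ Ix).
  derive_tac; rewrite mulfK; last by rewrite gt_eqF// ltr_wpDr ?sqr_ge0.
  by rewrite /S; field; exact: A0.
have [K6 zK] : exists K, forall u, I u -> cz c 0 u = K.
  exists (cz c 0 u0) => u Iu; apply: (constant_on II _ Iu Iu0) => x Ix.
  by have [_ _ zd] := @cj 0%N x isT Ix; rewrite -(c_horizontal Ix).
have UV u v : I u -> J v -> U v + V u != 0.
  move=> Iu Jv; apply: contraNneq (D0 _ _ Iu Jv) => /eqP; rewrite addr_eq0 => /eqP UVe.
  have TS : T v = - S u by rewrite -[T v]atanK -[S u]atanK -tanN -UVe.
  have H : dt v * (x1 u * g2 - y1 u * g1) - e * Z1 v * (x1 u * g1 + y1 u * g2) = 0.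
    have -> : dt v = T v * (e * Z1 v) by rewrite /T divfK// eZ.
    rewrite TS /S; field; exact: A0.
  apply/eqP; apply: (mulfI g0); rewrite mulr0 -[RHS]H -crE//.
  by rewrite /g /jac -/x1 -/y1 -/X1 -/Y1 /dt /cr; ring.
pose w0 := U v0 + V u0.
(* U + V does not vanish, so it keeps its sign and (U, V) stays in one of the
   two triangles. *)
have wP u v : I u -> J v -> 0 < w0 * (U v + V u).
  move=> Iu Jv.
  have Uc x : J x -> {for x, continuous U} by move=> Jx; exact: is_derive_continuous (Ud _ Jx).
  have Vc x : I x -> {for x, continuous V} by move=> Ix; exact: is_derive_continuous (Vd _ Ix).
  have w00 : w0 != 0 by exact: UV.
  have s1 : 0 < w0 * (U v + V u0).
    apply: (@constant_sign_on R J (fun v => w0 * (U v + V u0)) IJ _ _ v0 v J0 Jv).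
    - move=> x Jx; apply: cvgM; first exact: cvg_cst.
      by apply: cvgD; [exact: Uc|exact: cvg_cst].
    - by move=> x Jx; apply: mulf_neq0 => //; exact: UV.
    - by rewrite -/w0 -expr2 exprn_even_gt0.
  apply: (@constant_sign_on R I (fun u => w0 * (U v + V u)) II _ _ u0 u Iu0 Iu) => //.
  - move=> x Ix; apply: cvgM; first exact: cvg_cst.
    by apply: cvgD; [exact: cvg_cst|exact: Vc].
  - by move=> x Ix; apply: mulf_neq0 => //; exact: UV.
split; last first.
  exists g2, (- g1), (- e), (K1 - K2); split; first by rewrite orbA !oppr_eq0 e0 orbT.
  by move=> v Jv; rewrite -(UX _ Jv) -(UZ _ Jv); ring.
exists (log_cos_surface (triangle w0)),
  (Simil true (- g2) (- g1) 0 0 e (- K1 - K4) (- K3 - K5) (- K2 - e * K6)); split.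
- constructor 3; split => //; exists (triangle w0) => //.
  by apply: triangle_domain; exact: UV.
- by split => //=; rewrite !sqrrN addrC.
move=> u v Iu Jv; exists (U v, V u).
  by split; [rewrite /U /V /= !atan_gtNpi2 !atan_ltpi2|exact: wP].
rewrite /point vec3D simil_mapE /linx /liny /linz /= expr1; congr vec3.
- by rewrite -(UX _ Jv) -(VX _ Iu); ring.
- by rewrite -(UY _ Jv) -(VY _ Iu); ring.
- by rewrite -(UZ _ Jv) zK//; ring.
Qed.

Lemma horizontal_plane_case : fits a I J c d /\ flat J d.
Proof.
have [par|npar] := pselect (forall v w, J v -> J w -> cross v w = 0).
  exact: parallel_case.
have [v0 [v1 [J0 J1 c01]]] : exists v w, [/\ J v, J w & cross v w != 0].
  apply: contrapT => H; apply: npar => v w Jv Jw; apply: contrapT => /eqP c0.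
  by apply: H; exists v, w.
have [an1|an1] := eqVneq a (-1); first exact: (log_cos_case an1 J0 J1 c01).
have [v2 [J2 c02 d02]] := oblique_pair J0 J1 c01.
by case: (oblique_contradiction an1 J0 J2 c02 d02).
Qed.

End HorizontalPlane.

(** * From vector curves to coordinates *)

Section ClassC.
Variable R : realType.

Lemma near_eq_continuous (T U : topologicalType) (f g : T -> U) (x : T) :
  (\forall y \near x, f y = g y) -> {for x, continuous f} -> {for x, continuous g}.
Proof.
move=> fg fc; have fgx := nbhs_singleton fg.
have -> : {for x, continuous g} = (g y @[y --> x] --> f x) by rewrite fgx.
by apply: cvg_trans fc; apply: near_eq_cvg; exact: fg.
Qed.

Lemma class_C_eq (V W : normedModType R) (n : nat) (U : set V) (f g : V -> W) :
  open U -> (forall x, U x -> f x = g x) -> class_C n U f -> class_C n U g.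
Proof.
move=> oU; elim: n f g => [|n IH] f g fg [fC fD];
  have nfg x : U x -> \forall y \near x, f y = g y.
- by move=> Ux; apply: filterS (open_nbhs_nbhs (conj oU Ux)) => y; exact: fg.
- by split=> // x Ux; apply: near_eq_continuous (nfg _ Ux) (fC _ Ux).
- by move=> Ux; apply: filterS (open_nbhs_nbhs (conj oU Ux)) => y; exact: fg.
split=> [x Ux|w]; first exact: near_eq_continuous (nfg _ Ux) (fC _ Ux).
have [dF DC] := fD w; split=> [x Ux|].
  exact: near_eq_derivable (nfg _ Ux) (dF _ Ux).
by apply: IH DC => x Ux; apply: near_eq_derive; exact: nfg.
Qed.

Lemma class_C_coord (V : normedModType R) (m p n : nat) (U : set V)
    (f : V -> 'M[R]_(m, p)) i j :
  open U -> class_C n U f -> class_C n U (fun x => f x i j).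
Proof.
move=> oU; elim: n f => [|n IH] f [fC fD];
  have cc x : U x -> {for x, continuous (fun x => f x i j)}.
- by move=> Ux; apply: (cvg_comp f (fun M : 'M[R]_(m, p) => M i j) (fC _ Ux));
    exact: coord_continuous.
- by split=> // x Ux; exact: cc.
- by move=> Ux; apply: (cvg_comp f (fun M : 'M[R]_(m, p) => M i j) (fC _ Ux));
    exact: coord_continuous.
split=> [x Ux|w].
  exact: cc.
have [dF DC] := fD w; split=> [x Ux|]; first exact: (derivable_mxP _ _ _).1 (dF _ Ux) i j.
apply: class_C_eq oU _ (IH _ DC) => x Ux.
by rewrite (derive_mx (dF _ Ux)) mxE.
Qed.

End ClassC.

Section CurveOf.
Variable R : realType.
Implicit Types (I J U : set R) (alpha beta : R -> 'cV[R]_3).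

Definition curve_of alpha : curve R := Curve
  (fun k => derive1n k (fun u => alpha u 0 0))
  (fun k => derive1n k (fun u => alpha u 1 0))
  (fun k => derive1n k (fun u => alpha u ord_max 0)).

Lemma point_curve_of alpha u : point (curve_of alpha) u = alpha u.
Proof. by rewrite [RHS]vec3_eta. Qed.

Lemma class_C_derive1n (n : nat) U (f : R -> R) : class_C n U f ->
  forall k u, (k < n)%N -> U u ->
  is_derive u (1 : R) (derive1n k f) (derive1n k.+1 f u).
Proof.
elim: n f => // n IH f [_ fD] k u kn Uu; have [dF DC] := fD 1.
case: k kn => [_|k kn].
  by apply: DeriveDef; [exact: dF|rewrite derive1nS derive1E].
have fE : derive1 f = 'D_1 f by apply/funext => x; rewrite derive1E.
rewrite (derive1Sn f k) (derive1Sn f k.+1) fE.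
exact: IH.
Qed.

Lemma curve_of_jet I alpha : C3_curve I alpha -> curve_jet 3 I (curve_of alpha).
Proof.
move=> [U [oU IU aC]] k u k3 Iu.
by split; apply: (class_C_derive1n (n := 3) (U := U)) => //; try exact: IU;
  exact: class_C_coord.
Qed.

Lemma derive1_coord I alpha u i : C3_curve I alpha -> I u ->
  derive1 alpha u i 0 = derive1 (fun x => alpha x i 0) u.
Proof.
move=> [U [oU IU [_ aD]]] Iu; have [dA _] := aD 1.
by rewrite !derive1E (derive_mx (dA _ (IU _ Iu))) mxE.
Qed.

Lemma free_pair (V : vectType R) (p q : V) : free [:: p; q] ->
  forall s t : R, s *: p + t *: q = 0 -> s = 0 /\ t = 0.
Proof.
rewrite free_cons span_seq1 seq1_free => /andP[pq q0] s t E.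
have s0 : s = 0.
  apply: contraNeq pq => s0; apply/vlineP; exists (- (s^-1 * t)).
  apply: (scalerI s0); rewrite scalerA mulrN mulVKf//.
  by apply/eqP; rewrite scaleNr -addr_eq0 E.
split => //; move/eqP: E; rewrite s0 scale0r add0r scaler_eq0 (negbTE q0) orbF.
by move/eqP.
Qed.

(** A nontrivial combination of the velocities whose top view vanishes would be a
    vertical tangent vector. *)
Lemma jac_neq0 I J alpha beta u v : C3_curve I alpha -> C3_curve J beta ->
  I u -> J v -> free [:: derive1 alpha u; derive1 beta v] ->
  e_z R \notin tangent_plane alpha beta u v ->
  jac (curve_of alpha) (curve_of beta) u v != 0.
Proof.
move=> aC bC Iu Jv fr; apply: contraNneq.
rewrite /jac /curve_of /= -!(derive1_coord _ aC Iu) -!(derive1_coord _ bC Jv).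
rewrite /tangent_plane; move: (derive1 alpha u) (derive1 beta v) fr => p q fr D0.
have vert s t : s * p 0 0 + t * q 0 0 = 0 -> s * p 1 0 + t * q 1 0 = 0 ->
    (s != 0) || (t != 0) -> e_z R \in <<[:: p; q]>>%VS.
  move=> E0 E1 st.
  pose h := s * p ord_max 0 + t * q ord_max 0.
  have E : s *: p + t *: q = h *: e_z R.
    rewrite [LHS]vec3_eta !mxE E0 E1 -/h [RHS]vec3_eta !mxE /= !mulr0 mulr1 //.
  have h0 : h != 0.
    apply: contraTneq st => h0; have [] := free_pair fr (s := s) (t := t).
      by rewrite E h0 scale0r.
    by move=> -> ->; rewrite eqxx.
  have -> : e_z R = h^-1 *: (s *: p + t *: q).
    by rewrite E scalerA mulVf// scale1r.
  by rewrite memvZ// memvD// memvZ// memv_span// !inE eqxx ?orbT.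
have [X0|X0] := boolP ((q 0 0 != 0) || (p 0 0 != 0)).
  apply: (vert (q 0 0) (- p 0 0)); first by ring.
    by apply: oppr_inj; rewrite oppr0 -[RHS]D0; ring.
  by rewrite oppr_eq0.
have [Y0|Y0] := boolP ((q 1 0 != 0) || (p 1 0 != 0)).
  apply: (vert (q 1 0) (- p 1 0)); last by rewrite oppr_eq0.
    by rewrite -[RHS]D0; ring.
  by ring.
move: X0 Y0; rewrite !negb_or !negbK => /andP[/eqP q0 /eqP p0] /andP[/eqP q1 /eqP p1].
by apply: (vert 1 0); rewrite ?q0 ?p0 ?q1 ?p1 ?mulr0 ?addr0// oner_eq0.
Qed.

Lemma planar_curveP I alpha : planar_curve I alpha <-> flat I (curve_of alpha).
Proof.
have E (n : 'rV[R]_3) (p : 'cV[R]_3) : (n *m p) 0 0 =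
    n 0 0 * p 0 0 + n 0 1 * p 1 0 + n 0 ord_max * p ord_max 0.
  rewrite mxE !big_ord_recl big_ord0 addr0 addrA.
  by congr (n _ _ * p _ _ + n _ _ * p _ _ + n _ _ * p _ _); apply: val_inj.
split=> [[n [k [n0 nk]]]|[n1 [n2 [n3 [k [n0 nk]]]]]].
  exists (n 0 0), (n 0 1), (n 0 ord_max), k; split; last first.
    by move=> u Iu; rewrite /= -E nk// mxE.
  apply: contraNT n0; rewrite !negb_or !negbK => /and3P[/eqP N0 /eqP N1 /eqP N2].
  apply/eqP/rowP => i; rewrite mxE; case: i => -[|[|[|//]]] i.
  - by rewrite -[RHS]N0; congr (n _ _); apply: val_inj.
  - by rewrite -[RHS]N1; congr (n _ _); apply: val_inj.
  - by rewrite -[RHS]N2; congr (n _ _); apply: val_inj.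
exists (\row_(j < 3) [:: n1; n2; n3]`_j), k; split.
  apply: contraTneq n0 => /rowP n0; rewrite !negb_or !negbK.
  by have := n0 0; have := n0 1; have := n0 ord_max; rewrite !mxE /= => -> -> ->;
    rewrite eqxx.
by move=> u Iu; apply/matrixP => i j; rewrite !ord1 E !mxE /= nk.
Qed.

End CurveOf.

Section Forward.
Variable R : realType.

(** A plane that contains the first curve is vertical up to a rotation, or else
    becomes horizontal after a shear along the vertical axis. *)
Lemma fits_of_ratio (a : R) (I J : set R) (c d : curve R) : a != 0 ->
  nondegenerate_interval I -> nondegenerate_interval J ->
  curve_jet 3 I c -> curve_jet 3 J d -> flat I c ->
  (forall u v, I u -> J v -> ratio_at a c d u v) ->
  fits a I J c d /\ flat J d.
Proof.
move=> a0 nI nJ cj dj [n1 [n2 [n3 [k [n0 nk]]]]] cd.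
have n'0 u : I u -> n1 * cx c 1 u + n2 * cy c 1 u + n3 * cz c 1 u = 0.
  move=> Iu; have [xd yd zd] := cj 0%N u isT Iu.
  have F : is_derive u (1 : R) (fun u => n1 * cx c 0 u + n2 * cy c 0 u + n3 * cz c 0 u)
    (n1 * cx c 1 u + n2 * cy c 1 u + n3 * cz c 1 u) by derive_tac; ring.
  exact: (derive_eq_onW nI Iu F (is_derive_const k u) nk).
have [n30|n30] := eqVneq n3 0.
  pose g := @Simil R false n1 (- n2) 0 0 1 0 0 0.
  have gk : simil_ok g.
    split; rewrite /= ?oner_eq0// sqrrN.
    apply: contraTneq n0 => /eqP; rewrite n30 paddr_eq0 ?sqr_ge0// !sqrf_eq0.
    by move=> /andP[-> ->]; rewrite eqxx.
  have [||ft fl] := @vertical_plane_case R a I J (simil_curve g c) (simil_curve g d)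
      a0 nI nJ (simil_curve_jet g cj) (simil_curve_jet g dj).
  - move=> u Iu; rewrite /= /linx /= expr0 addr0 !mul1r mulNr opprK.
    by have := n'0 _ Iu; rewrite n30 mul0r addr0.
  - by move=> u v Iu Jv; apply: simil_ratio_at => //; exact: cd.
  by split; [exact: (fits_simil gk)|exact: (flat_simil gk)].
pose g := @Simil R false 1 0 n1 n2 n3 0 0 0.
have gk : simil_ok g by split; rewrite //= expr1n expr0n addr0 oner_eq0.
have [||ft fl] := @horizontal_plane_case R a I J (simil_curve g c) (simil_curve g d)
    a0 nI nJ (simil_curve_jet g cj) (simil_curve_jet g dj).
- by move=> u Iu; rewrite /= /linz /= addr0 n'0.
- by move=> u v Iu Jv; apply: simil_ratio_at => //; exact: cd.
by split; [exact: (fits_simil gk)|exact: (flat_simil gk)].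
Qed.

End Forward.

(** * Functions of class C^n *)

Section ClassCClosure.
Variable R : realType.

(** Reduces derivatives along a vector to derivatives of functions of one real
    variable. *)
Lemma is_derive_along (V : normedModType R) (g : V -> R) (p w : V) (e : R) :
  is_derive (0 : R) (1 : R) (fun s => g (p + s *: w)) e -> is_derive p w g e.
Proof.
have E : (fun h : R => h^-1 *: (((fun s => g (p + s *: w)) \o shift 0) (h *: 1)
      - g (p + 0 *: w)))
   = (fun h : R => h^-1 *: ((g \o shift p) (h *: w) - g p)).
  apply/funext => h /=; rewrite scale0r !addr0; congr (_ *: (g _ - _)).
  by rewrite [_ *: 1]mulr1 addrC.
by case=> dg vg; split; [move: dg; rewrite /derivable E|move: vg; rewrite /derive E].
Qed.

Lemma is_derive_line0 (V : normedModType R) (g : V -> R) (p w : V) :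
  derivable g p w -> is_derive (0 : R) (1 : R) (fun s => g (p + s *: w)) ('D_w g p).
Proof.
move=> dg; have E : p + 0 *: w = p by rewrite scale0r addr0.
by have := @is_derive_line R V g p w 0; rewrite E; exact.
Qed.

Implicit Types (n : nat).

Section Algebra.
Variables (V : normedModType R) (U : set V).
Hypothesis oU : open U.

Lemma class_C_cst n (k : R) : class_C n U (fun=> k).
Proof.
elim: n k => [|n IH] k; first by split=> // x _; exact: cst_continuous.
split=> [x _|w]; first exact: cst_continuous.
split=> [x _|]; first exact: derivable_cst.
by apply: (class_C_eq oU _ (IH 0)) => x _; rewrite derive_cst.
Qed.

Lemma class_C_add n (f g : V -> R) : class_C n U f -> class_C n U g ->
  class_C n U (fun x => f x + g x).
Proof.
elim: n f g => [|n IH] f g [fC fD] [gC gD].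
  by split=> // x Ux; apply: cvgD; [exact: fC|exact: gC].
split=> [x Ux|w]; first by apply: cvgD; [exact: fC|exact: gC].
have [df Cf] := fD w; have [dg Cg] := gD w.
split=> [x Ux|]; first by apply: derivableD; [exact: df|exact: dg].
apply: (class_C_eq oU _ (IH _ _ Cf Cg)) => x Ux.
by have := deriveD (df _ Ux) (dg _ Ux).
Qed.

Lemma class_C_mul n (f g : V -> R) : class_C n U f -> class_C n U g ->
  class_C n U (fun x => f x * g x).
Proof.
elim: n f g => [|n IH] f g fCn gCn; have [fC fD] := fCn; have [gC gD] := gCn.
  by split=> // x Ux; apply: cvgM; [exact: fC|exact: gC].
split=> [x Ux|w]; first by apply: cvgM; [exact: fC|exact: gC].
have [df Cf] := fD w; have [dg Cg] := gD w.
split=> [x Ux|]; first by apply: derivableM; [exact: df|exact: dg].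
have fn : class_C n U f by exact: class_CW fCn.
have gn : class_C n U g by exact: class_CW gCn.
apply: (class_C_eq oU _ (class_C_add (IH _ _ fn Cg) (IH _ _ gn Cf))) => x Ux.
by have := deriveM (df _ Ux) (dg _ Ux).
Qed.

Lemma class_C_opp n (f : V -> R) : class_C n U f -> class_C n U (fun x => - f x).
Proof.
move=> fC; apply: (class_C_eq oU _ (class_C_mul (class_C_cst n (-1)) fC)) => x _.
by rewrite mulN1r.
Qed.

Lemma class_C_sub n (f g : V -> R) : class_C n U f -> class_C n U g ->
  class_C n U (fun x => f x - g x).
Proof. by move=> fC gC; apply: class_C_add => //; exact: class_C_opp. Qed.

End Algebra.

Lemma class_C_sub_set (V W : normedModType R) n (U U' : set V) (f : V -> W) :
  U' `<=` U -> class_C n U f -> class_C n U' f.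
Proof.
move=> UU; elim: n f => [|n IH] f [fC fD].
  by split=> // x /UU; exact: fC.
split=> [x /UU|w]; first exact: fC.
have [df Cf] := fD w; split=> [x /UU|]; first exact: df.
exact: IH.
Qed.

Lemma class_C_comp (V : normedModType R) n (O : set R) (phi : R -> R) (U : set V)
    (f : V -> R) :
  open U -> class_C n O phi -> class_C n U f -> (forall x, U x -> O (f x)) ->
  class_C n U (fun x => phi (f x)).
Proof.
move=> oU; elim: n phi f => [|n IH] phi f pCn fCn Of;
  have [pC pD] := pCn; have [fC fD] := fCn;
  have cc x : U x -> {for x, continuous (fun x => phi (f x))}.
- by move=> Ux; apply: (cvg_comp f phi (fC _ Ux)); apply: pC; exact: Of.
- by split=> // x Ux; exact: cc.
- by move=> Ux; apply: (cvg_comp f phi (fC _ Ux)); apply: pC; exact: Of.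
split=> [x Ux|w]; first exact: cc.
have [df Cf] := fD w; have [dp Cp] := pD 1.
have D x : U x -> is_derive x w (fun x => phi (f x)) ('D_1 phi (f x) * 'D_w f x).
  move=> Ux; apply: is_derive_along.
  apply: (is_derive_compose (f := phi) (g := fun s : R => f (x + s *: w))).
    by rewrite scale0r addr0; apply: DeriveDef => //; exact: dp (Of _ Ux).
  exact: is_derive_line0 (df _ Ux).
split=> [x Ux|]; first by have [] := D _ Ux.
have fn : class_C n U f by exact: class_CW fCn.
apply: (class_C_eq oU _ (class_C_mul oU (IH _ _ Cp fn Of) Cf)) => x Ux.
by have [_ ->] := D _ Ux.
Qed.

Lemma class_C_real n (O : set R) (phi phi' : R -> R) : open O ->
  (forall x, O x -> is_derive x (1 : R) phi (phi' x)) -> class_C n O phi' ->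
  class_C n.+1 O phi.
Proof.
move=> oO pd pC; split=> [x Ox|w]; first exact: is_derive_continuous (pd _ Ox).
have D x : O x -> is_derive x w phi (phi' x * w).
  move=> Ox; apply: is_derive_along.
  apply: (is_derive_compose (f := phi) (g := fun s : R => x + s *: w)).
    by rewrite scale0r addr0; exact: pd.
  have E : (fun s : R => x + s *: w) = (fun s : R => x + s * w) by [].
  by rewrite E; derive_tac; ring.
split=> [x Ox|]; first by have [] := D _ Ox.
apply: (class_C_eq oO _ (class_C_mul oO pC (class_C_cst oO n w))) => x Ox.
by have [_ ->] := D _ Ox.
Qed.

Lemma class_C0_derive (O : set R) (phi phi' : R -> R) :
  (forall x, O x -> is_derive x (1 : R) phi (phi' x)) -> class_C 0 O phi.
Proof. by move=> pd; split=> // x Ox; exact: is_derive_continuous (pd _ Ox). Qed.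

Lemma class_C_id n (O : set R) : open O -> class_C n O (fun x : R => x).
Proof.
move=> oO; apply: (@class_CW _ _ _ n n.+1) => //.
have D x : O x -> is_derive x (1 : R) (fun x : R => x) ((fun=> 1) x).
  by move=> _; exact: is_derive_ident.
exact: (class_C_real oO D (class_C_cst oO n 1)).
Qed.

Lemma class_C_expR n : class_C n setT (@expR R).
Proof.
have D x : setT x -> is_derive x (1 : R) expR (expR x) by move=> _; exact: is_derive_expR.
elim: n => [|n IH]; first exact: class_C0_derive D.
by apply: class_C_real D IH; exact: openT.
Qed.

Lemma class_C_sin_cos n : class_C n setT (@sin R) /\ class_C n setT (@cos R).
Proof.
have Ds x : setT x -> is_derive x (1 : R) sin (cos x) by move=> _; exact: is_derive_sin.
have Dc x : setT x -> is_derive x (1 : R) cos (- sin x) by move=> _; exact: is_derive_cos.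
elim: n => [|n [IHs IHc]].
  by split; [exact: class_C0_derive Ds|exact: class_C0_derive Dc].
split; first by apply: class_C_real Ds IHc; exact: openT.
by apply: class_C_real Dc _; [exact: openT|apply: class_C_opp => //; exact: openT].
Qed.

Lemma open_nonzero : open [set x : R | x != 0].
Proof. exact: open_neq. Qed.

Lemma class_C_inv n : class_C n [set x : R | x != 0] (fun x => x^-1).
Proof.
have D x : [set x : R | x != 0] x ->
    is_derive x (1 : R) (fun x => x^-1) (- (x^-1 * x^-1)).
  by move=> /= x0; derive_tac => //; field.
elim: n => [|n IH]; first exact: class_C0_derive D.
apply: class_C_real D _; first exact: open_nonzero.
by apply: class_C_opp; [|apply: class_C_mul]; try exact: open_nonzero.
Qed.

Lemma class_C_atan n : class_C n setT (@atan R).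
Proof.
have D x : setT x -> is_derive x (1 : R) atan ((1 + x * x)^-1).
  by move=> _; rewrite -expr2; exact: is_derive1_atan.
apply: (@class_CW _ _ _ n n.+1) => //.
apply: class_C_real D _; first exact: openT.
apply: (class_C_comp (O := [set x : R | x != 0]) openT (class_C_inv n)).
  apply: class_C_add; first exact: openT; first by apply: class_C_cst; exact: openT.
  by apply: class_C_mul; try apply: class_C_id; exact: openT.
by move=> x _ /=; rewrite gt_eqF// ltr_wpDr// -expr2 sqr_ge0.
Qed.

Lemma class_C_ln_norm n : class_C n [set x : R | x != 0] (fun x => ln `|x|).
Proof.
apply: (@class_CW _ _ _ n n.+1) => //.
apply: (class_C_real (phi' := fun x => x^-1) open_nonzero _ (class_C_inv n)).
by move=> x /= x0; exact: is_derive_ln_norm.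
Qed.

Lemma class_C_top n (U : set 'cV[R]_2) i : open U -> class_C n U (fun p => p i 0).
Proof.
move=> oU; have C (p : 'cV[R]_2) : {for p, continuous (fun p : 'cV[R]_2 => p i 0)}.
  exact: coord_continuous.
case: n => [|n]; first by split=> // p _; exact: C.
have D (p w : 'cV[R]_2) : is_derive p w (fun p : 'cV[R]_2 => p i 0) (w i 0).
  apply: is_derive_along.
  have -> : (fun s : R => (p + s *: w) i 0) = (fun s : R => p i 0 + s * w i 0).
    by apply/funext => s; rewrite !mxE.
  by derive_tac; ring.
split=> [p _|w]; first exact: C.
split=> [p _|]; first by have [] := D p w.
by apply: (class_C_eq oU _ (class_C_cst oU n (w i 0))) => p _; have [_ ->] := D p w.
Qed.

(** The inverse is a left inverse on the whole interval V, which gives a global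
    graph; its smoothness is claimed only near the value at v0. If v0 is an
    endpoint of V, the interval is first enlarged by a ball around v0. *)
Lemma smooth_left_inverse (V G : set R) (v0 : R) (X X1 : R -> R) :
  is_interval V -> V v0 -> open G -> V `<=` G ->
  (forall v, G v -> is_derive v (1 : R) X (X1 v)) -> (forall v, G v -> X1 v != 0) ->
  exists (xi : R -> R) (O : set R),
    [/\ open O, O (X v0), (forall v, V v -> xi (X v) = v) &
        forall x, O x -> G (xi x) /\ is_derive x (1 : R) xi (X1 (xi x))^-1].
Proof.
move=> IV Vv0 oG VG Xd X0.
have /nbhs_ballP[e /= e0 BG] : nbhs v0 G.
  by apply: open_nbhs_nbhs; split=> //; exact: VG.
pose B : set R := ball v0 e.
have IB : is_interval B.
  move=> s t Bs Bt x; move: Bs Bt.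
  rewrite /B /ball /= !ltr_distl => /andP[? ?] /andP[? ?] /andP[? ?].
  by apply/andP; split; lra.
have Bv0 : B v0 by exact: ballxx.
have oB : open B by exact: ball_open.
pose V' := V `|` B.
have IV' : is_interval V'.
  move=> s t Vs Vt x /andP[sx xt]; case: (leP x v0) => xv.
    by case: Vs => Vs; [left; apply: (IV s v0)|right; apply: (IB s v0)];
      rewrite ?sx.
  by case: Vt => Vt; [left; apply: (IV v0 t)|right; apply: (IB v0 t)];
    rewrite ?(ltW xv).
have V'G : V' `<=` G by move=> x [/VG|/BG].
pose xi x := xget 0 [set v | V' v /\ X v = x].
have xiK v : V' v -> xi (X v) = v.
  move=> Vv; rewrite /xi; case: xgetP => [y _ [Vy Xy]|/(_ v)/=]; last by case.
  by apply: (injective_on IV' (f := X) (f' := X1)) => // x /V'G; [exact: Xd|exact: X0].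
have nB v : B v -> \forall x \near v, B x by move=> Bv; exact: open_nbhs_nbhs.
have can v : B v -> {near v, cancel X xi}.
  by move=> Bv; apply: filterS (nB _ Bv) => x Bx; apply: xiK; right.
have con v : B v -> {near v, continuous X}.
  by move=> Bv; apply: filterS (nB _ Bv) => x /BG Gx; exact: is_derive_continuous (Xd _ Gx).
exists xi, (X @` B); split.
- rewrite openE => _ [v Bv <-].
  have [xc Xxi] := near_can_continuousAcan_sym (can _ Bv) (con _ Bv).
  have xcv : {for X v, continuous xi} by exact: nbhs_singleton xc.
  have xB : \forall y \near X v, B (xi y).
    by apply: xcv; rewrite xiK; [exact: nB|right].
  by apply: filterS2 Xxi xB => y Xy By; exists (xi y).
- by exists v0.
- by move=> v Vv; apply: xiK; left.
- move=> _ [v Bv <-]; rewrite xiK; last by right.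
  have Gv := BG _ Bv; split=> //.
  exact: is_derive_inverse (can _ Bv) (con _ Bv) (Xd _ Gv) (X0 _ Gv).
Qed.

End ClassCClosure.

(** * The model surfaces *)

Section Backward.
Variable R : realType.

(** Smoothness of F is expressed through its composites with two functions on the
    plane, which is the form needed after a similarity. *)
Definition smooth2 (Om : set (R * R)) (F : R -> R -> R) : Prop :=
  forall (U : set 'cV[R]_2) (f g : 'cV[R]_2 -> R), open U ->
    class_C 3 U f -> class_C 3 U g -> (forall p, U p -> Om (f p, g p)) ->
    class_C 3 U (fun p => F (f p) (g p)).

(** Around its point q the set M is swept out by two curves whose sum satisfies
    the ratio equation, and all of M lies on the graph of one function which is
    smooth near the top view of q. *)
Definition graph_model (a : R) (M : set 'cV[R]_3) (q : 'cV[R]_3) : Prop :=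
  exists (I J : set R) (c d : curve R) (u v : R) (F : R -> R -> R) (Om : set (R * R)),
  [/\ [/\ nondegenerate_interval I, nondegenerate_interval J, I u & J v],
      [/\ curve_jet 2 I c, curve_jet 2 J d, ratio_at a c d u v &
          q = point c u + point d v],
      forall u' v', I u' -> J v' -> M (point c u' + point d v'),
      [/\ open Om, Om (q 0 0, q 1 0) & smooth2 Om F] &
      forall p, M p -> p ord_max 0 = F (p 0 0) (p 1 0)].

(** The graph function of M, pulled back by the similarity, is a graph function
    for S; the curves that sweep out M, pulled back as well, give its Hessian. *)
Lemma constant_ratio_of_model (a : R) (M S : set 'cV[R]_3) (g : simil R) :
  a != 0 -> simil_ok g -> (forall q, M q -> graph_model a M q) ->
  (forall p, S p -> M (simil_map g p)) -> constant_ratio a S.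
Proof.
move=> a0 gk Mq SM p Sp.
have [I [J [c [d [u [v [F [Om [[nI nJ Iu Jv] [cj dj cd qE] MI [oOm Omq sF] FE]]]]]]]]] :=
  Mq _ (SM _ Sp).
pose ax (x : 'cV[R]_2) := linx g (x 0 0) (x 1 0) + b1 g.
pose ay (x : 'cV[R]_2) := liny g (x 0 0) (x 1 0) + b2 g.
pose U := [set x | Om (ax x, ay x)].
pose f x := (F (ax x) (ay x) - (c1 g * x 0 0 + c2 g * x 1 0 + b3 g)) * (c3 g)^-1.
have [h0 k0] := gk.
have affC n W k1 k2 k3 : open W ->
    class_C n W (fun x : 'cV[R]_2 => k1 * x 0 0 + k2 * x 1 0 + k3).
  move=> oW; have kC k : class_C n W (fun=> k) := class_C_cst oW n k.
  exact: (class_C_add oW (class_C_add oW (class_C_mul oW (kC _) (class_C_top n 0 oW))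
    (class_C_mul oW (kC _) (class_C_top n 1 oW))) (kC _)).
have axC n W : open W -> class_C n W ax.
  move=> oW; apply: (class_C_eq oW _
    (affC n W ((-1) ^+ flip g * h1 g) (- ((-1) ^+ flip g * h2 g)) (b1 g) oW)).
  by move=> x _; rewrite /ax /linx mulNr.
have ayC n W : open W -> class_C n W ay.
  by move=> oW; exact: (affC n W (h2 g) (h1 g) (b2 g) oW).
have oU : open U.
  apply: (@open_comp _ _ (fun x => (ax x, ay x)) Om) => // x _.
  have [axc _] := axC 0%N setT openT; have [ayc _] := ayC 0%N setT openT.
  exact: (cvg_pair (axc x Logic.I) (ayc x Logic.I)).
have fC : class_C 3 U f.
  exact: (class_C_mul oU (class_C_sub oU (sF U ax ay oU (axC _ _ oU) (ayC _ _ oU)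
    (fun x Ux => Ux)) (affC _ _ _ _ _ oU)) (class_C_cst oU 3 _)).
have top0 (x : 'cV[R]_3) : (topview x) 0 0 = x 0 0.
  by rewrite [x in LHS]vec3_eta topview_vec3 mxE.
have top1 (x : 'cV[R]_3) : (topview x) 1 0 = x 1 0.
  by rewrite [x in LHS]vec3_eta topview_vec3 mxE.
have fE x : M (simil_map g x) -> height x = f (topview x).
  move=> /FE; rewrite /simil_map !(vec3_0, vec3_1, vec3_2) => E.
  apply: (mulIf k0); rewrite /f divfK// /ax /ay !top0 !top1 -E /height /linz; ring.
have Up : U (topview p).
  by move: Omq; rewrite /U /= /ax /ay !top0 !top1 /simil_map vec3_0 vec3_1.
pose g' := simil_inv g.
pose c' := simil_curve (simil_lin g') c; pose d' := simil_curve g' d.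
have g'k : simil_ok g' by exact: simil_inv_ok.
have pE u' v' : point c' u' + point d' v' = simil_map g' (point c u' + point d v').
  by rewrite simil_sum.
have pcd : p = point c' u + point d' v by rewrite pE -qE simil_mapK.
have tE u' v' : sum_top c' d' u' v' = topview (point c' u' + point d' v').
  by rewrite /point vec3D topview_vec3.
have hE u' v' : sum_height c' d' u' v' = height (point c' u' + point d' v').
  by rewrite /point vec3D height_vec3.
have cd' : ratio_at a c' d' u v by exact: simil_ratio_at.
have fcd : \forall q \near (u, v), I q.1 -> J q.2 ->
    f (sum_top c' d' q.1 q.2) = sum_height c' d' q.1 q.2.
  near=> q' => Iu' Jv'; rewrite tE hE -fE// pE simil_mapVK//.
  exact: MI.
have [|k1 [k2 [ck kk ka]]] := ratio_at_principal a0 nI nJ Iu Jv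
  (simil_curve_jet (simil_lin g') cj) (simil_curve_jet g' dj) oU _ fC fcd cd'.
  by rewrite -/c' -/d' tE -pcd.
exists k1, k2; split; [|by []|by left].
exists f; last by rewrite pcd -tE.
split; first by exists U.
by near=> x => Sx; apply: fE; exact: SM.
Unshelve. all: by end_near. Qed.

Lemma setT_nondegenerate : nondegenerate_interval (@setT R).
Proof. by split; [|exists 0, 1; split => //; exact: ltr01]. Qed.

Lemma paraboloid_model (a : R) q : a != 0 -> paraboloid a q ->
  graph_model a (paraboloid a) q.
Proof.
move=> a0 [u _ [v _ <-]].
pose c := Curve (fun k u => if k is k'.+1 then if k' is _.+1 then 0 else 1 else u)
  (fun _ _ => 0)
  (fun k u => if k is k'.+1 then if k' is _.+1 then 2 * a else 2 * a * u
              else a * u ^+ 2) : curve R.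
pose d := Curve (fun _ _ => 0)
  (fun k v => if k is k'.+1 then if k' is _.+1 then 0 else 1 else v)
  (fun k v => if k is k'.+1 then if k' is _.+1 then 2 else 2 * v
              else v ^+ 2) : curve R.
exists setT, setT, c, d, u, v, (fun x y => y ^+ 2 + a * x ^+ 2), setT; split.
- by split => //; exact: setT_nondegenerate.
- split.
  + by move=> [|[|//]] x _ _; split; rewrite /c /=; derive_tac; ring.
  + by move=> [|[|//]] x _ _; split; rewrite /d /=; derive_tac; ring.
  + by split; rewrite /jac /bend1 /bend2 /speed2 /det3 /=;
      rewrite ?(mul0r, mulr0, mul1r, mulr1, subr0, sub0r, addr0, add0r, oppr0,
        mulf_neq0, oner_eq0, pnatr_eq0) ?mulf_neq0 ?pnatr_eq0//; ring.
  + by rewrite /point /= vec3D addr0 add0r [v ^+ 2 + _]addrC.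
- by move=> x y _ _; exists x => //; exists y => //; rewrite /point /= vec3D addr0 add0r addrC.
- split; [exact: openT|by []|move=> U f g oU fC gC _].
  exact: (class_C_add oU (class_C_mul oU gC gC)
    (class_C_mul oU (class_C_cst oU 3 a) (class_C_mul oU fC fC))).
- by move=> p [x _ [y _ <-]]; rewrite !(vec3_0, vec3_1, vec3_2).
Qed.

Lemma open_ne0 (T : topologicalType) (f : T -> R) :
  continuous f -> open [set x | f x != 0].
Proof.
move=> fc; apply: (@open_comp _ _ f [set x | x != 0]); last exact: open_neq.
by move=> ? _; exact: fc.
Qed.

(** The abscissa v + b cos v is strictly monotone on V, so the curve in the
    horizontal plane is a graph over its abscissa, and the surface is a global
    graph. *)
Lemma exp_surface_model (a : R) (V : set R) q : a != 0 -> a != 1 ->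
  exp_domain a ((a + 1) / (a - 1)) V -> exp_surface ((a + 1) / (a - 1)) V q ->
  graph_model a (exp_surface ((a + 1) / (a - 1)) V) q.
Proof.
move=> a0 a1; have am : a - 1 != 0 by rewrite subr_eq0.
have [b bE] : exists b, b = (a + 1) / (a - 1) by exists ((a + 1) / (a - 1)).
rewrite -bE; move=> [nV VP] [u _ [v Vv <-]].
pose kb := b ^+ 2 - 1; pose k := 1 - b ^+ 2.
have kbE : kb = 4 * a / (a - 1) ^+ 2 by rewrite /kb bE; field.
have abE : 4 * a * b ^+ 2 = (a + 1) ^+ 2 * kb by rewrite kbE bE; field.
have am2 : 0 < (a - 1) ^+ 2 by rewrite exprn_even_gt0.
have k0 : k != 0.
  have kN : - k = kb by rewrite /k /kb; ring.
  rewrite -oppr_eq0 kN kbE.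
  by rewrite !mulf_neq0 ?pnatr_eq0// invr_neq0// expf_neq0.
pose G : set R := [set v | 1 - b * sin v != 0] `&` [set v | b - sin v != 0].
have sinc : continuous (fun v : R => sin v) by move=> x; exact: continuous_sin.
have oG : open G.
  apply: openI; apply: open_ne0 => x; apply: cvgB; try exact: cvg_cst.
    by apply: cvgM; [exact: cvg_cst|exact: sinc].
  exact: sinc.
have VG : V `<=` G.
  move=> x Vx; have [neg pos] := VP _ Vx.
  have s1 : sin x ^+ 2 <= 1 by rewrite -(cos2Dsin2 x) lerDr sqr_ge0.
  case: (ltgtP a 0) a0 => // lt _; split; rewrite /= subr_eq0.
  - apply/eqP => bs; have : kb < 0.
      by rewrite kbE pmulr_llt0 ?invr_gt0// pmulr_rlt0.
    rewrite /kb => kn; have : (b * sin x) ^+ 2 = 1 by rewrite -bs expr1n.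
    by rewrite exprMn => e1; nra.
  - by rewrite eq_sym; exact: neg.
  - by rewrite eq_sym; exact: pos.
  - apply/eqP => bs; have : 0 < kb.
      by rewrite kbE mulr_gt0 ?invr_gt0// mulr_gt0.
    by rewrite /kb bs subr_gt0 ltNge s1.
pose X x := x + b * cos x; pose X1 x := 1 - b * sin x.
have Xd x : G x -> is_derive x (1 : R) X (X1 x).
  by move=> _; rewrite /X /X1; derive_tac; ring.
have X10 x : G x -> X1 x != 0 by case.
have [xi [Om [oO Oq xiK xiP]]] := smooth_left_inverse nV.1 Vv oG VG Xd X10.
have sC n U : open U -> class_C n U (@sin R).
  move=> oU; apply: (class_C_sub_set (U := setT)) => //.
  by have [] := class_C_sin_cos R n.
have X1C n : class_C n G X1.
  have kC c : class_C n G (fun=> c) := class_C_cst oG n c.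
  exact: (class_C_sub oG (kC 1) (class_C_mul oG (kC b) (sC n G oG))).
have X1iC n : class_C n G (fun x => (X1 x)^-1).
  exact: (class_C_comp oG (class_C_inv R n) (X1C n) X10).
have xid x : Om x -> is_derive x (1 : R) xi (X1 (xi x))^-1 by case/xiP.
have xiG x : Om x -> G (xi x) by case/xiP.
have xiC n : class_C n Om xi.
  elim: n => [|n IH]; first exact: class_C0_derive xid.
  exact: (class_C_real oO xid (class_C_comp oO (X1iC n) IH xiG)).
pose Y x := b * sin x + kb * ln `|b - sin x|.
have YC n : class_C n G Y.
  have kC c : class_C n G (fun=> c) := class_C_cst oG n c.
  have bsC : class_C n G (fun x => b - sin x) := class_C_sub oG (kC b) (sC n G oG).
  have lC := class_C_comp oG (class_C_ln_norm R n) bsC (fun x (Gx : G x) => Gx.2).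
  exact: (class_C_add oG (class_C_mul oG (kC b) (sC n G oG)) (class_C_mul oG (kC kb) lC)).
pose w x := cos x / (b - sin x); pose w1 x := X1 x / (b - sin x) ^+ 2.
have wd x : V x -> is_derive x (1 : R) w (w1 x).
  move=> /VG[/= e0 t0]; rewrite /w /w1 /X1.
  have -> : (1 - b * sin x) / (b - sin x) ^+ 2 =
      (- sin x * (b - sin x) + cos x ^+ 2) / (b - sin x) ^+ 2.
    by rewrite cos2sin2; congr (_ / _); ring.
  by derive_tac => //; field.
have Yd x : V x -> is_derive x (1 : R) Y (w x * X1 x).
  move=> /VG[/= e0 t0]; rewrite /Y /w /X1.
  have ld : is_derive x (1 : R) (fun x => ln `|b - sin x|)
      ((b - sin x)^-1 * (- cos x)).
    apply: (is_derive_compose (f := fun z => ln `|z|)).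
      exact: is_derive_ln_norm.
    by derive_tac; ring.
  by derive_tac; rewrite /kb; field.
pose c := Curve (fun _ _ => 0)
  (fun n x => if n is n'.+1 then if n' is _.+1 then 0 else k else k * x)
  (fun _ x => expR x) : curve R.
pose d := Curve
  (fun n x => if n is n'.+1 then if n' is _.+1 then - (b * cos x) else X1 x else X x)
  (fun n x => if n is n'.+1 then if n' is _.+1 then w1 x * X1 x + w x * - (b * cos x)
              else w x * X1 x else Y x)
  (fun _ _ => 0) : curve R.
have X1d x : is_derive x (1 : R) X1 (- (b * cos x)).
  by rewrite /X1; derive_tac; ring.
exists setT, V, c, d, u, v, (fun x y => expR ((y - Y (xi x)) * k^-1)),
  [set q : R * R | Om q.1]; split.
- by split => //; exact: setT_nondegenerate.
- split.
  + by move=> [|[|//]] x _ _; split; rewrite /c /=; derive_tac; ring.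
  + move=> [|[|//]] x _ Vx; have Xx := Xd _ (VG _ Vx); have Yx := Yd _ Vx;
      have wx := wd _ Vx; have X1x := X1d x; split; rewrite /d /= => //.
    * by derive_tac; ring.
    * by derive_tac; ring.
    * by derive_tac; ring.
  + have [/= e0 t0] := VG _ Vv; have E0 := expR_gt0 u.
    have L : bend1 c d u v = - (k * X1 v * expR u) by rewrite /bend1 /det3 /=; ring.
    have N : bend2 c d u v = expR u * (w1 v * X1 v ^+ 2).
      by rewrite /bend2 /det3 /=; ring.
    have jE : jac c d u v = - (k * X1 v) by rewrite /jac /=; ring.
    have X10v : X1 v != 0 by [].
    have w10 : w1 v != 0 by rewrite mulf_neq0// invr_neq0// expf_neq0.
    split; rewrite ?jE ?L ?N ?oppr_eq0.
    * exact: mulf_neq0.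
    * by apply: mulf_neq0; [exact: mulf_neq0|rewrite gt_eqF].
    * by apply: mulf_neq0; [rewrite gt_eqF|apply: mulf_neq0 => //; exact: expf_neq0].
    have -> : speed2 c u = k ^+ 2 by rewrite /speed2 /=; ring.
    have -> : speed2 d v = X1 v ^+ 2 * (1 + w v ^+ 2) by rewrite /speed2 /=; ring.
    have w2 : 1 + w v ^+ 2 = (2 * b * (b - sin v) + k) / (b - sin v) ^+ 2.
      by rewrite /w expr_div_n cos2sin2 /k; field.
    rewrite w2 /w1; move: (X1 v) (expR u) => x1 e.
    transitivity (4 * a * b ^+ 2 * (x1 ^+ 6 * k ^+ 2 * e ^+ 2 / (b - sin v) ^+ 2)).
      by field.
    by rewrite abE /kb /k; field.
  + rewrite /point /= vec3D addr0 add0r [k * u + _]addrC //.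
- move=> x y _ Vy; exists x => //; exists y => //.
  by rewrite /point /= vec3D addr0 add0r [k * x + _]addrC.
- split.
  + by apply: (@open_comp _ _ fst Om) => // x _; exact: cvg_fst.
  + by rewrite /= vec3_0.
  + move=> U f g oU fC gC fO.
    have xf : class_C 3 U (fun p => xi (f p)) := class_C_comp oU (xiC 3%N) fC fO.
    have Yf : class_C 3 U (fun p => Y (xi (f p))).
      exact: (class_C_comp oU (YC 3%N) xf (fun p Up => xiG _ (fO p Up))).
    exact: (class_C_comp oU (class_C_expR R 3) (class_C_mul oU (class_C_sub oU gC Yf)
      (class_C_cst oU 3 k^-1)) (fun _ _ => Logic.I)).
- move=> p [x _ [y Vy <-]]; rewrite !(vec3_0, vec3_1, vec3_2) -/(X y) xiK//.
  by rewrite -/kb -/(Y y) -/k [Y y + _]addrC addrK mulrC mulKf.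
Qed.

(** With x = u + v and exp (- y) = cos v / cos u the addition formulas give
    tan u = (exp (- y) - cos x) / sin x, so the surface is a global graph. *)
Lemma log_cos_surface_model (D : set (R * R)) q : log_cos_domain D ->
  log_cos_surface D q -> graph_model (-1) (log_cos_surface D) q.
Proof.
move=> [oD _ DP] [[u v] Duv <-] /=.
pose T (x : R) : R := sin x / cos x.
have cos0 x : - (pi / 2) < x < pi / 2 -> 0 < cos x :> R by exact: cos_gt0_pihalf.
have TT x y : - (pi / 2) < x < pi / 2 -> - (pi / 2) < y < pi / 2 -> x + y != 0 ->
    T x + T y != 0.
  move=> xp yp; apply: contraNneq => /eqP; rewrite addr_eq0 => /eqP E.
  rewrite addr_eq0; apply/eqP; apply: tan_inj; rewrite ?in_itv//=.
    by move/andP: yp => [? ?]; apply/andP; split; lra.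
  by rewrite tanN -[tan x]/(T x) E.
have sin0 x y : D (x, y) -> sin (x + y) != 0.
  move=> /DP[xp yp xy]; have cx := cos0 _ xp; have cy := cos0 _ yp.
  have -> : sin (x + y) = cos x * cos y * (T x + T y).
    by rewrite sinD /T; field; rewrite !gt_eqF.
  by rewrite mulf_neq0 ?TT// mulf_neq0// gt_eqF.
have [up vp uv0] := DP _ _ Duv.
have /nbhs_ballP[e /= e0 eD] : nbhs (u, v) D by exact: open_nbhs_nbhs.
pose I : set R := setT `&` ball u e; pose J : set R := setT `&` ball v e.
have IJD x y : I x -> J y -> D (x, y) by move=> [_ Bx] [_ By]; apply: eD; split.
have Iu : I u by split => //; exact: ballxx.
have Jv : J v by split => //; exact: ballxx.
have cI x : I x -> cos x != 0.
  by move=> Ix; have [xp _ _] := DP _ _ (IJD _ _ Ix Jv); rewrite gt_eqF// cos0.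
have cJ x : J x -> cos x != 0.
  by move=> Jx; have [_ xp _] := DP _ _ (IJD _ _ Iu Jx); rewrite gt_eqF// cos0.
have Td x : cos x != 0 -> is_derive x (1 : R) T (1 + T x ^+ 2).
  move=> cx; rewrite /T; derive_tac => //.
  by field.
have ld x : cos x != 0 -> is_derive x (1 : R) (fun x => ln `|cos x|) (- T x).
  move=> cx; have lx : is_derive x (1 : R) (fun x => ln `|cos x|)
      ((cos x)^-1 * (- sin x)).
    exact: (is_derive_compose (f := fun z => ln `|z|) (g := cos)
      (is_derive_ln_norm cx) (is_derive_cos x)).
  by apply: (is_derive_congr lx); rewrite /T; ring.
pose c := Curve
  (fun n x => if n is n'.+1 then if n' is _.+1 then 0 else 1 else x)
  (fun n x => if n is n'.+1 then if n' is _.+1 then - (1 + T x ^+ 2) else - T x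
              else ln `|cos x|)
  (fun n x => if n is n'.+1 then if n' is _.+1 then 0 else 1 else x) : curve R.
pose d := Curve
  (fun n x => if n is n'.+1 then if n' is _.+1 then 0 else 1 else x)
  (fun n x => if n is n'.+1 then if n' is _.+1 then 1 + T x ^+ 2 else T x
              else - ln `|cos x|)
  (fun _ _ => 0) : curve R.
have MI x y : D (x, y) -> log_cos_surface D (point c x + point d y).
  by move=> Dxy; exists (x, y) => //; rewrite /point /= vec3D addr0.
exists I, J, c, d, u, v, (fun x y => atan ((expR (- y) - cos x) * (sin x)^-1)),
  [set q : R * R | sin q.1 != 0]; split.
- by split => //; apply: nondegenerate_ball => //; exact: setT_nondegenerate.
- split.
  + move=> [|[|//]] x _ Ix; have lx := ld _ (cI _ Ix); have tx := Td _ (cI _ Ix);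
      split; rewrite /c /=; derive_tac; ring.
  + move=> [|[|//]] x _ Jx; have lx := ld _ (cJ _ Jx); have tx := Td _ (cJ _ Jx);
      split; rewrite /d /=; derive_tac; ring.
  + have t0 (x : R) : 1 + T x ^+ 2 != 0 by rewrite gt_eqF// ltr_wpDr ?sqr_ge0.
    have L : bend1 c d u v = - (1 + T u ^+ 2) by rewrite /bend1 /det3 /=; ring.
    have N : bend2 c d u v = 1 + T v ^+ 2 by rewrite /bend2 /det3 /=; ring.
    have jE : jac c d u v = T u + T v by rewrite /jac /=; ring.
    split; rewrite ?jE ?L ?N ?oppr_eq0//; first exact: TT.
    by rewrite /speed2 /=; ring.
  + by rewrite /point /= vec3D addr0.
- by move=> x y Ix Jy; apply: MI; exact: IJD.
- split.
  + apply: open_ne0 => x; apply: (cvg_comp fst sin); first exact: cvg_fst.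
    exact: continuous_sin.
  + by rewrite /= vec3_0; exact: sin0.
  + move=> U f g oU fC gC f0.
    have [sC cC] := class_C_sin_cos R 3.
    have sf : class_C 3 U (fun p => sin (f p)) :=
      class_C_comp oU sC fC (fun _ _ => Logic.I).
    have cf : class_C 3 U (fun p => cos (f p)) :=
      class_C_comp oU cC fC (fun _ _ => Logic.I).
    have eg : class_C 3 U (fun p => expR (- g p)) :=
      class_C_comp oU (class_C_expR R 3) (class_C_opp oU gC) (fun _ _ => Logic.I).
    have sV : class_C 3 U (fun p => (sin (f p))^-1) :=
      class_C_comp oU (class_C_inv R 3) sf f0.
    exact: (class_C_comp oU (class_C_atan R 3)
      (class_C_mul oU (class_C_sub oU eg cf) sV) (fun _ _ => Logic.I)).
- move=> p [[x y] Dxy <-] /=; rewrite !(vec3_0, vec3_1, vec3_2).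
  have [xp yp xy] := DP _ _ Dxy; have cx := cos0 _ xp; have cy := cos0 _ yp.
  have s0 := sin0 _ _ Dxy.
  rewrite !gtr0_norm// opprB expRB !lnK ?posrE//.
  rewrite -[LHS]tanK ?in_itv//=; congr atan.
  apply: (mulIf s0); rewrite divfK// /tan sinD cosD.
  have cx0 : cos x != 0 by rewrite gt_eqF.
  apply: (mulIf cx0).
  transitivity (sin x ^+ 2 * cos y + sin x * cos x * sin y); first by field.
  by rewrite sin2cos2; field.
Qed.

End Backward.

Theorem theorem23 (R : realType) (a : R) (I J : set R)
    (alpha beta : R -> 'cV[R]_3)
    (ha : a != 0)
    (hS : translational_surface I J alpha beta)
    (hadm : admissible I J alpha beta)
    (hplanar : planar_curve I alpha) :
  let S := translational_set I J alpha beta in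
  (constant_ratio a S <->
   exists M S' : set 'cV[R]_3,
     [/\ model_surface a M, S' `<=` M & isotropic_similar S S']) /\
  (constant_ratio a S -> planar_curve J beta).
Proof.
move=> S; have [[nI nJ] [aC bC] fr _] := hS.
pose c := curve_of alpha; pose d := curve_of beta.
have cj : curve_jet 3 I c by exact: curve_of_jet.
have dj : curve_jet 3 J d by exact: curve_of_jet.
have SE : S = translational_set I J (point c) (point d).
  rewrite /S; congr translational_set; apply/funext => u; by rewrite point_curve_of.
have forward : constant_ratio a S -> fits a I J c d /\ flat J d.
  rewrite SE => rS; apply: (fits_of_ratio ha nI nJ cj dj).
    by apply/planar_curveP.
  apply: (constant_ratio_at nI nJ) rS.
  - exact: curve_jet_leq cj.
  - exact: curve_jet_leq dj.
  - by move=> u v Iu Jv; apply: (jac_neq0 aC bC Iu Jv); [exact: fr|exact: hadm].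
split; last by move=> /forward[_ fl]; apply/planar_curveP.
split=> [/forward[[M [g [mM gk MS]]] _]|[M [S' [mM SM [T /isotropic_similarityP[g gk ->] TS]]]]].
  exists M, (simil_map g @` S); split => //; last first.
    by exists (simil_map g) => //; apply/isotropic_similarityP; exists g.
  move=> _ [_ [u Iu [v Jv <-]] <-].
  by rewrite -[alpha u]point_curve_of -[beta v]point_curve_of; exact: MS.
apply: (constant_ratio_of_model (M := M) ha gk); last first.
  by move=> p Sp; apply: SM; rewrite -TS; exists p.
move=> q Mq; case: mM Mq => [->|[a1 [V dV ->]]|[an1 [D dD ->]]] Mq.
- exact: paraboloid_model.
- exact: exp_surface_model.
- by rewrite an1; exact: log_cos_surface_model.
Qed.
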